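(* For $(d,\mathbb{F})=(5,\mathbb{R})$ and for $(d,\mathbb{F})=(3,\mathbb{H})$, the answers to both of the following questions are ''no''. (Question 1) For all $\varepsilon>0$, does there exist $\delta>0$ so that, for all $n$, given $d$ self-adjoint contractions $H_1,\dots,H_d$ in $\mathbf{M}_n(\mathbb{F})$ such that $\|[H_r,H_s]\|\le\delta$ for all $r,s$, there exist $d$ self-adjoint contractions $K_1,\dots,K_d$ in $\mathbf{M}_n(\mathbb{F})$ with $\|K_r-H_r\|\le\varepsilon$ for all $r$ and $[K_r,K_s]=0$ for all $r,s$? (Question 2) Does every $*$-homomorphism of the form $$\psi:S^{d-1}\mathbb{R}\to\left.\prod_{n=1}^\infty\mathbf{M}_{m(n)}(\mathbb{F})\right/\bigoplus_{n=1}^\infty\mathbf{M}_{m(n)}(\mathbb{F}),$$ where $\{m(n)\}_{n=1}^\infty$ is a sequence of positive integers, lift to a $*$-homomorphism $\tilde\psi:S^{d-1}\mathbb{R}\to\prod_{n=1}^\infty\mathbf{M}_{m(n)}(\mathbb{F})$ such that $\psi=\pi\circ\tilde\psi$?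
   Context: $\mathbb{H}$ is the algebra of quaternions. $\mathbf{M}_n(\mathbb{F})$ carries the conjugate-transpose involution and the operator norm, making it an $R^*$-algebra (real $C^*$-algebra); $[X,Y]=XY-YX$; a contraction is an element of norm at most 1. For a sequence $B_n$ of $R^*$-algebras, $\prod_n B_n$ is the algebra of norm-bounded sequences, $\bigoplus_n B_n$ is the ideal of sequences tending to $0$ in norm, and $\pi$ is the quotient map $\prod_n B_n\to\prod_n B_n/\bigoplus_n B_n$. $S^{d-1}\mathbb{R}=C_0(\mathbb{R}^{d-1},\mathbb{R})$ is the $(d-1)$-fold suspension of $\mathbb{R}$. $*$-homomorphisms are $\mathbb{R}$-linear. *)

(* Defs.v *)
From HB Require Import structures.
From mathcomp Require Import all_boot all_order all_algebra.
From mathcomp Require Import ring lra.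
From mathcomp Require Import all_classical all_reals all_analysis.

Set Implicit Arguments.
Unset Strict Implicit.
Unset Printing Implicit Defensive.

Import Order.TTheory GRing.Theory Num.Theory.
Import numFieldNormedType.Exports.

Local Open Scope classical_set_scope.
Local Open Scope ring_scope.

(* Real algebras with a conjugation and a multiplicative modulus; the two     *)
(* instances are R^o and quat R.                                              *)
HB.mixin Record isConjScalar (R : realType) F of GRing.Algebra R F := {
  conjs : F -> F;
  modulus : F -> R;
  conjsD : {morph conjs : x y / x + y};
  conjsM : forall x y, conjs (x * y) = conjs y * conjs x;
  conjsK : involutive conjs;
  conjsZ : forall (t : R) x, conjs (t *: x) = t *: conjs x;
  conjs_mul : forall x, conjs x * x = (modulus x ^+ 2)%:A;
  modulus_ge0 : forall x, 0 <= modulus x;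
  modulus_eq0 : forall x, modulus x = 0 -> x = 0;
  modulusD : forall x y, modulus (x + y) <= modulus x + modulus y;
  modulusM : {morph modulus : x y / x * y};
  modulusZ : forall (t : R) x, modulus (t *: x) = `|t| * modulus x
}.

#[short(type="conjScalarType")]
HB.structure Definition ConjScalar (R : realType) :=
  {F of isConjScalar R F & GRing.Algebra R F}.

Section RealScalars.
Variable R : realType.

Let conjrM (x y : R^o) : id (x * y) = id y * id x.
Proof. exact: mulrC. Qed.

Let conjr_mul (x : R^o) : id x * x = ((`|x| : R) ^+ 2)%:A.
Proof. by rewrite /= real_normK ?num_real// expr2 /GRing.scale/= mulr1. Qed.

Let normr_eq0_imp (x : R^o) : (`|x| : R) = 0 -> x = 0.
Proof. by move/eqP; rewrite normr_eq0 => /eqP. Qed.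

HB.instance Definition _ := isConjScalar.Build R R^o
  (fun _ _ => erefl) conjrM (fun _ => erefl) (fun _ _ => erefl)
  conjr_mul (@normr_ge0 R R) normr_eq0_imp (@ler_normD R R)
  (@normrM R) (@normrM R).
End RealScalars.

Record quat (R : Type) := Quat { qre : R; qi : R; qj : R; qk : R }.

Section Quaternions.
Variable R : realType.
Implicit Types (x y z : quat R) (t u : R).

HB.instance Definition _ := gen_eqMixin (quat R).
HB.instance Definition _ := gen_choiceMixin (quat R).

Let qadd x y :=
  Quat (qre x + qre y) (qi x + qi y) (qj x + qj y) (qk x + qk y).
Let qopp x := Quat (- qre x) (- qi x) (- qj x) (- qk x).
Let qzero : quat R := Quat 0 0 0 0.
Let qone : quat R := Quat 1 0 0 0.
Let qmul x y :=
  let: Quat a b c d := x in let: Quat a' b' c' d' := y in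
  Quat (a * a' - b * b' - c * c' - d * d')
       (a * b' + b * a' + c * d' - d * c')
       (a * c' - b * d' + c * a' + d * b')
       (a * d' + b * c' - c * b' + d * a').
Let qscale t x := Quat (t * qre x) (t * qi x) (t * qj x) (t * qk x).
Let qconj x := Quat (qre x) (- qi x) (- qj x) (- qk x).
Let qsq x := qre x ^+ 2 + qi x ^+ 2 + qj x ^+ 2 + qk x ^+ 2.
Let qnorm x := Num.sqrt (qsq x).

Let qaddA : associative qadd.
Proof. by move=> [????] [????] [????]; congr Quat => /=; ring. Qed.
Let qaddC : commutative qadd.
Proof. by move=> [????] [????]; congr Quat => /=; ring. Qed.
Let qadd0 : left_id qzero qadd.
Proof. by move=> [????]; congr Quat => /=; ring. Qed.
Let qaddN : left_inverse qzero qopp qadd.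
Proof. by move=> [????]; congr Quat => /=; ring. Qed.

HB.instance Definition _ :=
  GRing.isZmodule.Build (quat R) qaddA qaddC qadd0 qaddN.

Let qmulA : associative qmul.
Proof. by move=> [????] [????] [????]; congr Quat => /=; ring. Qed.
Let qmul1l : left_id qone qmul.
Proof. by move=> [????]; congr Quat => /=; ring. Qed.
Let qmul1r : right_id qone qmul.
Proof. by move=> [????]; congr Quat => /=; ring. Qed.
Let qmulDl : left_distributive qmul +%R.
Proof. by move=> [????] [????] [????]; congr Quat => /=; ring. Qed.
Let qmulDr : right_distributive qmul +%R.
Proof. by move=> [????] [????] [????]; congr Quat => /=; ring. Qed.
Let qone_neq0 : qone != 0.
Proof. by apply/eqP => -[] /eqP; rewrite oner_eq0. Qed.

HB.instance Definition _ := GRing.Zmodule_isNzRing.Build (quat R)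
  qmulA qmul1l qmul1r qmulDl qmulDr qone_neq0.

Let qscaleA t u x : qscale t (qscale u x) = qscale (t * u) x.
Proof. by congr Quat => /=; ring. Qed.
Let qscale1 : left_id 1 qscale.
Proof. by move=> [????]; congr Quat => /=; ring. Qed.
Let qscaleDr : right_distributive qscale +%R.
Proof. by move=> t [????] [????]; congr Quat => /=; ring. Qed.
Let qscaleDl x : {morph qscale^~ x : t u / t + u}.
Proof. by case: x => [????] t u; congr Quat => /=; ring. Qed.

HB.instance Definition _ := GRing.Zmodule_isLmodule.Build R (quat R)
  qscaleA qscale1 qscaleDr qscaleDl.

Let qscaleAl t x y : t *: (x * y) = t *: x * y.
Proof. by case: x y => [????] [????]; congr Quat => /=; ring. Qed.
HB.instance Definition _ := GRing.Lmodule_isLalgebra.Build R (quat R) qscaleAl.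

Let qscaleAr t x y : t *: (x * y) = x * (t *: y).
Proof. by case: x y => [????] [????]; congr Quat => /=; ring. Qed.
HB.instance Definition _ := GRing.Lalgebra_isAlgebra.Build R (quat R) qscaleAr.

Let qsq_ge0 x : 0 <= qsq x.
Proof. by rewrite /qsq; nra. Qed.

Let qnormD x y : qnorm (x + y) <= qnorm x + qnorm y.
Proof.
rewrite -ler_sqr ?nnegrE ?addr_ge0 ?sqrtr_ge0// sqrrD !sqr_sqrtr ?qsq_ge0//.
suff dot_le : qre x * qre y + qi x * qi y + qj x * qj y + qk x * qk y <=
    qnorm x * qnorm y.
  rewrite -subr_ge0 in dot_le; rewrite -subr_ge0 /qsq /=.
  rewrite (_ : _ - _ = (qnorm x * qnorm y - (qre x * qre y + qi x * qi y
    + qj x * qj y + qk x * qk y)) *+ 2); first by rewrite mulrn_wge0.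
  by rewrite /qsq/=; ring.
rewrite (le_trans (ler_norm _))// -ler_sqr ?nnegrE ?mulr_ge0 ?sqrtr_ge0//.
rewrite exprMn !sqr_sqrtr ?qsq_ge0// real_normK ?num_real// /qsq.
case: x y => [a b c d] [a' b' c' d'] /=.
rewrite -subr_ge0 (_ : _ - _ = (a * b' - b * a') ^+ 2 + (a * c' - c * a') ^+ 2
  + (a * d' - d * a') ^+ 2 + (b * c' - c * b') ^+ 2 + (b * d' - d * b') ^+ 2
  + (c * d' - d * c') ^+ 2); last by ring.
by rewrite !addr_ge0 ?sqr_ge0.
Qed.

Let qnorm_eq0 x : qnorm x = 0 -> x = 0.
Proof.
move=> /eqP; rewrite sqrtr_eq0 /qsq; case: x => a b c d /= h.
by congr Quat; apply/eqP; rewrite -sqrf_eq0; apply/eqP; nra.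
Qed.

Let qnormZ t x : qnorm (t *: x) = `|t| * qnorm x.
Proof.
rewrite -sqrtr_sqr -sqrtrM ?sqr_ge0//; congr Num.sqrt.
by rewrite /qsq /=; ring.
Qed.

Let qconjD : {morph qconj : x y / x + y}.
Proof. by move=> [????] [????]; congr Quat => /=; ring. Qed.
Let qconjM x y : qconj (x * y) = qconj y * qconj x.
Proof. by case: x y => [????] [????]; congr Quat => /=; ring. Qed.
Let qconjK : involutive qconj.
Proof. by move=> [????]; congr Quat => /=; ring. Qed.
Let qconjZ t x : qconj (t *: x) = t *: qconj x.
Proof. by congr Quat => /=; ring. Qed.
Let qconj_mul x : qconj x * x = (qnorm x ^+ 2)%:A.
Proof.
rewrite sqr_sqrtr//.
by case: x => [????]; rewrite /qsq; congr Quat => /=; ring.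
Qed.
Let qnormM x y : qnorm (x * y) = qnorm x * qnorm y.
Proof.
rewrite -sqrtrM//; congr Num.sqrt.
by case: x y => [????] [????]; rewrite /qsq/=; ring.
Qed.

HB.instance Definition _ := isConjScalar.Build R (quat R)
  qconjD qconjM qconjK qconjZ qconj_mul (fun x => sqrtr_ge0 _) qnorm_eq0
  qnormD qnormM qnormZ.
End Quaternions.

(* No unit is assumed: C0 below has none. *)
HB.mixin Record isStarAlgebra (R : realType) A of GRing.Lmodule R A := {
  amul : A -> A -> A;
  star : A -> A;
  amulA : associative amul;
  amulDl : left_distributive amul +%R;
  amulDr : right_distributive amul +%R;
  amulZl : forall (t : R) a b, amul (t *: a) b = t *: amul a b;
  amulZr : forall (t : R) a b, amul a (t *: b) = t *: amul a b;
  starD : {morph star : a b / a + b};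
  starZ : forall (t : R) a, star (t *: a) = t *: star a;
  starM : forall a b, star (amul a b) = amul (star b) (star a);
  starK : involutive star
}.

#[short(type="starAlgType")]
HB.structure Definition StarAlgebra (R : realType) :=
  {A of isStarAlgebra R A & GRing.Lmodule R A}.

Infix "⋆" := amul (at level 40, left associativity) : ring_scope.

(* The part of the R*-algebra axioms needed to form norm-bounded sequences    *)
(* and null sequences; completeness and invertibility of 1 + a* a are not     *)
(* included.                                                                  *)
HB.mixin Record isNormedStarAlgebra (R : realType) A of StarAlgebra R A := {
  anorm : A -> R;
  anorm_ge0 : forall a, 0 <= anorm a;
  anorm_eq0 : forall a, anorm a = 0 -> a = 0;
  anormD : forall a b, anorm (a + b) <= anorm a + anorm b;
  anormZ : forall (t : R) a, anorm (t *: a) = `|t| * anorm a;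
  anormM : forall a b, anorm (a ⋆ b) <= anorm a * anorm b;
  cstar_norm : forall a, anorm (star a ⋆ a) = anorm a ^+ 2
}.

#[short(type="normedStarAlgType")]
HB.structure Definition NormedStarAlgebra (R : realType) :=
  {A of isNormedStarAlgebra R A & StarAlgebra R A}.

Notation "`‖ a ‖" := (anorm a) (at level 0, a at level 99, format "`‖ a ‖") :
  ring_scope.

Section NormedStarAlgebraTheory.
Variables (R : realType) (A : normedStarAlgType R).
Implicit Types a b c : A.

Lemma starB : {morph (star : A -> A) : a b / a - b}.
Proof. by move=> a b; rewrite starD -scaleN1r starZ scaleN1r. Qed.

Lemma amulBl a b c : (a - b) ⋆ c = a ⋆ c - b ⋆ c.
Proof. by rewrite amulDl -scaleN1r amulZl scaleN1r. Qed.

Lemma amulBr a b c : c ⋆ (a - b) = c ⋆ a - c ⋆ b.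
Proof. by rewrite amulDr -scaleN1r amulZr scaleN1r. Qed.

Lemma anorm0 : `‖(0 : A)‖ = 0.
Proof. by rewrite -(scale0r (0 : A)) anormZ normr0 mul0r. Qed.

Lemma anormN a : `‖- a‖ = `‖a‖.
Proof. by rewrite -scaleN1r anormZ normrN1 mul1r. Qed.

Lemma anormB a b : `‖a - b‖ <= `‖a‖ + `‖b‖.
Proof. by rewrite (le_trans (anormD _ _))// anormN. Qed.

Lemma anorm_star a : `‖star a‖ = `‖a‖.
Proof.
have norm_le b : `‖b‖ <= `‖star b‖.
  have [b0|b0] := eqVneq `‖b‖ 0; first by rewrite b0 anorm_ge0.
  rewrite -(ler_pM2r (_ : 0 < `‖b‖)) ?lt0r ?b0 ?anorm_ge0//.
  by rewrite -expr2 -cstar_norm anormM.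
by apply/eqP; rewrite eq_le norm_le andbT -[X in _ <= `‖X‖]starK norm_le.
Qed.

End NormedStarAlgebraTheory.

Definition is_star_hom (R : realType) (A B : starAlgType R) (phi : A -> B) :=
  [/\ forall (t : R) a b, phi (t *: a + b) = t *: phi a + phi b,
      forall a b, phi (a ⋆ b) = phi a ⋆ phi b
    & forall a, phi (star a) = star (phi a)].

Section EuclideanNorm.
Variables (R : realType) (F : conjScalarType R).

Definition vnorm n (x : 'cV[F]_n) : R :=
  Num.sqrt (\sum_i modulus (x i 0) ^+ 2).

(* Matrices act on the left of columns, i.e. F^n is a right F-module. *)
Definition opnorm n (a : 'M[F]_n) : R :=
  sup [set vnorm (a *m x) | x in [set x : 'cV[F]_n | vnorm x <= 1]].

Lemma conjs0 : conjs (0 : F) = 0.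
Proof. by apply: (addrI (conjs (0 : F))); rewrite -conjsD !addr0. Qed.

Lemma conjs_sum I (r : seq I) (P : pred I) (G : I -> F) :
  conjs (\sum_(i <- r | P i) G i) = \sum_(i <- r | P i) conjs (G i).
Proof. exact: (big_morph _ (@conjsD R F) conjs0). Qed.

Lemma modulus0 : modulus (0 : F) = 0.
Proof. by rewrite -(scale0r (0 : F)) modulusZ normr0 mul0r. Qed.

Lemma modulus1 : modulus (1 : F) = 1.
Proof.
have m1 : modulus (1 : F) != 0.
  by apply/eqP => /modulus_eq0 /eqP; rewrite oner_eq0.
by apply: (mulfI m1); rewrite -modulusM !mulr1.
Qed.

Lemma modulusA (t : R) : modulus (t%:A : F) = `|t|.
Proof. by rewrite modulusZ modulus1 mulr1. Qed.

Lemma modulus_conjs (x : F) : modulus (conjs x) = modulus x.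
Proof.
have [->|x0] := eqVneq x 0; first by rewrite conjs0.
have m0 : modulus x != 0.
  by apply: contra x0 => /eqP /modulus_eq0 ->.
apply: (mulIf m0); rewrite -modulusM conjs_mul modulusA -expr2.
by rewrite ger0_norm ?sqr_ge0.
Qed.

Lemma modulus_sum I (r : seq I) (P : pred I) (G : I -> F) :
  modulus (\sum_(i <- r | P i) G i) <= \sum_(i <- r | P i) modulus (G i).
Proof.
elim/big_rec2: _ => [|i y x _ le_xy]; first by rewrite modulus0.
by rewrite (le_trans (modulusD _ _))// lerD2l.
Qed.

Lemma vnorm_ge0 n (x : 'cV[F]_n) : 0 <= vnorm x.
Proof. exact: sqrtr_ge0. Qed.

Lemma vnorm_sqr n (x : 'cV[F]_n) :
  vnorm x ^+ 2 = \sum_i modulus (x i 0) ^+ 2.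
Proof. by rewrite sqr_sqrtr// sumr_ge0// => i _; rewrite sqr_ge0. Qed.

Lemma vnorm0 n : vnorm (0 : 'cV[F]_n) = 0.
Proof.
by rewrite /vnorm big1 ?sqrtr0// => i _; rewrite mxE modulus0 expr0n.
Qed.

Lemma vnorm_eq0 n (x : 'cV[F]_n) : vnorm x = 0 -> x = 0.
Proof.
move=> x0; apply/colP => i; rewrite mxE; apply: (@modulus_eq0 R).
have /psumr_eq0P/(_ i isT)/eqP : \sum_i modulus (x i 0) ^+ 2 = 0.
  by rewrite -vnorm_sqr x0 expr0n.
by rewrite sqrf_eq0 => h; apply/eqP/h => j _; rewrite sqr_ge0.
Qed.

Lemma vnormZ n (t : R) (x : 'cV[F]_n) :
  vnorm (map_mx ( *:%R t) x) = `|t| * vnorm x.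
Proof.
rewrite -sqrtr_sqr -sqrtrM ?sqr_ge0// mulr_sumr; congr Num.sqrt.
by apply: eq_bigr => i _; rewrite mxE modulusZ exprMn real_normK ?num_real.
Qed.

Lemma cauchy_schwarz n (x y : 'cV[F]_n) :
  \sum_i modulus (x i 0) * modulus (y i 0) <= vnorm x * vnorm y.
Proof.
have [x0|x0] := eqVneq (vnorm x) 0.
  rewrite x0 mul0r big1// => i _.
  by rewrite (vnorm_eq0 x0) mxE modulus0 mul0r.
have [y0|y0] := eqVneq (vnorm y) 0.
  rewrite y0 mulr0 big1// => i _.
  by rewrite (vnorm_eq0 y0) mxE modulus0 mulr0.
have xy0 : 0 < vnorm x * vnorm y by rewrite mulr_gt0// lt0r vnorm_ge0 ?x0 ?y0.
rewrite -(ler_pM2l (_ : 0 < vnorm x * vnorm y *+ 2)); last first.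
  by rewrite pmulrn_lgt0.
have -> : vnorm x * vnorm y *+ 2 * (vnorm x * vnorm y) =
    vnorm y ^+ 2 * (\sum_i modulus (x i 0) ^+ 2) +
    vnorm x ^+ 2 * (\sum_i modulus (y i 0) ^+ 2).
  by rewrite -!vnorm_sqr; ring.
rewrite !mulr_sumr -big_split/=.
apply: ler_sum => i _; rewrite -subr_ge0.
rewrite (_ : _ - _ = (vnorm y * modulus (x i 0) - vnorm x * modulus (y i 0))
  ^+ 2) ?sqr_ge0//.
by ring.
Qed.

Lemma vnormD n (x y : 'cV[F]_n) : vnorm (x + y) <= vnorm x + vnorm y.
Proof.
rewrite -ler_sqr ?nnegrE ?addr_ge0 ?vnorm_ge0// sqrrD !vnorm_sqr.
rewrite (@le_trans _ _ (\sum_i (modulus (x i 0) + modulus (y i 0)) ^+ 2))//.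
  apply: ler_sum => i _; rewrite mxE ler_sqr ?nnegrE ?addr_ge0 ?modulus_ge0//.
  exact: modulusD.
under eq_bigr do rewrite sqrrD.
by rewrite !big_split/= lerD2r lerD2l [leRHS]mulr2n lerD// cauchy_schwarz.
Qed.

Lemma vnorm_bounded n (a : 'M[F]_n) :
  exists2 C : R, 0 <= C & forall x : 'cV[F]_n, vnorm (a *m x) <= C * vnorm x.
Proof.
pose s i := Num.sqrt (\sum_j modulus (a i j) ^+ 2).
exists (Num.sqrt (\sum_i s i ^+ 2)) => [|x]; first exact: sqrtr_ge0.
rewrite -ler_sqr ?nnegrE ?mulr_ge0 ?sqrtr_ge0// exprMn vnorm_sqr.
rewrite [X in X * _]sqr_sqrtr; last first.
  by rewrite sumr_ge0// => i _; rewrite sqr_ge0.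
rewrite mulr_suml; apply: ler_sum => i _.
rewrite -exprMn ler_sqr ?nnegrE ?mulr_ge0 ?sqrtr_ge0 ?modulus_ge0//.
rewrite mxE (le_trans (modulus_sum _ _ _))//.
have := cauchy_schwarz (\col_j a i j) x.
under eq_bigr do rewrite mxE -modulusM; move=> /le_trans; apply.
by rewrite /vnorm; under eq_bigr do rewrite mxE.
Qed.

Lemma opnorm_has_sup n (a : 'M[F]_n) :
  has_sup [set vnorm (a *m x) | x in [set x : 'cV[F]_n | vnorm x <= 1]].
Proof.
split.
  by exists (vnorm (a *m 0)), 0 => //=; rewrite vnorm0 ler01.
have [C C0 aC] := vnorm_bounded a.
exists C => _ [x /= x1 <-]; rewrite (le_trans (aC x))//.
by rewrite -[leRHS]mulr1 ler_wpM2l.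
Qed.

Lemma opnorm_ge0 n (a : 'M[F]_n) : 0 <= opnorm a.
Proof.
apply: sup_upper_bound; first exact: opnorm_has_sup.
by exists 0 => /=; rewrite ?mulmx0 vnorm0 ?ler01.
Qed.

Lemma mulmx_realZ n (t : R) (a : 'M[F]_n) (x : 'cV[F]_n) :
  a *m map_mx ( *:%R t) x = map_mx ( *:%R t) (a *m x).
Proof.
apply/colP => i; rewrite !mxE scaler_sumr; apply: eq_bigr => j _.
by rewrite mxE scalerAr.
Qed.

Lemma opnormP n (a : 'M[F]_n) (x : 'cV[F]_n) :
  vnorm (a *m x) <= opnorm a * vnorm x.
Proof.
have [x0|x0] := eqVneq (vnorm x) 0.
  by rewrite (vnorm_eq0 x0) mulmx0 vnorm0 mulr0.
have x_gt0 : 0 < vnorm x by rewrite lt0r x0 vnorm_ge0.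
rewrite -ler_pdivrMr// mulrC.
have -> : (vnorm x)^-1 * vnorm (a *m x) =
    vnorm (a *m map_mx ( *:%R (vnorm x)^-1) x).
  by rewrite mulmx_realZ vnormZ ger0_norm ?invr_ge0 ?vnorm_ge0.
apply: sup_upper_bound; first exact: opnorm_has_sup.
exists (map_mx ( *:%R (vnorm x)^-1) x) => //=.
by rewrite vnormZ ger0_norm ?invr_ge0 ?vnorm_ge0// mulVf.
Qed.

Lemma opnorm_le n (a : 'M[F]_n) (C : R) : 0 <= C ->
  (forall x : 'cV[F]_n, vnorm (a *m x) <= C * vnorm x) -> opnorm a <= C.
Proof.
move=> C0 aC; apply: ge_sup; first by have [] := opnorm_has_sup a.
by move=> _ [x /= x1 <-]; rewrite (le_trans (aC x))// -[leRHS]mulr1 ler_wpM2l.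
Qed.

Lemma opnorm_eq0 n (a : 'M[F]_n) : opnorm a = 0 -> a = 0.
Proof.
move=> a0; apply/matrixP => i j; rewrite mxE.
have /colP/(_ i) : a *m delta_mx j 0 = 0 :> 'cV[F]_n.
  apply: vnorm_eq0; apply/eqP; rewrite eq_le vnorm_ge0 andbT.
  by rewrite (le_trans (opnormP _ _))// a0 mul0r.
by rewrite -colE !mxE.
Qed.

Lemma opnormD n (a b : 'M[F]_n) : opnorm (a + b) <= opnorm a + opnorm b.
Proof.
apply: opnorm_le => [|x]; first by rewrite addr_ge0 ?opnorm_ge0.
by rewrite mulmxDl (le_trans (vnormD _ _))// mulrDl lerD// opnormP.
Qed.

Lemma opnormM n (a b : 'M[F]_n) : opnorm (a *m b) <= opnorm a * opnorm b.
Proof.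
apply: opnorm_le => [|x]; first by rewrite mulr_ge0 ?opnorm_ge0.
rewrite -mulmxA (le_trans (opnormP _ _))// -mulrA.
by rewrite ler_wpM2l ?opnorm_ge0// opnormP.
Qed.

Lemma opnormZ n (t : R) (a : 'M[F]_n) :
  opnorm (map_mx ( *:%R t) a) = `|t| * opnorm a.
Proof.
have mulZ (u : R) (b : 'M[F]_n) (x : 'cV[F]_n) :
    map_mx ( *:%R u) b *m x = map_mx ( *:%R u) (b *m x).
  apply/colP => i; rewrite !mxE scaler_sumr; apply: eq_bigr => j _.
  by rewrite mxE scalerAl.
have leZ (u : R) (b : 'M[F]_n) : opnorm (map_mx ( *:%R u) b) <= `|u| * opnorm b.
  apply: opnorm_le => [|x]; first by rewrite mulr_ge0 ?opnorm_ge0.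
  by rewrite mulZ vnormZ -mulrA ler_wpM2l// opnormP.
apply/eqP; rewrite eq_le leZ/=.
have [->|t0] := eqVneq t 0; first by rewrite normr0 mul0r opnorm_ge0.
rewrite -ler_pdivlMl ?normr_gt0// -normfV.
rewrite [X in opnorm X <= _](_ : a =
  map_mx ( *:%R t^-1) (map_mx ( *:%R t) a)) ?leZ//.
by apply/matrixP => i j; rewrite !mxE scalerA mulVf ?scale1r.
Qed.

Definition adjmx m n (a : 'M[F]_(m, n)) : 'M[F]_(n, m) := (map_mx conjs a)^T.

Lemma adjmxM m n p (a : 'M[F]_(m, n)) (b : 'M[F]_(n, p)) :
  adjmx (a *m b) = adjmx b *m adjmx a.
Proof.
apply/matrixP => i j; rewrite !mxE conjs_sum; apply: eq_bigr => k _.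
by rewrite !mxE conjsM.
Qed.

Lemma adjmxK m n : cancel (@adjmx m n) (@adjmx n m).
Proof. by move=> a; apply/matrixP => i j; rewrite !mxE conjsK. Qed.

Lemma adjmx_dot n (x : 'cV[F]_n) :
  modulus ((adjmx x *m x) 0 0) = vnorm x ^+ 2.
Proof.
rewrite vnorm_sqr mxE -[RHS]ger0_norm ?sumr_ge0// => [|i _]; last first.
  by rewrite sqr_ge0.
rewrite -modulusA scaler_suml; congr modulus; apply: eq_bigr => i _.
by rewrite !mxE conjs_mul.
Qed.

Lemma adjmx_dot_le n (x y : 'cV[F]_n) :
  modulus ((adjmx x *m y) 0 0) <= vnorm x * vnorm y.
Proof.
rewrite mxE (le_trans (modulus_sum _ _ _))//.
rewrite (le_trans _ (cauchy_schwarz _ _))//; apply: ler_sum => i _.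
by rewrite !mxE modulusM modulus_conjs.
Qed.

Lemma opnorm_cstar n (a : 'M[F]_n) :
  opnorm (adjmx a *m a) = opnorm a ^+ 2.
Proof.
have sqr_le (b : 'M[F]_n) : opnorm b ^+ 2 <= opnorm (adjmx b *m b).
  rewrite -[leRHS]sqr_sqrtr ?opnorm_ge0// ler_sqr ?nnegrE ?sqrtr_ge0//
    ?opnorm_ge0//.
  apply: opnorm_le => [|x]; first exact: sqrtr_ge0.
  rewrite -ler_sqr ?nnegrE ?mulr_ge0 ?sqrtr_ge0 ?vnorm_ge0//.
  rewrite exprMn (sqr_sqrtr (opnorm_ge0 _)) -adjmx_dot adjmxM -mulmxA.
  rewrite (le_trans (adjmx_dot_le _ _))// mulmxA.
  by rewrite expr2 mulrCA ler_wpM2l ?vnorm_ge0// opnormP.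
have adj_le (b : 'M[F]_n) : opnorm b <= opnorm (adjmx b).
  have [b0|b0] := eqVneq (opnorm b) 0; first by rewrite b0 opnorm_ge0.
  rewrite -(ler_pM2r (_ : 0 < opnorm b)) ?lt0r ?b0 ?opnorm_ge0//.
  by rewrite -expr2 (le_trans (sqr_le _))// opnormM.
apply/eqP; rewrite eq_le sqr_le andbT (le_trans (opnormM _ _))//.
by rewrite expr2 ler_wpM2r ?opnorm_ge0// -[X in _ <= opnorm X]adjmxK adj_le.
Qed.

End EuclideanNorm.

(* A copy of 'M[F]_n carrying the real algebra structure and the operator     *)
(* norm, rather than the library's F-module structure and entrywise norm.     *)
Definition mxalg (R : realType) (F : conjScalarType R) (n : nat) : Type :=
  'M[F]_n.

Section MatrixAlgebra.
Variables (R : realType) (F : conjScalarType R) (n : nat).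
Implicit Types (a b c : mxalg F n) (t u : R).

HB.instance Definition _ := GRing.Zmodule.copy (mxalg F n) 'M[F]_n.

Let mscale t a : mxalg F n := map_mx ( *:%R t) (a : 'M[F]_n).
Let mscaleA t u a : mscale t (mscale u a) = mscale (t * u) a.
Proof. by apply/matrixP => i j; rewrite !mxE scalerA. Qed.
Let mscale1 : left_id 1 mscale.
Proof. by move=> a; apply/matrixP => i j; rewrite !mxE scale1r. Qed.
Let mscaleDr : right_distributive mscale +%R.
Proof. by move=> t a b; apply/matrixP => i j; rewrite !mxE scalerDr. Qed.
Let mscaleDl a : {morph mscale^~ a : t u / t + u}.
Proof. by move=> t u; apply/matrixP => i j; rewrite !mxE scalerDl. Qed.

HB.instance Definition _ := GRing.Zmodule_isLmodule.Build R (mxalg F n)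
  mscaleA mscale1 mscaleDr mscaleDl.

Let mmul a b : mxalg F n := (a : 'M[F]_n) *m (b : 'M[F]_n).
Let mstar a : mxalg F n := adjmx a.

Let mmulDl : left_distributive mmul +%R.
Proof. by move=> a b c; exact: mulmxDl. Qed.
Let mmulDr : right_distributive mmul +%R.
Proof. by move=> a b c; exact: mulmxDr. Qed.
Let mmulZl t a b : mmul (t *: a) b = t *: mmul a b.
Proof.
apply/matrixP => i j; rewrite !mxE scaler_sumr; apply: eq_bigr => k _.
by rewrite mxE scalerAl.
Qed.
Let mmulZr t a b : mmul a (t *: b) = t *: mmul a b.
Proof.
apply/matrixP => i j; rewrite !mxE scaler_sumr; apply: eq_bigr => k _.
by rewrite mxE scalerAr.
Qed.
Let mstarD : {morph mstar : a b / a + b}.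
Proof. by move=> a b; apply/matrixP => i j; rewrite !mxE conjsD. Qed.
Let mstarZ t a : mstar (t *: a) = t *: mstar a.
Proof. by apply/matrixP => i j; rewrite !mxE conjsZ. Qed.

HB.instance Definition _ := isStarAlgebra.Build R (mxalg F n)
  (@mulmxA _ _ _ _ _) mmulDl mmulDr mmulZl mmulZr mstarD mstarZ
  (@adjmxM R F n n n) (@adjmxK R F n n).

HB.instance Definition _ := isNormedStarAlgebra.Build R (mxalg F n)
  (@opnorm_ge0 R F n) (@opnorm_eq0 R F n) (@opnormD R F n)
  (@opnormZ R F n) (@opnormM R F n) (@opnorm_cstar R F n).
End MatrixAlgebra.

Section VanishingFunctions.
Variables (R : realType) (T : topologicalType).

Definition vanishes_at_infty (f : T -> R^o) :=
  forall e : R, 0 < e ->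
    exists2 K : set T, compact K & forall x, ~ K x -> `|f x| < e.

Definition C0_pred : {pred T -> R^o} :=
  mem [set f : T -> R^o | continuous f /\ vanishes_at_infty f].

Record C0 := MkC0 { C0_fun :> T -> R^o ; _ : C0_fun \in C0_pred }.

HB.instance Definition _ := [isSub for C0_fun].
HB.instance Definition _ := [Choice of C0 by <:].

Let C0_submod : subsemimod_closed C0_pred.
Proof.
split; [split|].
- rewrite inE; split; first by move=> x; exact: cst_continuous.
  by move=> e e0; exists set0; [exact: compact0|move=> x _; rewrite normr0].
- move=> f g; rewrite !inE => -[cf f0] [cg g0]; split.
    by move=> x; apply: continuousD; [exact: cf|exact: cg].
  move=> e e0; have e2 : 0 < e / 2 by rewrite divr_gt0.
  have [K cK Kf] := f0 _ e2; have [L cL Lg] := g0 _ e2.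
  exists (K `|` L); first exact: compactU.
  move=> x /not_orP[Kx Lx]; rewrite (le_lt_trans (ler_normD _ _))//.
  by rewrite [ltRHS]splitr ltrD ?Kf ?Lg.
- move=> t f; rewrite !inE => -[cf f0]; split.
    by move=> x; apply: continuousZl_tmp; exact: cf.
  move=> e e0; have t0 : 0 < `|t| + 1 by rewrite ltr_wpDl.
  have [K cK Kf] := f0 _ (divr_gt0 e0 t0); exists K => // x /Kf.
  rewrite ltr_pdivlMr// => lt_e; rewrite normrM (le_lt_trans _ lt_e)//.
  by rewrite mulrC ler_wpM2l// lerDl.
Qed.

HB.instance Definition _ := GRing.SubChoice_isSubLmodule.Build R (T -> R^o)
  C0_pred C0 C0_submod.

Let C0_mul_subproof (f g : C0) :
  (fun x => (f x : R) * g x : R^o) \in C0_pred.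
Proof.
case: f g => [f /= +] [g /=]; rewrite !inE => -[cf f0] [cg g0]; split.
  by move=> x; apply: continuousM; [exact: cf|exact: cg].
move=> e e0; have [K cK Kf] := f0 _ e0; have [L cL Lg] := g0 1 ltr01.
exists (K `|` L); first exact: compactU.
move=> x /not_orP[/Kf Kx /Lg Lx]; rewrite normrM -[ltRHS]mulr1.
by rewrite ltr_pM.
Qed.

Let C0_mul (f g : C0) : C0 := MkC0 (C0_mul_subproof f g).

Let C0P (f g : C0) : f =1 g -> f = g.
Proof. by move=> fg; apply/val_inj/funext. Qed.

Let C0_mulA : associative C0_mul.
Proof. by move=> f g h; apply: C0P => x; exact: mulrA. Qed.
Let C0_mulDl : left_distributive C0_mul +%R.
Proof. by move=> f g h; apply: C0P => x; exact: mulrDl. Qed.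
Let C0_mulDr : right_distributive C0_mul +%R.
Proof. by move=> f g h; apply: C0P => x; exact: mulrDr. Qed.
Let C0_mulZl (t : R) f g : C0_mul (t *: f) g = t *: C0_mul f g.
Proof. by apply: C0P => x; rewrite /= -scalerAl. Qed.
Let C0_mulZr (t : R) f g : C0_mul f (t *: g) = t *: C0_mul f g.
Proof. by apply: C0P => x; rewrite /= -scalerAr. Qed.
Let C0_starM (f g : C0) : id (C0_mul f g) = C0_mul (id g) (id f).
Proof. by apply: C0P => x; exact: mulrC. Qed.

(* The functions are real-valued, so the involution is trivial. *)
HB.instance Definition _ := isStarAlgebra.Build R C0
  C0_mulA C0_mulDl C0_mulDr C0_mulZl C0_mulZr
  (fun _ _ => erefl) (fun _ _ => erefl) C0_starM (fun _ => erefl).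
End VanishingFunctions.

Definition suspension (R : realType) (k : nat) := C0 R 'rV[R]_k.

Section SequenceAlgebra.
Variables (R : realType) (B : nat -> normedStarAlgType R).

Record prod_alg := MkProd {
  prod_seq :> forall n, B n;
  prod_bounded : exists C : R, forall n, `‖prod_seq n‖ <= C }.
Implicit Types s u v : prod_alg.

Lemma prod_algP s u : (forall n, s n = u n) -> s = u.
Proof.
case: s u => s sP [u uP] /= su; have {}su : s = u by exact: functional_extensionality_dep.
by subst u; congr MkProd; exact: Prop_irrelevance.
Qed.

HB.instance Definition _ := gen_eqMixin prod_alg.
HB.instance Definition _ := gen_choiceMixin prod_alg.

Let zero_bd : exists C : R, forall n, `‖(0 : B n)‖ <= C.
Proof. by exists 0 => n; rewrite anorm0. Qed.
Let add_bd s u : exists C : R, forall n, `‖s n + u n‖ <= C.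
Proof.
have [C Cs] := prod_bounded s; have [D Du] := prod_bounded u.
by exists (C + D) => n; rewrite (le_trans (anormD _ _))// lerD.
Qed.
Let opp_bd s : exists C : R, forall n, `‖- s n‖ <= C.
Proof.
by have [C Cs] := prod_bounded s; exists C => n; rewrite anormN.
Qed.
Let scale_bd (t : R) s : exists C : R, forall n, `‖t *: s n‖ <= C.
Proof.
have [C Cs] := prod_bounded s; exists (`|t| * C) => n.
by rewrite anormZ ler_wpM2l.
Qed.
Let mul_bd s u : exists C : R, forall n, `‖s n ⋆ u n‖ <= C.
Proof.
have [C Cs] := prod_bounded s; have [D Du] := prod_bounded u.
exists (C * D) => n; rewrite (le_trans (anormM _ _))//.
by rewrite ler_pM ?anorm_ge0.
Qed.
Let star_bd s : exists C : R, forall n, `‖star (s n)‖ <= C.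
Proof. by have [C Cs] := prod_bounded s; exists C => n; rewrite anorm_star. Qed.

Let pzero := MkProd zero_bd.
Let padd s u := MkProd (add_bd s u).
Let popp s := MkProd (opp_bd s).
Let pscale t s := MkProd (scale_bd t s).
Let pmul s u := MkProd (mul_bd s u).
Let pstar s := MkProd (star_bd s).

Let paddA : associative padd.
Proof. by move=> ? ? ?; apply: prod_algP => n; exact: addrA. Qed.
Let paddC : commutative padd.
Proof. by move=> ? ?; apply: prod_algP => n; exact: addrC. Qed.
Let padd0 : left_id pzero padd.
Proof. by move=> ?; apply: prod_algP => n; exact: add0r. Qed.
Let paddN : left_inverse pzero popp padd.
Proof. by move=> ?; apply: prod_algP => n; exact: addNr. Qed.
HB.instance Definition _ :=
  GRing.isZmodule.Build prod_alg paddA paddC padd0 paddN.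

Let pscaleA t r s : pscale t (pscale r s) = pscale (t * r) s.
Proof. by apply: prod_algP => n; exact: scalerA. Qed.
Let pscale1 : left_id 1 pscale.
Proof. by move=> ?; apply: prod_algP => n; exact: scale1r. Qed.
Let pscaleDr : right_distributive pscale +%R.
Proof. by move=> ? ? ?; apply: prod_algP => n; exact: scalerDr. Qed.
Let pscaleDl s : {morph pscale^~ s : t r / t + r}.
Proof. by move=> ? ?; apply: prod_algP => n; exact: scalerDl. Qed.
HB.instance Definition _ := GRing.Zmodule_isLmodule.Build R prod_alg
  pscaleA pscale1 pscaleDr pscaleDl.

Let pmulA : associative pmul.
Proof. by move=> ? ? ?; apply: prod_algP => n; exact: amulA. Qed.
Let pmulDl : left_distributive pmul +%R.
Proof. by move=> ? ? ?; apply: prod_algP => n; exact: amulDl. Qed.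
Let pmulDr : right_distributive pmul +%R.
Proof. by move=> ? ? ?; apply: prod_algP => n; exact: amulDr. Qed.
Let pmulZl (t : R) s u : pmul (t *: s) u = t *: pmul s u.
Proof. by apply: prod_algP => n; exact: amulZl. Qed.
Let pmulZr (t : R) s u : pmul s (t *: u) = t *: pmul s u.
Proof. by apply: prod_algP => n; exact: amulZr. Qed.
Let pstarD : {morph pstar : s u / s + u}.
Proof. by move=> ? ?; apply: prod_algP => n; exact: starD. Qed.
Let pstarZ (t : R) s : pstar (t *: s) = t *: pstar s.
Proof. by apply: prod_algP => n; exact: starZ. Qed.
Let pstarM s u : pstar (pmul s u) = pmul (pstar u) (pstar s).
Proof. by apply: prod_algP => n; exact: starM. Qed.
Let pstarK : involutive pstar.
Proof. by move=> ?; apply: prod_algP => n; exact: starK. Qed.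
HB.instance Definition _ := isStarAlgebra.Build R prod_alg
  pmulA pmulDl pmulDr pmulZl pmulZr pstarD pstarZ pstarM pstarK.

Definition null_ideal : {pred prod_alg} :=
  mem [set s : prod_alg | (fun n => `‖s n‖) @ \oo --> (0 : R)].

Let null_idealP s (w : nat -> R) :
  (forall n, `‖s n‖ <= w n) -> w @ \oo --> (0 : R) -> s \in null_ideal.
Proof.
move=> sw w0; rewrite inE/=; apply: (squeeze_cvgr _ (cvg_cst 0) w0).
by near=> n; rewrite anorm_ge0 sw.
Unshelve. all: by end_near. Qed.

Let null_zmod : zmod_closed null_ideal.
Proof.
split.
  apply: (null_idealP (w := fun=> 0)) => [n|]; last exact: cvg_cst.
  by rewrite anorm0.
move=> s u /set_mem/= s0 /set_mem/= u0.
apply: (null_idealP (w := fun n => `‖s n‖ + `‖u n‖)) => [n|].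
  exact: anormB.
by rewrite -[X in _ --> X](addr0 (0 : R)); exact: cvgD.
Qed.

HB.instance Definition _ := GRing.isZmodClosed.Build _ null_ideal null_zmod.

Let null_le s u (C : R) : s \in null_ideal ->
  (forall n, `‖u n‖ <= C * `‖s n‖) -> u \in null_ideal.
Proof.
rewrite inE/= => s0 us; apply: (null_idealP us).
by rewrite -[X in _ --> X](mulr0 C); exact: cvgMl_tmp s0.
Qed.

Let null_scale (t : R) s : s \in null_ideal -> t *: s \in null_ideal.
Proof. by move/null_le; apply=> n; rewrite anormZ. Qed.

Let null_star s : s \in null_ideal -> star s \in null_ideal.
Proof.
move=> s0; apply: (null_le (C := 1) s0) => n /=.
by rewrite anorm_star mul1r.
Qed.

Let null_mull s u : s \in null_ideal -> u ⋆ s \in null_ideal.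
Proof.
have [C Cu] := prod_bounded u => s0; apply: (null_le (C := C) s0) => n.
by rewrite (le_trans (anormM _ _))// ler_wpM2r ?anorm_ge0.
Qed.

Let null_mulr s u : s \in null_ideal -> s ⋆ u \in null_ideal.
Proof.
have [C Cu] := prod_bounded u => s0; apply: (null_le (C := C) s0) => n.
by rewrite (le_trans (anormM _ _))// mulrC ler_wpM2r ?anorm_ge0.
Qed.

(* The quotient of the algebra of bounded sequences by the null sequences;    *)
(* the group structure comes from the library, the rest is defined below.     *)
Definition corona := Quotient.quot null_ideal.
HB.instance Definition _ := GRing.Zmodule.on corona.

Definition corona_pi (s : prod_alg) : corona := \pi_corona%qT s.

Lemma corona_piP s u : (corona_pi s = corona_pi u) <-> (s - u \in null_ideal).
Proof. by rewrite Quotient.idealrBE; split => /eqP. Qed.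

Lemma corona_pi_surj (x : corona) : exists s, corona_pi s = x.
Proof. by exists (repr x); exact: reprK. Qed.

Lemma corona_piD : {morph corona_pi : s u / s + u}.
Proof. by move=> s u; exact: Quotient.pi_add. Qed.

Let null_repr s : s - repr (corona_pi s) \in null_ideal.
Proof. by apply/corona_piP; rewrite /corona_pi reprK. Qed.

Let cscale (t : R) (x : corona) := corona_pi (t *: repr x).
Let cmul (x y : corona) := corona_pi (repr x ⋆ repr y).
Let cstar (x : corona) := corona_pi (star (repr x)).

Let piZ t s : cscale t (corona_pi s) = corona_pi (t *: s).
Proof.
by apply/esym/corona_piP; rewrite -scalerBr null_scale ?null_repr.
Qed.

Let piM s u : cmul (corona_pi s) (corona_pi u) = corona_pi (s ⋆ u).
Proof.
apply/esym/corona_piP; set s' := repr _; set u' := repr _.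
have -> : s ⋆ u - s' ⋆ u' = (s - s') ⋆ u + s' ⋆ (u - u').
  apply: prod_algP => n /=.
  have := amulBl (s n) (s' n) (u n); have := amulBr (u n) (u' n) (s' n).
  by rewrite /= => -> ->; rewrite addrA subrK.
apply: rpredD; [apply: null_mulr|apply: null_mull]; exact: null_repr.
Qed.

Let piS s : cstar (corona_pi s) = corona_pi (star s).
Proof.
apply/esym/corona_piP; set s' := repr _.
have -> : star s - star s' = star (s - s').
  by apply: prod_algP => n; rewrite /= [RHS]starB.
by rewrite null_star ?null_repr.
Qed.

Let cscaleA t r x : cscale t (cscale r x) = cscale (t * r) x.
Proof. by have [s <-] := corona_pi_surj x; rewrite !piZ scalerA. Qed.
Let cscale1 : left_id 1 cscale.
Proof. by move=> x; have [s <-] := corona_pi_surj x; rewrite piZ scale1r. Qed.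
Let cscaleDr : right_distributive cscale +%R.
Proof.
move=> t x y; have [s <-] := corona_pi_surj x; have [u <-] := corona_pi_surj y.
by rewrite -corona_piD !piZ scalerDr corona_piD.
Qed.
Let cscaleDl x : {morph cscale^~ x : t u / t + u}.
Proof.
move=> t u; have [s <-] := corona_pi_surj x.
by rewrite !piZ scalerDl corona_piD.
Qed.

HB.instance Definition _ := GRing.Zmodule_isLmodule.Build R corona
  cscaleA cscale1 cscaleDr cscaleDl.

Let piZ' (t : R) s : t *: corona_pi s = corona_pi (t *: s).
Proof. exact: piZ. Qed.

Let cmulA : associative cmul.
Proof.
move=> x y z; have [s <-] := corona_pi_surj x; have [u <-] := corona_pi_surj y.
by have [v <-] := corona_pi_surj z; rewrite !piM amulA.
Qed.
Let cmulDl : left_distributive cmul +%R.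
Proof.
move=> x y z; have [s <-] := corona_pi_surj x; have [u <-] := corona_pi_surj y.
have [v <-] := corona_pi_surj z.
by rewrite -corona_piD !piM amulDl corona_piD.
Qed.
Let cmulDr : right_distributive cmul +%R.
Proof.
move=> x y z; have [s <-] := corona_pi_surj x; have [u <-] := corona_pi_surj y.
have [v <-] := corona_pi_surj z.
by rewrite -corona_piD !piM amulDr corona_piD.
Qed.
Let cmulZl (t : R) x y : cmul (t *: x) y = t *: cmul x y.
Proof.
have [s <-] := corona_pi_surj x; have [u <-] := corona_pi_surj y.
by rewrite piZ' !piM piZ' amulZl.
Qed.
Let cmulZr (t : R) x y : cmul x (t *: y) = t *: cmul x y.
Proof.
have [s <-] := corona_pi_surj x; have [u <-] := corona_pi_surj y.
by rewrite piZ' !piM piZ' amulZr.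
Qed.
Let cstarD : {morph cstar : x y / x + y}.
Proof.
move=> x y; have [s <-] := corona_pi_surj x; have [u <-] := corona_pi_surj y.
by rewrite -corona_piD !piS starD corona_piD.
Qed.
Let cstarZ (t : R) x : cstar (t *: x) = t *: cstar x.
Proof.
by have [s <-] := corona_pi_surj x; rewrite piZ' !piS piZ' starZ.
Qed.
Let cstarM x y : cstar (cmul x y) = cmul (cstar y) (cstar x).
Proof.
have [s <-] := corona_pi_surj x; have [u <-] := corona_pi_surj y.
by rewrite piM !piS piM starM.
Qed.
Let cstarK : involutive cstar.
Proof. by move=> x; have [s <-] := corona_pi_surj x; rewrite !piS starK. Qed.

HB.instance Definition _ := isStarAlgebra.Build R corona
  cmulA cmulDl cmulDr cmulZl cmulZr cstarD cstarZ cstarM cstarK.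

Lemma corona_pi_star_hom : is_star_hom corona_pi.
Proof.
by split=> [t s u|s u|s]; [rewrite corona_piD piZ'|rewrite -piM|rewrite -piS].
Qed.

End SequenceAlgebra.

Definition acomm (R : realType) (A : starAlgType R) (a b : A) := a ⋆ b - b ⋆ a.

Definition selfadjoint_contraction (R : realType) (A : normedStarAlgType R)
  (a : A) := star a = a /\ `‖a‖ <= 1.

Definition question1 (R : realType) (d : nat) (F : conjScalarType R) : Prop :=
  forall eps : R, 0 < eps -> exists2 delta : R, 0 < delta &
  forall n : nat, (0 < n)%N -> forall H : 'I_d -> mxalg F n,
    (forall r, selfadjoint_contraction (H r)) ->
    (forall r s, `‖acomm (H r) (H s)‖ <= delta) ->
    exists K : 'I_d -> mxalg F n,
      [/\ forall r, selfadjoint_contraction (K r),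
          forall r, `‖K r - H r‖ <= eps
        & forall r s, acomm (K r) (K s) = 0].

Definition mxalg_seq (R : realType) (F : conjScalarType R) (m : nat -> nat) :
  nat -> normedStarAlgType R := fun n => mxalg F (m n).

Definition question2 (R : realType) (d : nat) (F : conjScalarType R) : Prop :=
  forall m : nat -> nat, (forall n, (0 < m n)%N) ->
  forall psi : suspension R d.-1 -> corona (mxalg_seq F m),
    is_star_hom psi ->
    exists2 psi' : suspension R d.-1 -> prod_alg (mxalg_seq F m),
      is_star_hom psi' & psi = @corona_pi R (mxalg_seq F m) \o psi'.

(* Main.v *)
From HB Require Import structures.
Require Import Defs.
From mathcomp Require Import all_boot all_order all_algebra.
From mathcomp Require Import fingroup perm generic_quotient fraction spectral sesquilinear.
From mathcomp Require Import ring lra zify.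
From mathcomp Require Import all_classical all_reals all_analysis.
From mathcomp.real_closed Require Import complex mxtens.

Set Implicit Arguments.
Unset Strict Implicit.
Unset Printing Implicit Defensive.

Import Order.TTheory GRing.Theory Num.Theory.

Local Open Scope ring_scope.

(** Both negative answers come from one finite-dimensional fact, [obstructed]: for a fixed eps there
    are self-adjoint families H_1, ..., H_d with sum of squares 1 and arbitrarily small commutators,
    none of which lies within eps of a commuting self-adjoint family. The H_r are fuzzy spheres: the
    Pauli matrices (d = 3) or five 4x4 gamma matrices (d = 5) act on homogeneous polynomials of
    degree N+2 through the oscillator representation of gl_k, and these operators are divided by the
    square root of their Casimir value. Before scaling, the operators and their commutators are both
    of order N, so the scaled commutators are of order 1/N. Imaginary units are kept in a separate
    factor, a quaternion or a real 2x2 rotation.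

    The obstruction is an invariant of a pencil pairing the H_r with Clifford generators. For the
    fuzzy spheres, [sphere2_pencil] and [sphere4_pencil] write it through Gram matrices of maps from
    the neighbouring polynomial degrees, which gives its spectrum explicitly.

    Over the quaternions (d = 3) the pencil is real skew-symmetric and the invariant is the sign of
    its Pfaffian, which is constant along paths of invertible pencils ([pfaffian_sign_path]). A
    commuting family, slightly shifted, is joined through invertible commuting pencils to the
    constant family (1, 0, 0), whose sign is opposite to that of the fuzzy sphere; but a family
    close to the fuzzy sphere would have the sign of the latter.

    Over the reals (d = 5) the pencil is symmetric and the invariant is its signature. The pencil of
    a commuting family is nonpositive on a subspace of half dimension ([nonpositive_vector]),
    whereas that of the fuzzy sphere is positive, with a uniform bound, on a subspace of more than
    half the dimension ([positive_mx_wide]), because the number of monomials of degree N is a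
    strictly convex function of N. The two subspaces meet.

    The first question is then immediate. For the second, a sequence of such families with
    commutators tending to 0 has to be turned into a homomorphism from the functions on the
    punctured sphere to the quotient algebra. This is done with noncommutative Bernstein operators.
    Letters proportional to 1 + H_r and 1 - H_r have squares summing to 1; words in them give
    positive operators E(w) summing to 1, and each word has a sample point, the average of the
    coordinates of its letters. A function f is sent to the sum of f(point of w) E(w). When the H_r
    commute this is an average over a multinomial law, concentrated on the sphere by the law of
    large numbers; [mean_defect] expresses the concentration through a quadratic defect,
    [defect_dominates] bounds the error of continuous functions by the defect, and
    [positive_sum_dominated] turns scalar bounds into norm bounds. A diagonal choice of word length
    and index gives the homomorphism, and a lift of it would give commuting self-adjoint K_r
    asymptotic to the H_r ([lift_commuting]). *)

(** * Square roots of characteristic polynomials and the sign of a Pfaffian *)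

(** Induction by Schur complement. A nonzero entry of the first row is brought to position (0, 1) by
    permuting rows and columns alike, which preserves skewness and the determinant; the upper left
    2x2 block then has determinant b^2, and its Schur complement is skew again. *)
Lemma det_skew_square (F : fieldType) (n : nat) (A : 'M[F]_n) :
  (2%:R : F) != 0 -> A^T = - A -> exists x, \det A = x ^+ 2.
Proof.
move=> two0; elim: {n}_.+1 {-2}n (ltnSn n) A => // m IH [|n] ltnm A skA.
  by exists 1; rewrite det_mx00 expr1n.
have skE i j : A i j = - A j i by have /matrixP/(_ j i) := skA; rewrite !mxE.
have diag0 i : A i i = 0.
  apply/eqP; have /eqP := skE i i; rewrite -addr_eq0 -mulr2n -mulr_natr.
  by rewrite mulf_eq0 (negbTE two0) orbF.
have [/forallP A0|] := boolP [forall j, A 0 j == 0].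
  exists 0; rewrite (expand_det_row A 0) expr0n big1 // => j _.
  by rewrite (eqP (A0 j)) mul0r.
rewrite negb_forall => /existsP [j A0j].
have j0 : j != 0 by apply: contraNneq A0j => ->; rewrite diag0.
case: n => [|n] in ltnm A skA skE diag0 j A0j j0 *; first by rewrite ord1 in j0.
pose one : 'I_n.+2 := lift ord0 ord0.
pose s := tperm one j.
have s0 : s 0 = 0 by rewrite /s tpermD //.
have s1 : s one = j by rewrite /s tpermL.
pose B := col_perm s (row_perm s A).
have BE x y : B x y = A (s x) (s y) by rewrite !mxE.
have detB : \det B = \det A.
  rewrite /B col_permE row_permE !det_mulmx !det_perm odd_permV.
  by rewrite mulrAC -expr2 sqrr_sign mul1r.
rewrite -detB; clear detB.
have skB : B^T = - B by apply/matrixP => x y; rewrite mxE BE mxE BE skE.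
have b0 : B 0 one != 0 by rewrite BE s0 s1.
move: B skB b0 {BE} => B skB b0.
have skBE i k : B i k = - B k i by have /matrixP/(_ k i) := skB; rewrite !mxE.
have diagB i : B i i = 0.
  apply/eqP; have /eqP := skBE i i; rewrite -addr_eq0 -mulr2n -mulr_natr.
  by rewrite mulf_eq0 (negbTE two0) orbF.
pose B' : 'M[F]_(2 + n) := B.
pose b := B 0 one.
pose P : 'M[F]_2 := ulsubmx B'.
pose C : 'M[F]_(2, n) := ursubmx B'.
pose D : 'M[F]_n := drsubmx B'.
have skB' : B'^T = - B' by [].
have skP : P^T = - P by rewrite /P trmx_ulsub skB' /ulsubmx !linearN.
have skD : D^T = - D by rewrite /D trmx_drsub skB' /drsubmx !linearN.
have CE : dlsubmx B' = - C^T.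
  by rewrite /C trmx_ursub skB' /dlsubmx !linearN /= opprK.
have P00 : P 0 0 = 0 by rewrite !mxE; apply: diagB.
have P11 : P 1 1 = 0 by rewrite !mxE; apply: diagB.
have P01 : P 0 1 = b by rewrite !mxE /b; congr (B _ _); apply/val_inj.
have P10 : P 1 0 = - b.
  by have /matrixP/(_ 0 1) := skP; rewrite mxE => ->; rewrite mxE P01.
have detP : \det P = b ^+ 2.
  rewrite (expand_det_row P 0) !big_ord_recl big_ord0 P00 mul0r add0r addr0.
  rewrite /cofactor.
  have -> : lift ord0 ord0 = 1 :> 'I_2 by apply/val_inj.
  rewrite P01 det_mx11 mxE [X in _ * (_ * X)]mxE.
  have -> : lift 0 (0 : 'I_1) = 1 :> 'I_2 by apply/val_inj.
  have -> : lift 1 (0 : 'I_1) = 0 :> 'I_2 by apply/val_inj.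
  by rewrite P10 expr1; ring.
have Pu : P \in unitmx by rewrite unitmxE detP unitfE sqrf_eq0.
have skIP : (invmx P)^T = - invmx P.
  have Pu' : - P \in unitmx by rewrite -skP unitmx_tr.
  rewrite trmx_inv skP; apply: (can_inj (mulKmx Pu)).
  by rewrite mulmxN mulmxV // -[in LHS](opprK P) mulNmx opprK mulmxV.
pose E := D + C^T *m invmx P *m C.
have skE' : E^T = - E.
  rewrite /E linearD /= !trmx_mul trmxK skIP skD opprD; congr (_ + _).
  by rewrite mulNmx mulmxN mulmxA.
have [x detE] := IH n (ltnW ltnm) E skE'.
exists (b * x); rewrite exprMn -detE -detP -(det_lblock _ (- C^T)).
transitivity (\det (B' *m block_mx 1%:M (- (invmx P *m C)) 0 1%:M)).
  by rewrite det_mulmx det_ublock !det1 !mulr1.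
congr (\det _); rewrite -[B']submxK mulmx_block CE -/P -/C -/D.
rewrite !mulmx1 !mulmx0 !addr0 mulmxN mulNmx mulmxN opprK !mulmxA mulmxV //.
by rewrite mul1mx addNr addrC.
Qed.

Lemma frac_numden (D : idomainType) (y : {fraction D}) :
  exists u v : D, v != 0 /\ y * (tofrac v) = tofrac u.
Proof.
elim/quotW: y => x; exists (frac x).1, (frac x).2; split; first exact: denom_ratioP.
rewrite !piE; apply/eqmodP; rewrite /= FracField.equivfE /FracField.mulf.
by rewrite !numden_Ratio ?mulr1 ?oner_neq0 ?denom_ratioP // mulrC.
Qed.

(** With y = u / v, the square of v divides that of u, hence v divides u. *)
Lemma poly_square_of_frac (F : fieldType) (p : {poly F}) (y : {fraction {poly F}}) :
  tofrac p = y ^+ 2 -> exists q, p = q ^+ 2.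
Proof.
have [u [v [v0 yv]]] := frac_numden y => py.
have e : u ^+ 2 = p * v ^+ 2.
  by apply/eqP; rewrite -tofrac_eq rmorphXn /= -yv exprMn -py rmorphM rmorphXn.
have /dvdpP [q uq] : v %| u by rewrite -(@dvdp_pexp2r _ _ _ 2) // e dvdp_mulIr.
exists q; apply: (mulIf (expf_neq0 2 v0)).
by rewrite -e uq exprMn.
Qed.

Section SqrtCharPoly.
Variables (F : fieldType) (n : nat).
Implicit Types L A : 'M[F]_n.

Lemma monic_sqrt_inj (p q : {poly F}) : (2%:R : F) != 0 ->
  p \is monic -> q \is monic -> p ^+ 2 = q ^+ 2 -> p = q.
Proof.
move=> two0 /monicP pm /monicP qm /eqP; rewrite eqf_sqr => /orP [/eqP//|/eqP pq].
have : (2%:R : F) = 0.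
  by rewrite -[LHS]/(1 + 1) -{1}pm pq lead_coefN qm addNr.
by move/eqP; rewrite (negbTE two0).
Qed.

(** L (X + L A) = X L - A is skew, so the characteristic polynomial is a quotient of determinants of
    two skew matrices: a square in F(X), hence in F[X]. The leading coefficient of the root is 1 or
    -1, and a sign makes it monic. *)
Lemma char_poly_skew_square L A : (2%:R : F) != 0 -> L^T = - L -> A^T = - A ->
  L *m L = - 1%:M ->
  exists2 q : {poly F}, q \is monic & q ^+ 2 = char_poly (- (L *m A)).
Proof.
move=> two0 skL skA LL.
have two0' : (2%:R : {fraction {poly F}}) != 0.
  rewrite -(rmorph_nat (@tofrac {poly F})) tofrac_eq0 -polyC_natr polyC_eq0 //.
pose LP := map_mx polyC L; pose AP := map_mx polyC A.
pose Z : 'M[{poly F}]_n := 'X *: LP - AP.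
have ZE : LP *m char_poly_mx (- (L *m A)) = Z.
  rewrite /char_poly_mx mulmxBr mul_mx_scalar /Z; congr (_ - _).
  by rewrite -map_mxM mulmxN mulmxA LL mulNmx opprK mul1mx.
have [x xE] : exists x, \det (map_mx (@tofrac {poly F}) LP) = x ^+ 2.
  apply: det_skew_square => //.
  by rewrite !map_trmx skL !map_mxN.
have [z zE] : exists z, \det (map_mx (@tofrac {poly F}) Z) = z ^+ 2.
  apply: det_skew_square => //.
  rewrite map_trmx -map_mxN; congr map_mx.
  rewrite /Z linearB linearZ /= !map_trmx skL skA !map_mxN scalerN opprK opprB.
  by rewrite addrC.
have x0 : x != 0.
  have : \det (map_mx (@tofrac {poly F}) LP) != 0.
    rewrite !det_map_mx tofrac_eq0 polyC_eq0.
    have /mulmx1_unit [] : L *m (- L) = 1%:M by rewrite mulmxN LL opprK.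
    by rewrite unitmxE unitfE.
  by rewrite xE sqrf_eq0.
have : tofrac (char_poly (- (L *m A))) = (z / x) ^+ 2.
  apply: (mulfI (expf_neq0 2 x0)); rewrite exprMn exprVn mulrCA mulfV ?expf_neq0 //.
  by rewrite mulr1 -xE -zE -ZE map_mxM det_mulmx; congr (_ * _); rewrite det_map_mx.
move=> /poly_square_of_frac [q qE].
have lq : lead_coef q ^+ 2 = 1.
  have := monicP (char_poly_monic (- (L *m A))).
  by rewrite qE lead_coef_exp.
move/eqP: lq; rewrite sqrf_eq1 => /orP [/eqP lq|/eqP lq].
  by exists q => //; apply/monicP.
by exists (- q); rewrite ?sqrrN //; apply/monicP; rewrite lead_coefN lq opprK.
Qed.

End SqrtCharPoly.

(** The coefficient of degree 2m - k of the square involves only the top k + 1 coefficients of q, so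
    a monic q can be recovered from its square from the top down. *)
Lemma coef_sqr_top (F : comNzRingType) (q : {poly F}) m k : size q = m.+1 ->
  (k <= m)%N ->
  (q ^+ 2)`_(m + (m - k)) = \sum_(i < k.+1) q`_(m - k + i) * q`_(m - i).
Proof.
move=> sq km; rewrite expr2 coefM.
rewrite -(big_mkord xpredT (fun j => q`_j * q`_(m + (m - k) - j))).
rewrite (@big_cat_nat _ _ _ (m - k)%N) //=; last lia.
rewrite big1_seq ?add0r => [|i]; last first.
  rewrite mem_index_iota => /= h.
  by rewrite [X in _ * X]nth_default ?mulr0 // sq; lia.
rewrite (@big_cat_nat _ _ _ m.+1) //=; [|lia|lia].
rewrite [X in _ + X]big1_seq ?addr0 => [|i]; last first.
  rewrite mem_index_iota => /= h.
  by rewrite [X in X * _]nth_default ?mul0r // sq; lia.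
rewrite -{1}(add0n (m - k)%N) big_addn (_ : (m.+1 - (m - k) = k.+1)%N); last lia.
rewrite big_mkord; apply: eq_bigr => i _; congr (_`_ _ * _`_ _); lia.
Qed.

(** Each new coefficient occurs in the square as 2 q_(m-k) plus products of coefficients already
    known to be polynomial in t. *)
Lemma sqrt_coef_poly (F : realFieldType) (q : F -> {poly F}) (c : nat -> {poly F}) m :
  (forall t, q t \is monic) -> (forall t, size (q t) = m.+1) ->
  (forall t k, (q t ^+ 2)`_k = (c k).[t]) ->
  forall k, (k <= m)%N -> exists Q : {poly F}, forall t, (q t)`_(m - k) = Q.[t].
Proof.
move=> mq sq cq; elim/ltn_ind => -[|k] IH km.
  exists 1 => t; rewrite subn0 hornerC.
  by have /monicP := mq t; rewrite lead_coefE sq.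
have [Q QE] : exists Q : {poly F}, forall t,
    \sum_(i < k) (q t)`_(m - k.+1 + i.+1) * (q t)`_(m - i.+1) = Q.[t].
  have : forall j, (j <= k)%N -> exists Q : {poly F}, forall t,
      \sum_(i < j) (q t)`_(m - k.+1 + i.+1) * (q t)`_(m - i.+1) = Q.[t].
    elim=> [|j IHj] jk; first by exists 0 => t; rewrite big_ord0 horner0.
    have [P PE] := IHj (ltnW jk).
    have [Q1 Q1E] := IH (k - j)%N ltac:(lia) ltac:(lia).
    have [Q2 Q2E] := IH j.+1 ltac:(lia) ltac:(lia).
    exists (P + Q1 * Q2) => t; rewrite big_ord_recr /= PE hornerD hornerM.
    by rewrite -Q1E -Q2E; congr (_ + (_ `_ _) * _); lia.
  by move=> /(_ k (leqnn k)).
exists (2^-1 *: (c (m + (m - k.+1))%N - Q)) => t.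
rewrite hornerZ hornerD hornerN -QE -cq (coef_sqr_top (sq t) km).
rewrite big_ord_recl big_ord_recr /= addn0 subn0.
have -> : (q t)`_m = 1.
  by have /monicP := mq t; rewrite lead_coefE sq.
have -> : (m - k.+1 + bump 0 k = m)%N by rewrite /bump /=; lia.
have -> : (q t)`_m = 1.
  by have /monicP := mq t; rewrite lead_coefE sq.
set s := \sum_(i < k) _.
rewrite mulr1 mul1r (_ : bump 0 k = k.+1) //; lra.
Qed.

Lemma char_poly_pencil (F : comNzRingType) n (A B : 'M[F]_n) :
  exists c : nat -> {poly F}, forall t k, (char_poly (A + t *: B))`_k = (c k).[t].
Proof.
pose M : 'M[{poly {poly F}}]_n :=
  'X%:M - map_mx polyC (map_mx polyC A + 'X *: map_mx polyC B).
exists (fun k => (\det M)`_k) => t k.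
have -> : ((\det M)`_k).[t] = (map_poly (horner_eval t) (\det M))`_k.
  by rewrite coef_map.
rewrite -det_map_mx /char_poly; congr (polyseq (\det _))`_k.
apply/matrixP => i j; rewrite !mxE /= rmorphB /= rmorphMn /= map_polyX.
rewrite map_polyC /= /horner_eval. by rewrite !hornerE.
Qed.

(* The sign of [q.[0]] plays the role of the sign of the Pfaffian of [A]        *)
(* relative to the complex structure [L].                                      *)
Lemma pfaffian_sign_path (R : rcfType) n (L A0 A1 : 'M[R]_n) (q0 q1 : {poly R}) :
  L^T = - L -> A0^T = - A0 -> A1^T = - A1 -> L *m L = - 1%:M ->
  (forall t, 0 <= t <= 1 -> A0 + t *: (A1 - A0) \in unitmx) ->
  q0 \is monic -> q1 \is monic ->
  q0 ^+ 2 = char_poly (- (L *m A0)) -> q1 ^+ 2 = char_poly (- (L *m A1)) ->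
  0 < q0.[0] * q1.[0].
Proof.
move=> skL sk0 sk1 LL unit_t m0 m1 q0E q1E.
have two0 : (2%:R : R) != 0 by rewrite pnatr_eq0.
pose A t := A0 + t *: (A1 - A0).
have skA t : (A t)^T = - A t.
  by rewrite /A linearD linearZ linearB /= sk0 sk1 -opprD scalerN opprD.
have /choice [q qE] : forall t, exists q : {poly R},
    q \is monic /\ q ^+ 2 = char_poly (- (L *m A t)).
  by move=> t; have [q] := char_poly_skew_square two0 skL (skA t) LL; exists q.
pose m := (n./2)%N.
have sizeq t p : p \is monic -> p ^+ 2 = char_poly (- (L *m A t)) ->
    (size p).-1.*2 = n.
  move=> /monic_neq0 p0 /(congr1 (fun p : {poly R} => (size p).-1)).
  by rewrite size_char_poly size_exp muln2.
have sq t : size (q t) = m.+1.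
  have [mq] := qE t; move/(sizeq t _ mq).
  have : (0 < size (q t))%N by rewrite size_poly_gt0 monic_neq0.
  by rewrite /m => s0 <-; rewrite doubleK prednK.
have [c cE] := char_poly_pencil (- (L *m A0)) (- (L *m (A1 - A0))).
have cq t k : (q t ^+ 2)`_k = (c k).[t].
  have [_ ->] := qE t; rewrite -cE /A mulmxDr -scalemxAr opprD scalerN.
  by [].
have [Q QE] := sqrt_coef_poly (fun t => (qE t).1) sq cq (leqnn m).
rewrite subnn in QE.
have q0q : q0 = q 0.
  apply: (monic_sqrt_inj two0 m0 (qE 0).1); rewrite q0E (qE 0).2.
  by rewrite /A scale0r addr0.
have q1q : q1 = q 1.
  apply: (monic_sqrt_inj two0 m1 (qE 1).1); rewrite q1E (qE 1).2.
  by rewrite /A scale1r addrC subrK.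
(* The square of the constant coefficient is, up to sign, det (L A_t), which does not vanish; a
   change of sign between 0 and 1 would give a zero by the intermediate value theorem. *)
have nz t : 0 <= t <= 1 -> Q.[t] != 0.
  move=> t01; rewrite -QE -sqrf_eq0.
  have -> : (q t)`_0 ^+ 2 = (q t ^+ 2)`_0 by rewrite !expr2 coef0M.
  rewrite (qE t).2 char_poly_det mulf_eq0 signr_eq0 /= -unitfE.
  have /mulmx1_unit [Lu _] : (- L) *m L = 1%:M by rewrite mulNmx LL opprK.
  have Au := unit_t t t01; rewrite -/(A t) in Au.
  by rewrite -mulNmx -unitmxE unitmx_mul Au Lu.
rewrite q0q q1q !horner_coef0 !QE.
have Q0 : Q.[0] != 0 by apply: nz; rewrite lexx ler01.
have Q1 : Q.[1] != 0 by apply: nz; rewrite lexx ler01.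
have noroot (P : {poly R}) : (forall t, 0 <= t <= 1 -> P.[t] != 0) ->
    P.[0] < 0 -> P.[1] < 0.
  move=> Pnz P0; rewrite ltNge; apply/negP => P1.
  have [|t t01 /rootP Pt] := @poly_ivt R P 0 1 ler01; first by rewrite (ltW P0).
  by move: (Pnz t t01); rewrite Pt eqxx.
have [Q0n|Q0p|Q0z] := ltgtP Q.[0] 0; last by rewrite Q0z eqxx in Q0.
  by rewrite nmulr_rgt0 // noroot.
rewrite pmulr_rgt0 //; have := noroot (- Q); rewrite !hornerN !oppr_lt0; apply=> //.
by move=> t t01; rewrite hornerN oppr_eq0 nz.
Qed.

(** Sylvester's identity: the block matrix with rows (z, U) and (V, 1) is made triangular in two
    ways. *)
Lemma det_scalar_sub_mulmxC (F : idomainType) m p (z : F) (U : 'M[F]_(m, p))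
    (V : 'M[F]_(p, m)) : z != 0 ->
  z ^+ p * \det (z%:M - U *m V) = z ^+ m * \det (z%:M - V *m U).
Proof.
move=> z0; pose B := block_mx z%:M U V (1%:M : 'M[F]_p).
have E1 : B *m block_mx (1%:M : 'M[F]_m) 0 (- V) 1%:M = block_mx (z%:M - U *m V) U 0 1%:M.
  rewrite mulmx_block !mulmx1 !mulmx0 !mul1mx !add0r mulmxN.
  by rewrite addrN.
have E2 : B *m block_mx (1%:M : 'M[F]_m) (- U) 0 z%:M = block_mx z%:M 0 V (z%:M - V *m U).
  rewrite mulmx_block !mulmx1 !mulmx0 !mul1mx !addr0 !mulmxN.
  by rewrite mul_scalar_mx mul_mx_scalar addNr addrC.
have := congr1 (fun M => \det M) E1; rewrite /= det_mulmx det_lblock det_ublock !det1 !mulr1 => <-.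
by have := congr1 (fun M => \det M) E2; rewrite /= det_mulmx det_ublock det_lblock det1 mul1r !det_scalar mulrC.
Qed.

(** * The bosonic Fock space of k oscillators, degree by degree *)

Section Oscillators.
Variables (R : rcfType) (k : nat).
Notation midx := {ffun 'I_k -> nat}.

Definition midx_incr (i : 'I_k) (u : midx) : midx := [ffun j => (u j + (j == i))%N].

Fixpoint midx_of_deg N : seq midx :=
  if N is N'.+1 then
    undup [seq midx_incr i u | u <- midx_of_deg N', i <- enum 'I_k]
  else [:: [ffun=> 0%N]].

Lemma midx_of_deg_uniq N : uniq (midx_of_deg N).
Proof. by case: N => [|N] //=; exact: undup_uniq. Qed.

Lemma sum_midx_incr i u : (\sum_j midx_incr i u j = (\sum_j u j).+1)%N.
Proof.
under eq_bigr do rewrite ffunE.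
rewrite big_split /= -addn1; congr addn.
by rewrite (bigD1 i) //= eqxx big1 ?addn0 // => j /negbTE ->.
Qed.

Lemma midx_incr_surj (u : midx) i : (0 < u i)%N -> exists v, u = midx_incr i v.
Proof.
move=> ui; exists [ffun j => (u j - (j == i))%N].
by apply/ffunP => j; rewrite !ffunE; case: eqP => [->|_] /=; lia.
Qed.

Lemma mem_midx_of_deg N u : (u \in midx_of_deg N) = (\sum_i u i == N)%N.
Proof.
elim: N u => [|N IH] u /=.
  rewrite inE; apply/eqP/eqP => [->|/eqP].
    by rewrite big1 // => i _; rewrite ffunE.
  rewrite sum_nat_eq0 => /forallP u0; apply/ffunP => i; rewrite ffunE.
  by apply/eqP; exact: u0.
rewrite mem_undup; apply/allpairsP/eqP => [[[v i] /= [+ _ ->]]|su].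
  by rewrite IH sum_midx_incr => /eqP ->.
have [i ui] : exists i, (0 < u i)%N.
  apply/existsP; rewrite -[X in is_true X]negbK negb_exists.
  apply/negP => /forallP u0; move: su; rewrite big1 // => i _.
  by move: (u0 i); rewrite lt0n negbK => /eqP.
have [v uv] := midx_incr_surj ui.
exists (v, i); rewrite mem_enum IH; split=> //=.
by move: su; rewrite uv sum_midx_incr => -[->].
Qed.

Lemma midx_incr_inj i : injective (midx_incr i).
Proof.
by move=> u v /ffunP uv; apply/ffunP => j; move: (uv j); rewrite !ffunE => /addIn.
Qed.

Lemma sum_pick (s : seq midx) (F : midx -> R) v : uniq s ->
  \sum_(u <- s) F u *+ (u == v) = F v *+ (v \in s).
Proof.
move=> us; case: (boolP (v \in s)) => vs.
  rewrite (bigD1_seq v) //= eqxx big1 ?addr0 // => u /negbTE ->.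
  by rewrite mulr0n.
rewrite big_seq big1 // => u us'; case: eqP => [uv|]; last by rewrite mulr0n.
by move: vs; rewrite -uv us'.
Qed.

Notation dimV N := (size (midx_of_deg N)).
Definition midx_nth N : nat -> midx := nth [ffun=> 0%N] (midx_of_deg N).

Lemma sum_midx N (F : midx -> R) :
  \sum_(x < dimV N) F (midx_nth N x) = \sum_(u <- midx_of_deg N) F u.
Proof. by rewrite (big_nth [ffun=> 0%N]) big_mkord. Qed.

(** Annihilation from degree N+1 to degree N in the orthonormal basis of monomials: the basis vector
    u goes to sqrt(u_i) times the basis vector u - e_i. *)
Definition annih N (i : 'I_k) : 'M[R]_(dimV N, dimV N.+1) :=
  \matrix_(x, y) (Num.sqrt ((midx_nth N.+1 y) i)%:R *+ ((midx_nth N.+1 y) == midx_incr i (midx_nth N x))).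

Lemma mem_nth_midx N (x : 'I_(dimV N)) : (midx_nth N x) \in midx_of_deg N.
Proof. exact: mem_nth. Qed.

Lemma nth_midx_inj N (x y : 'I_(dimV N)) : ((midx_nth N x) == (midx_nth N y)) = (x == y).
Proof. by rewrite nth_uniq // midx_of_deg_uniq. Qed.

Lemma mem_incr N i (x : 'I_(dimV N)) : midx_incr i (midx_nth N x) \in midx_of_deg N.+1.
Proof.
rewrite mem_midx_of_deg sum_midx_incr eqSS -mem_midx_of_deg; exact: mem_nth_midx.
Qed.

Lemma annih_creat_entry N i j (x y : 'I_(dimV N)) :
  (annih N i *m (annih N j)^T) x y =
  (Num.sqrt (midx_incr i (midx_nth N x) i)%:R * Num.sqrt (midx_incr i (midx_nth N x) j)%:R)
     *+ (midx_incr i (midx_nth N x) == midx_incr j (midx_nth N y)).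
Proof.
rewrite mxE.
under eq_bigr => z _ do rewrite !mxE.
pose G (u : midx) : R := Num.sqrt (u i)%:R * (Num.sqrt (u j)%:R *+ (u == midx_incr j (midx_nth N y))).
transitivity (\sum_(u <- midx_of_deg N.+1) G u *+ (u == midx_incr i (midx_nth N x))).
  by rewrite -(@sum_midx N.+1 (fun u => G u *+ _)); apply: eq_bigr => z _; rewrite /= /G mulrnAl.
rewrite sum_pick ?midx_of_deg_uniq // mem_incr mulr1n /G.
by rewrite mulrnAr.
Qed.

Lemma creat_annih_entry N i j (x y : 'I_(dimV N.+1)) :
  ((annih N j)^T *m annih N i) x y =
  \sum_(u <- midx_of_deg N)
    Num.sqrt ((midx_nth N.+1 x) j)%:R * Num.sqrt ((midx_nth N.+1 y) i)%:R
     *+ (((midx_nth N.+1 x) == midx_incr j u) && ((midx_nth N.+1 y) == midx_incr i u)).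
Proof.
rewrite mxE -sum_midx; apply: eq_bigr => z _; rewrite !mxE.
by rewrite mulrnAl mulrnAr -mulrnA mulnb andbC.
Qed.

Lemma annih_creat0 i j :
  annih 0 i *m (annih 0 j)^T = (i == j)%:R%:M.
Proof.
apply/matrixP => x y; rewrite annih_creat_entry mxE [x]ord1 [y]ord1 eqxx /=.
case: eqP => [ij|ij].
  have -> : i = j.
    move: ij => /ffunP /(_ i); rewrite !ffunE eqxx !add0n.
    by case: eqP.
  by rewrite eqxx !ffunE eqxx add0n sqrtr1 mulr1.
by case: eqP ij => // -> [].
Qed.

(** The canonical commutation relations. For i = j the diagonal entries are u_i + 1 against u_i; for
    i and j distinct, u + e_i = v + e_j forces u = w + e_j and v = w + e_i, and both sides give the
    same product of square roots. *)
Lemma annih_creat N i j :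
  annih N.+1 i *m (annih N.+1 j)^T =
  (annih N j)^T *m annih N i + (i == j)%:R%:M.
Proof.
apply/matrixP => x y; rewrite annih_creat_entry [RHS]mxE creat_annih_entry mxE.
set u := (midx_nth N.+1 x); set v := (midx_nth N.+1 y).
have [<-{j}|ij] := eqVneq i j.
  rewrite (inj_eq (@midx_incr_inj i)).
  have [uv|/negbTE uv] := eqVneq u v; last first.
    rewrite big1 => [|w _].
      by move: uv; rewrite /u /v nth_midx_inj mulr0n add0r => ->.
    case: andP => // -[/eqP uw /eqP vw].
    by rewrite uw vw eqxx in uv.
  have -> : x = y by apply/eqP; rewrite -nth_midx_inj; apply/eqP.
  rewrite eqxx mulr1n -uv -!expr2 !sqr_sqrtr ?ler0n // ffunE eqxx natrD.
  congr (_ + _).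
  under eq_bigr do rewrite andbb.
  have [u0|] := posnP (u i).
    by rewrite u0 big1 // => w _; rewrite mul0rn.
  move=> /midx_incr_surj [w uw].
  have wN : w \in midx_of_deg N.
    have := mem_nth_midx x; rewrite -/u uw !mem_midx_of_deg sum_midx_incr.
    by rewrite eqSS.
  transitivity (((u i)%:R : R) *+ (w \in midx_of_deg N)); first by rewrite wN.
  rewrite -(sum_pick (fun=> _) w (midx_of_deg_uniq N)).
  by apply: eq_bigr => t _; rewrite uw (inj_eq (@midx_incr_inj i)) eq_sym.
rewrite mul0rn addr0.
have [uv|uv] := eqVneq (midx_incr i u) (midx_incr j v); last first.
  rewrite big1 // => w _; case: andP => // -[/eqP uw /eqP vw].
  by case/eqP: uv; rewrite uw vw; apply/ffunP => l; rewrite !ffunE addnAC.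
have [w uw] : exists w, u = midx_incr j w.
  apply: midx_incr_surj; move: uv => /ffunP /(_ j).
  by rewrite !ffunE eqxx (eq_sym j) (negbTE ij) addn0 addn1 => ->.
have vw : v = midx_incr i w.
  apply/ffunP => l; move: uv => /ffunP /(_ l); by rewrite uw !ffunE addnAC => /addIn.
have wN : w \in midx_of_deg N.
  have := mem_nth_midx x; rewrite -/u uw !mem_midx_of_deg sum_midx_incr.
  by rewrite eqSS.
rewrite mulr1n; under eq_bigr => t _.
  rewrite vw uw (inj_eq (@midx_incr_inj i)) (inj_eq (@midx_incr_inj j)) andbb.
  by rewrite (eq_sym w t); over.
rewrite sum_pick ?midx_of_deg_uniq // wN mulr1n.
by rewrite uw !ffunE !eqxx (eq_sym j) (negbTE ij) !addn0 mulrC.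
Qed.

Lemma annih_comm N i j :
  annih N i *m annih N.+1 j = annih N j *m annih N.+1 i.
Proof.
have E a b x y : (annih N a *m annih N.+1 b) x y =
   Num.sqrt (midx_incr a (midx_nth N x) a)%:R * (Num.sqrt ((midx_nth N.+2 y) b)%:R
     *+ ((midx_nth N.+2 y) == midx_incr b (midx_incr a (midx_nth N x)))).
  rewrite mxE.
  pose G (u : midx) : R := Num.sqrt (u a)%:R * (Num.sqrt ((midx_nth N.+2 y) b)%:R
     *+ ((midx_nth N.+2 y) == midx_incr b u)).
  transitivity (\sum_(u <- midx_of_deg N.+1) G u *+ (u == midx_incr a (midx_nth N x))).
    by rewrite -(@sum_midx N.+1 (fun u => G u *+ _)); apply: eq_bigr => z _; rewrite !mxE /= /G mulrnAl.
  by rewrite sum_pick ?midx_of_deg_uniq // mem_incr.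
apply/matrixP => x y; rewrite !E.
have -> : midx_incr i (midx_incr j (midx_nth N x)) = midx_incr j (midx_incr i (midx_nth N x)).
  by apply/ffunP => l; rewrite !ffunE addnAC.
case: eqP => [->|_]; last by rewrite !mulr0n !mulr0.
rewrite !mulr1n; have [->//|ij] := eqVneq i j.
by rewrite !ffunE !eqxx (eq_sym j) (negbTE ij) !addn0 mulrC.
Qed.

Lemma number_op N : \sum_i (annih N i)^T *m annih N i = N.+1%:R%:M.
Proof.
apply/matrixP => x y; rewrite summxE mxE.
set u := (midx_nth N.+1 x); set v := (midx_nth N.+1 y).
transitivity (\sum_i ((u i)%:R : R) *+ (x == y)); last first.
  rewrite sumrMnl -natr_sum.
  by have := mem_nth_midx x; rewrite mem_midx_of_deg => /eqP ->.
apply: eq_bigr => i _; rewrite creat_annih_entry -/u -/v.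
have [xy|/negbTE xy] := eqVneq x y; last first.
  rewrite big1 // => w _; case: andP => // -[/eqP uw /eqP vw].
  by move: xy; rewrite -nth_midx_inj -/u -/v uw vw eqxx.
rewrite /v -xy -/u -expr2 sqr_sqrtr ?ler0n // mulr1n.
under eq_bigr do rewrite andbb.
have [u0|] := posnP (u i).
  by rewrite u0 big1 // => w _; rewrite mul0rn.
move=> /midx_incr_surj [w uw].
have wN : w \in midx_of_deg N.
  have := mem_nth_midx x; rewrite -/u uw !mem_midx_of_deg sum_midx_incr.
  by rewrite eqSS.
transitivity (((u i)%:R : R) *+ (w \in midx_of_deg N)); last by rewrite wN.
rewrite -(sum_pick (fun=> _) w (midx_of_deg_uniq N)).
by apply: eq_bigr => t _; rewrite uw (inj_eq (@midx_incr_inj i)) eq_sym.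
Qed.

Definition fock_dim N := dimV N.

End Oscillators.

(** The relations through which the Fock space enters all later arguments, so that the explicit
    bases stay hidden. The degree is the index of [ann], and only finite matrices occur. *)
Record fock (R : rcfType) (k : nat) := Fock {
  fdim : nat -> nat;
  ann : forall N, 'I_k -> 'M[R]_(fdim N, fdim N.+1);
  fdim0 : fdim 0 = 1%N;
  ann_cre0 : forall i j, ann 0 i *m (ann 0 j)^T = (i == j)%:R%:M;
  ann_cre : forall N i j, ann N.+1 i *m (ann N.+1 j)^T =
    (ann N j)^T *m ann N i + (i == j)%:R%:M;
  annC : forall N i j, ann N i *m ann N.+1 j = ann N j *m ann N.+1 i;
  ann_num : forall N, \sum_i (ann N i)^T *m ann N i = N.+1%:R%:M
}.

Definition fock_rep (R : rcfType) (k : nat) : fock R k :=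
  @Fock R k _ (@annih R k) erefl (@annih_creat0 R k) (@annih_creat R k)
    (@annih_comm R k) (@number_op R k).

Section Fock.
Variables (R : rcfType) (k : nat) (V : fock R k).
Notation d := (fdim V).
Notation a := (ann V).

Lemma fdim1 : d 1 = k.
Proof.
apply/eqP; rewrite -(eqr_nat R).
have := congr1 (fun A => \tr A) (ann_num V 0); rewrite /= mxtrace_scalar => <-.
rewrite raddf_sum /= (eq_bigr (fun=> 1)) => [|i _].
  by rewrite sumr_const card_ord.
by rewrite mxtrace_mulC ann_cre0 eqxx mxtrace_scalar fdim0.
Qed.

(** Compare the traces of the number operator in two consecutive degrees, using that a_i^T a_i and
    a_i a_i^T have the same trace. *)
Lemma fdimS N : (N.+1 * d N.+1 = (N + k) * d N)%N.
Proof.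
case: N => [|N]; first by rewrite mul1n fdim1 fdim0 muln1.
apply/eqP; rewrite -(eqr_nat R) !natrM.
have := congr1 (fun A => \tr A) (ann_num V N.+1).
have /= := congr1 (fun A => \tr A) (ann_num V N).
rewrite !mxtrace_scalar !raddf_sum /= => trN; rewrite -[_ *+ d N.+2]mulr_natr.
move<-; rewrite natrD mulrDl mulr_natr -trN.
have -> : k%:R * (d N.+1)%:R = \sum_(i < k) ((d N.+1)%:R : R).
  by rewrite sumr_const card_ord mulr_natl.
rewrite -big_split /=; apply/eqP/eq_bigr => i _.
by rewrite mxtrace_mulC ann_cre eqxx raddfD /= mxtrace_scalar.
Qed.

Lemma fdim_gt0 N : (0 < k)%N -> (0 < d N)%N.
Proof.
move=> k0; elim: N => [|N IH]; first by rewrite fdim0.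
by rewrite -(ltn_pmul2l (ltn0Sn N)) muln0 fdimS muln_gt0 IH addn_gt0 k0 orbT.
Qed.

(** The matrix unit E_ij of gl_k acting on polynomials of degree N+1. *)
Definition gl N i j : 'M[R]_(d N.+1) := (a N i)^T *m a N j.

Lemma gl_tr N i j : (gl N i j)^T = gl N j i.
Proof. by rewrite /gl trmx_mul trmxK. Qed.

(** Normal ordering: creation operators are moved to the left at the cost of one contraction. *)
Lemma glM N i j i' j' : gl N.+1 i j *m gl N.+1 i' j' =
  (a N.+1 i)^T *m ((a N i')^T *m a N j) *m a N.+1 j' + (j == i')%:R *: gl N.+1 i j'.
Proof.
rewrite /gl mulmxA -(mulmxA _ (a N.+1 j)) ann_cre mulmxDr mulmxDl.
by rewrite mul_mx_scalar scalemxAl.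
Qed.

(** The normally ordered parts of the two products coincide, because annihilation operators commute;
    only the contractions remain. *)
Lemma gl_comm N i j i' j' :
  gl N.+1 i j *m gl N.+1 i' j' - gl N.+1 i' j' *m gl N.+1 i j =
  (j == i')%:R *: gl N.+1 i j' - (j' == i)%:R *: gl N.+1 i' j.
Proof.
rewrite !glM.
have -> : (a N.+1 i)^T *m ((a N i')^T *m a N j) *m a N.+1 j' =
   (a N.+1 i')^T *m ((a N i)^T *m a N j') *m a N.+1 j.
  by rewrite !mulmxA -!trmx_mul annC -!mulmxA (annC _ _ j).
by rewrite opprD addrACA subrr add0r.
Qed.

End Fock.

(** * The action of gl_k and its quadratic Casimir identities *)

Section Casimir.
Variables (R : rcfType) (k : nat) (V : fock R k).
Notation d := (fdim V).
Notation a := (ann V).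
Notation gl := (gl V).

(** The second quantization of x, that is, the representation of gl_k on polynomials of degree
    N+1. *)
Definition gop N (x : 'M[R]_k) : 'M[R]_(d N.+1) :=
  \sum_p x p.1 p.2 *: gl N p.1 p.2.

Lemma gop_tr N x : (gop N x)^T = gop N x^T.
Proof.
rewrite /gop linear_sum /= (reindex (fun p : 'I_k * 'I_k => (p.2, p.1))) /=.
  by apply: eq_bigr => p _; rewrite linearZ /= gl_tr mxE.
by exists (fun p : 'I_k * 'I_k => (p.2, p.1)) => -[].
Qed.

Lemma gopB N x y : gop N (x - y) = gop N x - gop N y.
Proof. by rewrite /gop -sumrB; apply: eq_bigr => p _; rewrite !mxE scalerBl. Qed.

Lemma gopM N x y : gop N x *m gop N y =
  \sum_p \sum_q (x p.1 p.2 * y q.1 q.2) *: (gl N p.1 p.2 *m gl N q.1 q.2).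
Proof.
rewrite /gop mulmx_suml; apply: eq_bigr => p _.
rewrite mulmx_sumr; apply: eq_bigr => q _.
by rewrite -scalemxAl -scalemxAr scalerA.
Qed.

Lemma sum_gl_contract N (x y : 'M[R]_k) :
  \sum_p \sum_q (x p.1 p.2 * y q.1 q.2) *: ((p.2 == q.1)%:R *: gl N p.1 q.2) =
  gop N (x *m y).
Proof.
transitivity (\sum_i \sum_j \sum_l (x i j * y j l) *: gl N i l).
  rewrite [RHS]pair_bigA /=; apply: eq_bigr => -[i j] _ /=.
  transitivity (\sum_i' \sum_l (x i j * y i' l) *: ((j == i')%:R *: gl N i l)).
    by rewrite pair_bigA.
  rewrite (bigD1 j) //= eqxx [X in _ + X]big1 ?addr0 => [|i' /negbTE i'j].
    by apply: eq_bigr => l _; rewrite scale1r.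
  by rewrite big1 // => l _; rewrite eq_sym i'j scale0r scaler0.
rewrite /gop -(pair_bigA _ (fun i j => (x *m y) i j *: gl N i j)) /=.
apply: eq_bigr => i _; rewrite exchange_big /=; apply: eq_bigr => l _.
by rewrite -scaler_suml mxE.
Qed.

Lemma gop_comm N x y :
  gop N.+1 x *m gop N.+1 y - gop N.+1 y *m gop N.+1 x = gop N.+1 (x *m y - y *m x).
Proof.
rewrite gopB -!sum_gl_contract [X in _ - X = _]gopM exchange_big /= gopM -sumrB.
rewrite [X in _ = _ - X]exchange_big /= -sumrB; apply: eq_bigr => p _.
rewrite -!sumrB; apply: eq_bigr => q _.
by rewrite (mulrC (y _ _)) -!scalerBr gl_comm.
Qed.

Lemma gl_trace N : \sum_i gl N i i = N.+1%:R%:M.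
Proof. exact: ann_num. Qed.

Lemma gop_scalar N t : gop N t%:M = (t * N.+1%:R)%:M.
Proof.
rewrite -scale_scalar_mx -gl_trace /gop.
rewrite -(pair_bigA _ (fun i j => t%:M i j *: gl N i j)) /= scaler_sumr.
apply: eq_bigr => i _; rewrite (bigD1 i) //= mxE eqxx big1 ?addr0 // => j ji.
by rewrite mxE eq_sym (negbTE ji) scale0r.
Qed.

Lemma sum_annih_creat N : \sum_i a N.+1 i *m (a N.+1 i)^T = (N.+1 + k)%:R%:M.
Proof.
under eq_bigr do rewrite ann_cre eqxx.
rewrite big_split /= ann_num sumr_const card_ord natrD raddfD /=.
by rewrite -raddfMn.
Qed.

Lemma gl_swap_sum N :
  \sum_i \sum_j gl N.+1 i j *m gl N.+1 j i = ((N.+1 + k) * N.+2)%:R%:M.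
Proof.
transitivity (\sum_i (a N.+1 i)^T *m (\sum_j a N.+1 j *m (a N.+1 j)^T) *m a N.+1 i).
  apply: eq_bigr => i _; rewrite mulmx_sumr mulmx_suml; apply: eq_bigr => j _.
  by rewrite /gl !mulmxA.
under eq_bigr do rewrite sum_annih_creat mul_mx_scalar -scalemxAl.
by rewrite -scaler_sumr ann_num scale_scalar_mx natrM.
Qed.

(** Creation operators commute, so contracting them with a skew form gives zero. *)
Lemma skew_creat_sum N (J : 'M[R]_k) : J^T = - J ->
  \sum_i \sum_j J i j *: ((a N.+1 i)^T *m (a N j)^T) = 0.
Proof.
move=> skJ; set S := LHS.
have JE i j : J j i = - J i j by have /matrixP/(_ i j) := skJ; rewrite !mxE.
have SN : S = - S.
  rewrite {1}/S exchange_big /= -sumrN; apply: eq_bigr => i _.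
  rewrite -sumrN; apply: eq_bigr => j _.
  by rewrite JE -!trmx_mul annC scaleNr.
have : 2%:R *: S = 0 by rewrite scaler_nat mulr2n {1}SN addNr.
by move/eqP; rewrite scaler_eq0 pnatr_eq0 /= => /eqP.
Qed.

(** After normal ordering, the term with four operators contains the vanishing factor of
    [skew_creat_sum]; the contraction term is [gop] of J J. *)
Lemma gl_skew_sum N (J : 'M[R]_k) : J^T = - J ->
  \sum_p \sum_q (J p.1 q.1 * J p.2 q.2) *: (gl N.+1 p.1 p.2 *m gl N.+1 q.1 q.2) =
  gop N.+1 (J *m J).
Proof.
move=> skJ; rewrite -sum_gl_contract.
pose G i j i' j' := (J i i' * J j j') *:
  ((a N.+1 i)^T *m ((a N i')^T *m a N j) *m a N.+1 j').
have G0 : \sum_p \sum_q G p.1 p.2 q.1 q.2 = 0.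
  transitivity (\sum_i \sum_j \sum_i' \sum_j' G i j i' j').
    rewrite [RHS]pair_bigA /=; apply: eq_bigr => p _.
    by rewrite [RHS]pair_bigA.
  transitivity (\sum_i \sum_i' \sum_j \sum_j' G i j i' j').
    by apply: eq_bigr => i _; rewrite exchange_big.
  transitivity ((\sum_i \sum_i' J i i' *: ((a N.+1 i)^T *m (a N i')^T)) *m
                (\sum_j \sum_j' J j j' *: (a N j *m a N.+1 j'))).
    rewrite mulmx_suml; apply: eq_bigr => i _.
    rewrite mulmx_suml; apply: eq_bigr => i' _.
    rewrite mulmx_sumr; apply: eq_bigr => j _.
    rewrite mulmx_sumr; apply: eq_bigr => j' _.
    by rewrite /G -scalemxAl -scalemxAr scalerA !mulmxA.
  by rewrite skew_creat_sum // mul0mx.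
rewrite -[RHS]add0r -[X in _ = X + _]G0 -[RHS]big_split /=; apply: eq_bigr => p _.
rewrite -[RHS]big_split /=; apply: eq_bigr => q _.
rewrite glM scalerDr; congr (_ + _).
by case: eqP => [->|_] //; rewrite !scale0r !scaler0.
Qed.

(** The Fierz identity splits the sum over r into a swap, an identity and a symplectic term. They
    contribute 2 (N+1+k)(N+2), minus (N+2)^2 and -2 c (N+2). The weights [kappa] stand for the
    squares of the units that are kept apart from the real matrices. *)
Lemma casimir N m (x : 'I_m -> 'M[R]_k) (kappa : 'I_m -> R) (J : 'M[R]_k) (c : R) :
  J^T = - J -> J *m J = - c%:M ->
  (forall p q : 'I_k * 'I_k, \sum_r kappa r * (x r p.1 p.2 * x r q.1 q.2) =
    2 * ((p.1 == q.2)%:R * (p.2 == q.1)%:R) - (p.1 == p.2)%:R * (q.1 == q.2)%:R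
    + 2 * (J p.1 q.1 * J p.2 q.2)) ->
  \sum_r kappa r *: (gop N.+1 (x r) *m gop N.+1 (x r)) =
    (N.+2%:R * (2 * (N.+1 + k)%:R - N.+2%:R - 2 * c))%:M.
Proof.
move=> skJ JJ fierz.
under eq_bigr do rewrite gopM scaler_sumr.
rewrite exchange_big /=.
transitivity (\sum_p \sum_q
   (2 * ((p.1 == q.2)%:R * (p.2 == q.1)%:R) - (p.1 == p.2)%:R * (q.1 == q.2)%:R
    + 2 * (J p.1 q.1 * J p.2 q.2)) *: (gl N.+1 p.1 p.2 *m gl N.+1 q.1 q.2)).
  apply: eq_bigr => p _.
  under eq_bigr do rewrite scaler_sumr.
  rewrite exchange_big /=; apply: eq_bigr => q _.
  rewrite -fierz scaler_suml; apply: eq_bigr => r _.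
  by rewrite scalerA.
have swapE : \sum_p \sum_q
     (2 * ((p.1 == q.2)%:R * (p.2 == q.1)%:R)) *: (gl N.+1 p.1 p.2 *m gl N.+1 q.1 q.2) =
     2 *: ((N.+1 + k) * N.+2)%:R%:M.
  rewrite -gl_swap_sum [in RHS]pair_bigA /= scaler_sumr; apply: eq_bigr => -[i j] _ /=.
  rewrite (bigD1 (j, i)) //= !eqxx !mulr1 big1 ?addr0 // => -[i' j'] /=.
  rewrite xpair_eqE negb_and (eq_sym i') (eq_sym j').
  by move=> /orP[] /negbTE ->; rewrite ?mulr0 ?mul0r ?mulr0 scale0r.
have traceE : \sum_p \sum_q
     ((p.1 == p.2)%:R * (q.1 == q.2)%:R) *: (gl N.+1 p.1 p.2 *m gl N.+1 q.1 q.2) =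
     (N.+2%:R * N.+2%:R)%:M.
  rewrite scalar_mxM -[X in X%:M](mul1r N.+2%:R) -gop_scalar gopM.
  by apply: eq_bigr => p _; apply: eq_bigr => q _; rewrite !mxE.
have skewE : \sum_p \sum_q (2 * (J p.1 q.1 * J p.2 q.2)) *:
     (gl N.+1 p.1 p.2 *m gl N.+1 q.1 q.2) = 2 *: (- c * N.+2%:R)%:M.
  rewrite -gop_scalar raddfN -JJ -gl_skew_sum // scaler_sumr.
  apply: eq_bigr => p _; rewrite scaler_sumr; apply: eq_bigr => q _.
  by rewrite scalerA.
transitivity (2 *: ((N.+1 + k) * N.+2)%:R%:M - (N.+2%:R * N.+2%:R)%:M +
    2 *: (- c * N.+2%:R)%:M : 'M[R]_(d N.+2)).
  rewrite -swapE -traceE -skewE -sumrB -big_split /=; apply: eq_bigr => p _.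
  rewrite -sumrB -big_split /=; apply: eq_bigr => q _.
  by rewrite scalerDl scalerBl.
rewrite !scale_scalar_mx -raddfB -raddfD.
by congr (_%:M); rewrite natrM; ring.
Qed.
End Casimir.

(** * Real matrices acting over the scalars, with norm bounds for the Fock operators *)

Section RealMatrices.
Variables (R : realType) (F : conjScalarType R).

Lemma scalerA_inj : injective (fun t : R => t%:A : F).
Proof.
move=> s t /= st; apply/eqP; rewrite -subr_eq0 -normr_eq0.
by rewrite -(modulusA F) scalerBl st subrr modulus0.
Qed.

Lemma conjs1 : conjs (1 : F) = 1.
Proof.
rewrite -[LHS]mulr1 -[X in _ * X](conjsK (1 : F)) -conjsM mulr1.
by rewrite conjsK.
Qed.

Lemma conjs_real (t : R) : conjs (t%:A : F) = t%:A.
Proof. by rewrite conjsZ conjs1. Qed.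

Lemma adjmx_dotE n (x : 'cV[F]_n) : (adjmx x *m x) 0 0 = (vnorm x ^+ 2)%:A.
Proof.
rewrite vnorm_sqr mxE scaler_suml; apply: eq_bigr => i _.
by rewrite !mxE conjs_mul.
Qed.

Definition qmx (q : F) m n (X : 'M[R]_(m, n)) : 'M[F]_(m, n) :=
  map_mx (fun t => t *: q) X.
Notation emx := (qmx 1).

Lemma qmxM (p q : F) m n l (X : 'M[R]_(m, n)) (Y : 'M[R]_(n, l)) :
  qmx p X *m qmx q Y = qmx (p * q) (X *m Y).
Proof.
apply/matrixP => i j; rewrite !mxE scaler_suml; apply: eq_bigr => s _.
by rewrite !mxE -scalerAl -scalerAr scalerA.
Qed.

Lemma qmxD q m n (X Y : 'M[R]_(m, n)) : qmx q (X + Y) = qmx q X + qmx q Y.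
Proof. by apply/matrixP => i j; rewrite !mxE scalerDl. Qed.

Lemma qmxN q m n (X : 'M[R]_(m, n)) : qmx q (- X) = - qmx q X.
Proof. by apply/matrixP => i j; rewrite !mxE scaleNr. Qed.

Lemma qmx0 q m n : qmx q (0 : 'M[R]_(m, n)) = 0.
Proof. by apply/matrixP => i j; rewrite !mxE scale0r. Qed.

Lemma qmx_sum q m n I (r : seq I) (P : pred I) (G : I -> 'M[R]_(m, n)) :
  qmx q (\sum_(i <- r | P i) G i) = \sum_(i <- r | P i) qmx q (G i).
Proof. exact: (big_morph _ (@qmxD q m n) (qmx0 q m n)). Qed.

Lemma qmx_adj q m n (X : 'M[R]_(m, n)) : adjmx (qmx q X) = qmx (conjs q) X^T.
Proof. by apply/matrixP => i j; rewrite !mxE conjsZ. Qed.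

Lemma emx_adj m n (X : 'M[R]_(m, n)) : adjmx (emx X) = emx X^T.
Proof. by rewrite qmx_adj conjs1. Qed.

Lemma emxM m n l (X : 'M[R]_(m, n)) (Y : 'M[R]_(n, l)) :
  emx X *m emx Y = emx (X *m Y).
Proof. by rewrite qmxM mulr1. Qed.

Lemma qmx_scalar q n (t : R) : qmx q (t%:M : 'M[R]_n) = (t *: q)%:M.
Proof.
apply/matrixP => i j; rewrite !mxE.
by case: eqP => _; rewrite ?mulr1n // mulr0n scale0r.
Qed.

Lemma qmxZ q n (t : R) (X : 'M[R]_n) : (qmx q (t *: X) : mxalg F n) = t *: (qmx q X : mxalg F n).
Proof. by apply/matrixP => i j; rewrite !mxE scalerA. Qed.

Lemma vnorm_gram m n (A : 'M[R]_(m, n)) (v : 'cV[F]_n) :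
  (vnorm (emx A *m v) ^+ 2)%:A = (adjmx v *m (emx (A^T *m A) *m v)) 0 0.
Proof.
by rewrite -adjmx_dotE adjmxM emx_adj -mulmxA (mulmxA (emx A^T)) emxM.
Qed.

Lemma vnorm_emx_tr_le m n (A : 'M[R]_(m, n)) (C : R) : 0 <= C ->
  (forall v : 'cV[F]_n, vnorm (emx A *m v) <= C * vnorm v) ->
  forall w : 'cV[F]_m, vnorm (emx A^T *m w) <= C * vnorm w.
Proof.
move=> C0 AC w; set x := emx A^T *m w.
have [x0|x0] := eqVneq (vnorm x) 0; first by rewrite x0 mulr_ge0 ?vnorm_ge0.
have xp : 0 < vnorm x by rewrite lt0r x0 vnorm_ge0.
rewrite -(ler_pM2r xp) -expr2 -adjmx_dot {1}/x adjmxM emx_adj trmxK -mulmxA.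
apply: le_trans (adjmx_dot_le _ _) _.
by rewrite mulrAC [X in _ <= X]mulrC ler_wpM2l ?vnorm_ge0.
Qed.

Lemma opnorm_qmx_le q n (X : 'M[R]_n) (C : R) : 0 <= C ->
  (forall v : 'cV[F]_n, vnorm (emx X *m v) <= C * vnorm v) ->
  opnorm (qmx q X) <= modulus q * C.
Proof.
move=> C0 XC; apply: opnorm_le => [|v]; first by rewrite mulr_ge0 ?modulus_ge0.
have -> : qmx q X = q%:M *m emx X.
  rewrite -[q in q%:M]scale1r -qmx_scalar qmxM mul1mx mulr1 //.
have -> : vnorm (q%:M *m emx X *m v) = modulus q * vnorm (emx X *m v).
  rewrite -mulmxA -[modulus q]ger0_norm ?modulus_ge0 // -sqrtr_sqr -sqrtrM ?sqr_ge0 //.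
  congr Num.sqrt; rewrite mulr_sumr; apply: eq_bigr => i _.
  by rewrite mul_scalar_mx mxE modulusM exprMn.
by rewrite -mulrA ler_wpM2l ?modulus_ge0.
Qed.

Variables (k : nat) (V : fock R k).
Notation d := (fdim V).
Notation a := (ann V).

(** By the number operator, the squared norms of all a_j v add up to (N+1) times that of v. *)
Lemma vnorm_ann_le N i (v : 'cV[F]_(d N.+1)) :
  vnorm (emx (a N i) *m v) <= Num.sqrt N.+1%:R * vnorm v.
Proof.
rewrite -ler_sqr ?nnegrE ?mulr_ge0 ?sqrtr_ge0 ?vnorm_ge0 // exprMn.
rewrite [X in _ <= X * _]sqr_sqrtr ?ler0n //.
have E : \sum_j vnorm (emx (a N j) *m v) ^+ 2 = N.+1%:R * vnorm v ^+ 2.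
  apply: scalerA_inj; rewrite scaler_suml.
  under eq_bigr do rewrite vnorm_gram.
  rewrite -summxE -mulmx_sumr -mulmx_suml -qmx_sum ann_num qmx_scalar.
  rewrite mul_scalar_mx -scalerA -adjmx_dotE mxE mxE scaler_sumr.
  by apply: eq_bigr => l _; rewrite [X in _ * X]mxE -scalerAl mul1r scalerAr.
rewrite -E.
by rewrite (bigD1 i) //= lerDl sumr_ge0 // => j _; rewrite sqr_ge0.
Qed.

Lemma vnorm_gl_le N i j (v : 'cV[F]_(d N.+1)) :
  vnorm (emx (gl V N i j) *m v) <= N.+1%:R * vnorm v.
Proof.
rewrite /gl -emxM -mulmxA.
have := vnorm_emx_tr_le (sqrtr_ge0 _) (@vnorm_ann_le N i) (emx (a N j) *m v).
move=> /le_trans; apply.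
rewrite -[X in X * vnorm v](@sqr_sqrtr _ N.+1%:R) ?ler0n // expr2 -mulrA.
by rewrite ler_wpM2l ?sqrtr_ge0 // vnorm_ann_le.
Qed.

(** The bound is linear in the degree. As commutators of [gop] operators are again of this form,
    dividing each operator by a quantity of order N leaves commutators of order 1/N. *)
Lemma vnorm_gop_le N x (v : 'cV[F]_(d N.+1)) :
  vnorm (emx (gop V N x) *m v) <= (\sum_p `|x p.1 p.2|) * N.+1%:R * vnorm v.
Proof.
rewrite /gop qmx_sum mulmx_suml !mulr_suml.
elim/big_ind2: _ => [|y1 y2 w1 w2 h1 h2|[i j] _] /=.
- by rewrite vnorm0.
- by rewrite (le_trans (vnormD _ _)) // lerD.
- have -> : emx (x i j *: gl V N i j) *m v = map_mx ( *:%R (x i j)) (emx (gl V N i j) *m v).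
    apply/colP => l; rewrite !mxE scaler_sumr; apply: eq_bigr => s _.
    by rewrite !mxE -scalerA scalerAl.
  by rewrite vnormZ -mulrA ler_wpM2l // vnorm_gl_le.
Qed.

End RealMatrices.

(** The common source of both negative answers. The normalization puts H on a sphere and makes each
    H_r a contraction; K ranges over all commuting self-adjoint families, because those obtained
    from a lift need not be contractions. *)
Definition obstructed (R : realType) (d : nat) (F : conjScalarType R) : Prop :=
  exists2 eps : R, 0 < eps & forall delta : R, 0 < delta ->
  exists n, (0 < n)%N /\ exists H : 'I_d -> mxalg F n,
  [/\ forall r, star (H r) = H r,
      \sum_r H r ⋆ H r = (1%:M : 'M[F]_n),
      forall r s, `‖acomm (H r) (H s)‖ <= delta
    & forall K : 'I_d -> mxalg F n, (forall r, star (K r) = K r) ->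
        (forall r s, acomm (K r) (K s) = 0) ->
        (forall r, `‖K r - H r‖ <= eps) -> False].

(** * Tensor products and maps between neighbouring Fock degrees *)

Section TensLinear.
Variables (R : comNzRingType) (m n p q : nat).
Implicit Types (A : 'M[R]_(m, n)) (B : 'M[R]_(p, q)).

Lemma tensmxDl A A' B : (A + A') *t B = A *t B + A' *t B.
Proof. by apply/matrixP => i j; rewrite !mxE mulrDl. Qed.

Lemma tensmxDr A B B' : A *t (B + B') = A *t B + A *t B'.
Proof. by apply/matrixP => i j; rewrite !mxE mulrDr. Qed.

Lemma tensmxZl t A B : (t *: A) *t B = t *: (A *t B).
Proof. by apply/matrixP => i j; rewrite !mxE mulrA. Qed.

Lemma tensmxZr t A B : A *t (t *: B) = t *: (A *t B).
Proof. by apply/matrixP => i j; rewrite !mxE mulrCA. Qed.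

Lemma tensmx_suml I (r : seq I) (P : pred I) (G : I -> 'M[R]_(m, n)) B :
  (\sum_(i <- r | P i) G i) *t B = \sum_(i <- r | P i) (G i *t B).
Proof. exact: (big_morph (fun A => A *t B) (fun A A' => tensmxDl A A' B) (tens0mx B)). Qed.

Lemma tensmx_sumr I (r : seq I) (P : pred I) (G : I -> 'M[R]_(p, q)) A :
  A *t (\sum_(i <- r | P i) G i) = \sum_(i <- r | P i) (A *t G i).
Proof. exact: (big_morph (fun B => A *t B) (@tensmxDr A) (tensmx0 A)). Qed.
End TensLinear.

Lemma tensmxB_scalar (R : comNzRingType) m p (A : 'M[R]_m) (B : 'M[R]_p) (c : R) :
  A *t (B - c%:M) = A *t B - (c *: A) *t 1%:M.
Proof.
apply/matrixP => i j; rewrite !mxE mulrBr; congr (_ - _).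
by rewrite -mulr_natr mulrA [in LHS](mulrC (A _ _)).
Qed.

Lemma tens_scalar (R : comNzRingType) m p (x y : R) :
  (x%:M : 'M[R]_m) *t (y%:M : 'M[R]_p) = (x * y)%:M.
Proof.
apply/matrixP => i j; case: (mxtens_indexP i) => i1 i2; case: (mxtens_indexP j) => j1 j2.
rewrite tensmxE !mxE (inj_eq (can_inj (@mxtens_indexK _ _))) xpair_eqE.
by rewrite mulrnAl mulrnAr -mulrnA mulnb andbC.
Qed.

Lemma sum_mxtens (R : nmodType) n p (G : 'I_(n * p) -> R) :
  \sum_x G x = \sum_i \sum_a G (mxtens_index (i, a)).
Proof.
rewrite pair_bigA /=.
rewrite (reindex (@mxtens_index n p)) /=; last first.
  exists (@mxtens_unindex n p) => x _; [exact: mxtens_indexK|exact: mxtens_unindexK].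
by apply: eq_bigr => -[].
Qed.

Lemma tensmx11 (R : comNzRingType) m p : (1%:M : 'M[R]_m) *t (1%:M : 'M[R]_p) = 1%:M.
Proof. by rewrite tens_scalar mulr1. Qed.

Section FockTensors.
Variables (R : rcfType) (k : nat) (V : fock R k) (s t : nat).
Variables (f g : 'I_k -> 'M[R]_(s, t)).
Notation d := (fdim V).
Notation a := (ann V).
Notation gl := (gl V).

(** Both matrices take values in degree N+1: [raise_mx] is defined on the higher degree N+2 and
    [lower_mx] on the lower degree N. For suitable f and g they are multiples of isometries whose
    ranges are eigenspaces of the pencils studied below. *)
Definition raise_mx N := \sum_i a N.+1 i *t f i.
Definition lower_mx N := \sum_i (a N i)^T *t g i.

Lemma raise_mx_tr N : (raise_mx N)^T = \sum_i (a N.+1 i)^T *t (f i)^T.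
Proof. by rewrite linear_sum; apply: eq_bigr => i _ /=; exact: trmx_tens. Qed.

Lemma lower_mx_tr N : (lower_mx N)^T = \sum_i (a N i) *t (g i)^T.
Proof. by rewrite linear_sum; apply: eq_bigr => i _ /=; rewrite trmx_tens trmxK. Qed.

(** Orthogonality of the f_i reduces the double sum to the number operator. *)
Lemma raise_gram N (c : R) : (forall i j, (f i)^T *m f j = ((i == j)%:R * c)%:M) ->
  (raise_mx N)^T *m raise_mx N = (N.+2%:R * c)%:M.
Proof.
move=> ff; rewrite raise_mx_tr mulmx_suml.
transitivity (\sum_i ((a N.+1 i)^T *m a N.+1 i) *t (c%:M : 'M[R]_t)).
  apply: eq_bigr => i _; rewrite mulmx_sumr (bigD1 i) //= tensmx_mul ff eqxx mul1r.
  rewrite big1 ?addr0 // => j ji.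
  by rewrite tensmx_mul ff eq_sym (negbTE ji) mul0r raddf0 tensmx0.
by rewrite -tensmx_suml ann_num tens_scalar.
Qed.

Lemma raise_cogram N : raise_mx N *m (raise_mx N)^T =
  \sum_p gl N p.1 p.2 *t (f p.2 *m (f p.1)^T) + 1%:M *t (\sum_i f i *m (f i)^T).
Proof.
rewrite raise_mx_tr mulmx_suml.
transitivity (\sum_i \sum_j ((a N j)^T *m a N i + (i == j)%:R%:M) *t (f i *m (f j)^T)).
  apply: eq_bigr => i _; rewrite mulmx_sumr; apply: eq_bigr => j _.
  by rewrite tensmx_mul ann_cre.
transitivity (\sum_i (\sum_j gl N j i *t (f i *m (f j)^T) + 1%:M *t (f i *m (f i)^T))).
  apply: eq_bigr => i _; rewrite (eq_bigr _ (fun _ _ => tensmxDl _ _ _)) big_split /=.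
  congr (_ + _); rewrite (bigD1 i) //= eqxx big1 ?addr0 // => j ji.
  by rewrite eq_sym (negbTE ji) raddf0 tens0mx.
rewrite big_split /= -tensmx_sumr exchange_big /=; congr (_ + _).
by rewrite pair_bigA.
Qed.

Lemma lower_gram N (c : R) : (forall i j, (g i)^T *m g j = ((i == j)%:R * c)%:M) ->
  (lower_mx N.+1)^T *m lower_mx N.+1 = ((N.+1 + k)%:R * c)%:M.
Proof.
move=> gg; rewrite lower_mx_tr mulmx_suml.
transitivity (\sum_i (a N.+1 i *m (a N.+1 i)^T) *t (c%:M : 'M[R]_t)).
  apply: eq_bigr => i _; rewrite mulmx_sumr (bigD1 i) //= tensmx_mul gg eqxx mul1r.
  rewrite big1 ?addr0 // => j ji.
  by rewrite tensmx_mul gg eq_sym (negbTE ji) mul0r raddf0 tensmx0.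
by rewrite -tensmx_suml sum_annih_creat tens_scalar.
Qed.

Lemma lower_cogram N : lower_mx N *m (lower_mx N)^T =
  \sum_p gl N p.1 p.2 *t (g p.1 *m (g p.2)^T).
Proof.
rewrite lower_mx_tr mulmx_suml.
transitivity (\sum_i \sum_j gl N i j *t (g i *m (g j)^T)); last by rewrite pair_bigA.
apply: eq_bigr => i _; rewrite mulmx_sumr; apply: eq_bigr => j _.
by rewrite tensmx_mul.
Qed.

(** The product pairs the symmetric a_i^T a_j^T with the antisymmetric f_i^T g_j, so it equals its
    own opposite. *)
Lemma raise_lower0 N : (forall i j, (f i)^T *m g j = - ((f j)^T *m g i)) ->
  (raise_mx N.+1)^T *m lower_mx N.+1 = 0.
Proof.
move=> fg; set S := LHS.
have SE : S = \sum_i \sum_j ((a N.+2 i)^T *m (a N.+1 j)^T) *t ((f i)^T *m g j).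
  rewrite /S raise_mx_tr mulmx_suml; apply: eq_bigr => i _.
  by rewrite mulmx_sumr; apply: eq_bigr => j _; rewrite tensmx_mul.
have SN : S = - S.
  rewrite {1}SE exchange_big /= SE -sumrN; apply: eq_bigr => i _.
  rewrite -sumrN; apply: eq_bigr => j _.
  by rewrite fg -!trmx_mul annC -[- (_ *m _)]scaleN1r tensmxZr scaleN1r.
have : 2%:R *: S = 0 by rewrite scaler_nat mulr2n {1}SN addNr.
by move/eqP; rewrite scaler_eq0 pnatr_eq0 /= => /eqP.
Qed.
End FockTensors.

Lemma unitmx_of_ker (F : fieldType) n (A : 'M[F]_n) :
  (forall v : 'cV_n, A *m v = 0 -> v = 0) -> A \in unitmx.
Proof.
move=> kerA; rewrite -unitmx_tr -row_free_unit -kermx_eq0.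
apply/eqP/row_matrixP => i; rewrite row0.
apply: trmx_inj; rewrite trmx0; apply: kerA; apply: trmx_inj.
by rewrite trmx_mul trmxK trmx0 -row_mul mulmx_ker row0.
Qed.

(** By Sylvester's identity U U^T has the eigenvalue a with multiplicity p, and 0 otherwise. *)
Lemma char_poly_affine_gram (F : fieldType) m p (U : 'M[F]_(m, p)) (g b a : F) :
  (p <= m)%N -> U^T *m U = a%:M ->
  char_poly (g *: (U *m U^T) - b%:M) =
    ('X + b%:P) ^+ (m - p) * ('X - (g * a - b)%:P) ^+ p.
Proof.
move=> pm UU; pose z : {poly F} := 'X + b%:P.
have z0 : z != 0 by rewrite -size_poly_gt0 size_XaddC.
rewrite /char_poly /char_poly_mx.
have -> : 'X%:M - map_mx polyC (g *: (U *m U^T) - b%:M) =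
    z%:M - (map_mx polyC (g *: U)) *m (map_mx polyC U^T).
  rewrite -map_mxM -scalemxAl map_mxB map_scalar_mx opprB addrA.
  by rewrite /z raddfD /=.
apply: (mulfI (expf_neq0 p z0)); rewrite det_scalar_sub_mulmxC //.
rewrite -map_mxM -scalemxAr UU.
have -> : z%:M - map_mx polyC (g *: a%:M) = @scalar_mx _ p ('X - (g * a - b)%:P).
  rewrite scale_scalar_mx map_scalar_mx -raddfB /= /z.
  by rewrite polyCB opprB addrA addrAC -addrA.
by rewrite det_scalar mulrA -exprD subnKC.
Qed.

(** * Three quaternionic matrices: the fuzzy 2-sphere and its Pfaffian sign *)

Section QuaternionicOperators.
Variable R : realType.
Notation H := (quat R).

Definition quat_basis (a : 'I_4) : H :=
  Quat (a == 0 :> nat)%:R (a == 1 :> nat)%:R (a == 2 :> nat)%:R (a == 3 :> nat)%:R.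

Definition quat_coord (a : 'I_4) (x : H) : R :=
  match val a with 0 => qre x | 1 => qi x | 2 => qj x | _ => qk x end.

Lemma quat_eqP (x y : H) : (forall a, quat_coord a x = quat_coord a y) -> x = y.
Proof.
move: x y => [x0 x1 x2 x3] [y0 y1 y2 y3] h.
have := h (@Ordinal 4 0 isT); have := h (@Ordinal 4 1 isT).
have := h (@Ordinal 4 2 isT); have := h (@Ordinal 4 3 isT).
by rewrite /quat_coord /= => -> -> -> ->.
Qed.

Lemma quat_coordD a : {morph quat_coord a : x y / x + y}.
Proof. by move: a => [[|[|[|]]] ?]. Qed.

Lemma quat_coord0 a : quat_coord a 0 = 0.
Proof. by move: a => [[|[|[|]]] ?]. Qed.

Lemma quat_coordZ a (t : R) x : quat_coord a (t *: x) = t * quat_coord a x.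
Proof. by move: a => [[|[|[|]]] ?]. Qed.

Lemma quat_coord_sum I (r : seq I) (P : pred I) (G : I -> H) a :
  quat_coord a (\sum_(i <- r | P i) G i) = \sum_(i <- r | P i) quat_coord a (G i).
Proof. exact: (big_morph _ (@quat_coordD a) (quat_coord0 a)). Qed.

Lemma sum_quat_coord x : \sum_a quat_coord a x *: quat_basis a = x.
Proof.
apply: quat_eqP => b; rewrite quat_coord_sum !big_ord_recl big_ord0 !quat_coordZ.
by move: x b => [x0 x1 x2 x3] [[|[|[|[|//]]]] ?] /=; rewrite /quat_coord /quat_basis /=; ring.
Qed.

(** For the Euclidean product on the quaternions, the adjoint of multiplication by k on the left and
    e on the right is multiplication by their conjugates. *)
Lemma quat_coord_conj a b (k e : H) :
  quat_coord a (k * quat_basis b * e) =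
  quat_coord b (conjs k * quat_basis a * conjs e).
Proof.
move: k e a b => [k0 k1 k2 k3] [e0 e1 e2 e3] [[|[|[|[|//]]]] ?] [[|[|[|[|//]]]] ?];
rewrite /quat_coord /quat_basis /=; ring.
Qed.

(** The real matrix of the map v -> K v e on quaternionic columns. Right multiplications commute
    with K, so they can serve as Clifford generators. *)
Definition lrmx n (K : 'M[H]_n) (e : H) : 'M[R]_(n * 4) :=
  \matrix_(x, y) quat_coord (mxtens_unindex x).2
    (K (mxtens_unindex x).1 (mxtens_unindex y).1
       * quat_basis (mxtens_unindex y).2 * e).


Lemma lrmxE n (K : 'M[H]_n) e i a j b :
  lrmx K e (mxtens_index (i, a)) (mxtens_index (j, b)) =
  quat_coord a (K i j * quat_basis b * e).
Proof. by rewrite mxE !mxtens_indexK. Qed.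

Lemma lrmxM n (K K' : 'M[H]_n) e e' :
  lrmx K e *m lrmx K' e' = lrmx (K *m K') (e' * e).
Proof.
apply/matrixP => x y; case: (mxtens_indexP x) => i a; case: (mxtens_indexP y) => j b.
rewrite mxE sum_mxtens lrmxE mxE !mulr_suml quat_coord_sum.
apply: eq_bigr => l _; under eq_bigr do rewrite !lrmxE.
have -> : K i l * K' l j * quat_basis b * (e' * e) =
    K i l * (K' l j * quat_basis b * e') * e by rewrite !mulrA.
rewrite -[in RHS](sum_quat_coord (K' l j * quat_basis b * e')).
rewrite mulr_sumr mulr_suml quat_coord_sum; apply: eq_bigr => c _.
by rewrite -scalerAr -scalerAl quat_coordZ mulrC.
Qed.

Lemma lrmx_is_additive n (e : H) : {morph (fun K : 'M[H]_n => lrmx K e) : K K' / K + K'}.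
Proof. by move=> K K'; apply/matrixP => x y; rewrite !mxE !mulrDl quat_coordD. Qed.

Lemma lrmxZ n (t : R) (K : mxalg H n) e : lrmx (t *: K) e = t *: lrmx K e.
Proof. by apply/matrixP => x y; rewrite !mxE -!scalerAl quat_coordZ. Qed.

Lemma lrmx_tr n (K : 'M[H]_n) e : (lrmx K e)^T = lrmx (adjmx K) (conjs e).
Proof. by apply/matrixP => x y; rewrite !mxE quat_coord_conj. Qed.

Lemma quat_coord_basis a b : quat_coord a (quat_basis b) = (a == b)%:R.
Proof.
by move: a b => [[|[|[|[|//]]]] ?] [[|[|[|[|//]]]] ?]; rewrite /quat_coord /quat_basis.
Qed.

Lemma lrmx1 n : lrmx (1%:M : 'M[H]_n) 1 = 1%:M.
Proof.
apply/matrixP => x y; case: (mxtens_indexP x) => i a; case: (mxtens_indexP y) => j b.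
rewrite lrmxE !mxE mulr1 (inj_eq (can_inj (@mxtens_indexK _ _))) xpair_eqE.
case: eqP => _; rewrite ?mul1r ?mul0r ?quat_coord0 // quat_coord_basis.
by case: eqP.
Qed.

Definition to_quat n (v : 'cV[R]_(n * 4)) : 'cV[H]_n :=
  \col_i \sum_a v (mxtens_index (i, a)) 0 *: quat_basis a.

Lemma quat_modulus_sqr (x : H) : modulus x ^+ 2 = \sum_a quat_coord a x ^+ 2.
Proof.
rewrite sqr_sqrtr; last by rewrite !addr_ge0 ?sqr_ge0.
by rewrite !big_ord_recl big_ord0 addr0 !addrA /quat_coord.
Qed.

Lemma vnorm_to_quat n (v : 'cV[R^o]_(n * 4)) : vnorm (to_quat v) = vnorm v.
Proof.
rewrite /vnorm; congr Num.sqrt; rewrite sum_mxtens; apply: eq_bigr => i _.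
rewrite quat_modulus_sqr mxE; apply: eq_bigr => a _.
rewrite quat_coord_sum (bigD1 a) //= quat_coordZ quat_coord_basis eqxx mulr1.
rewrite big1 ?addr0 => [|b ba]; last first.
  by rewrite quat_coordZ quat_coord_basis eq_sym (negbTE ba) mulr0.
by rewrite real_normK ?num_real.
Qed.

Lemma to_quat_lrmx n (K : 'M[H]_n) e (v : 'cV[R]_(n * 4)) :
  to_quat (lrmx K e *m v) = map_mx (fun x => x * e) (K *m to_quat v).
Proof.
apply/colP => i; rewrite !mxE mulr_suml; apply: quat_eqP => a.
rewrite !quat_coord_sum.
transitivity ((lrmx K e *m v) (mxtens_index (i, a)) 0).
  rewrite (bigD1 a) //= quat_coordZ quat_coord_basis eqxx mulr1.
  rewrite big1 ?addr0 // => b ba.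
  by rewrite quat_coordZ quat_coord_basis eq_sym (negbTE ba) mulr0.
rewrite mxE sum_mxtens; apply: eq_bigr => j _.
rewrite mxE mulr_sumr mulr_suml quat_coord_sum; apply: eq_bigr => b _.
by rewrite lrmxE -scalerAr -scalerAl quat_coordZ mulrC.
Qed.

Lemma vnorm_lrmx n (K : 'M[H]_n) e (v : 'cV[R^o]_(n * 4)) :
  vnorm (lrmx K e *m v : 'cV[R^o]_(n * 4)) <= opnorm K * modulus e * vnorm v.
Proof.
rewrite -vnorm_to_quat to_quat_lrmx -(vnorm_to_quat v) mulrAC.
have -> : vnorm (map_mx (fun x : H => x * e) (K *m to_quat v)) =
    vnorm (K *m to_quat v) * modulus e.
  rewrite -[modulus e]ger0_norm ?modulus_ge0 // -sqrtr_sqr -sqrtrM; last first.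
    by rewrite sumr_ge0 // => *; rewrite sqr_ge0.
  congr Num.sqrt.
  by rewrite mulr_suml; apply: eq_bigr => i _; rewrite mxE modulusM exprMn.
by rewrite ler_wpM2r ?modulus_ge0 // opnormP.
Qed.

Definition lr4 (q e : H) : 'M[R]_4 := \matrix_(a, b) quat_coord a (q * quat_basis b * e).

Lemma lrmx_tens n (X : 'M[R]_n) (q e : H) :
  lrmx (map_mx (fun t : R => t *: q) X) e = X *t lr4 q e.
Proof.
apply/matrixP => x y; case: (mxtens_indexP x) => i a; case: (mxtens_indexP y) => j b.
by rewrite lrmxE tensmxE !mxE -!scalerAl quat_coordZ.
Qed.

End QuaternionicOperators.

Section Quat3.
Variable R : realType.
Notation H := (quat R).
Let qI : H := Quat 0 1 0 0.

(** Multiplied by [sphere2_unit], these are the Pauli matrices up to sign. The imaginary unit is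
    kept apart because the Fock operators are real. *)
Definition sphere2_coef (r i j : nat) : int :=
  match r with
  | 0 => if i == j then if i == 0 then 1 else -1 else 0
  | 1 => if i == j then 0 else if i == 0 then 1 else -1
  | _ => if i == j then 0 else 1
  end.
Definition sphere2_mx (r : 'I_3) : 'M[R]_2 :=
  \matrix_(i, j) (sphere2_coef r i j)%:~R.
Definition sphere2_unit (r : 'I_3) : H := if r == 1 :> nat then qI else 1.
Definition sphere2_sign (r : 'I_3) : R := if r == 1 :> nat then -1 else 1.
Definition quat_imag (r : 'I_3) : H := quat_basis R (lift ord0 r).
Definition block2 (i : 'I_2) : 'M[R]_(4, 2) :=
  \matrix_(a, b) (a == 2 * i + b :> nat)%N%:R.

Lemma sphere2_fierz (p q : 'I_2 * 'I_2) :
  \sum_r sphere2_sign r * (sphere2_mx r p.1 p.2 * sphere2_mx r q.1 q.2) =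
    2 * ((p.1 == q.2)%:R * (p.2 == q.1)%:R) - (p.1 == p.2)%:R * (q.1 == q.2)%:R
    + 2 * ((0 : 'M[R]_2) p.1 q.1 * (0 : 'M[R]_2) p.2 q.2).
Proof.
move: p q => [[[|[|//]] ?] [[|[|//]] ?]] [[[|[|//]] ?] [[|[|//]] ?]];
rewrite !big_ord_recl big_ord0 !mxE /sphere2_sign /sphere2_coef /=; ring.
Qed.

(** The maps x -> -i u_r x e_r act on R^4 as a second copy of the Pauli matrices, so this is the
    identity sum of sigma_r (x) sigma_r = 2 swap - 1, in coordinates. *)
Lemma sphere2_block (i j : 'I_2) :
  \sum_r sphere2_mx r i j *: lr4 (- qI * sphere2_unit r) (quat_imag r) =
  2 *: (block2 j *m (block2 i)^T) - (i == j)%:R%:M.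
Proof.
apply/matrixP => a b; rewrite !big_ord_recl big_ord0.
rewrite !mxE !big_ord_recl big_ord0 !mxE /=.
move: i j a b => [[|[|//]] ?] [[|[|//]] ?] [[|[|[|[|//]]]] ?] [[|[|[|[|//]]]] ?];
rewrite /sphere2_coef /sphere2_unit /quat_coord /quat_imag /quat_basis /=; ring.
Qed.

Lemma block2_gram i j : (block2 i)^T *m block2 j = ((i == j)%:R * 1)%:M.
Proof.
apply/matrixP => a b; rewrite !mxE !big_ord_recl big_ord0 !mxE /=.
by move: i j a b => [[|[|//]] ?] [[|[|//]] ?] [[|[|//]] ?] [[|[|//]] ?] /=; ring.
Qed.

Lemma block2_cogram : \sum_i block2 i *m (block2 i)^T = 1%:M.
Proof.
apply/matrixP => a b; rewrite !big_ord_recl big_ord0.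
rewrite !mxE !big_ord_recl !big_ord0 !mxE /=.
by move: a b => [[|[|[|[|//]]]] ?] [[|[|[|[|//]]]] ?] /=; ring.
Qed.


(** A Dirac-type operator with the imaginary units, multiplying from the right, as Clifford
    generators. It is real skew when the K_r are self-adjoint. *)
Definition quat_pencil n (K : 'I_3 -> 'M[H]_n) : 'M[R]_(n * 4) :=
  \sum_r lrmx (K r) (quat_imag r).
(** The reference skew matrix with square -1 relative to which Pfaffian signs are read off. *)
Definition left_i n : 'M[R]_(n * 4) := lrmx (qmx qI (1%:M : 'M[R]_n)) 1.

Lemma quat_coordN a (x : H) : quat_coord a (- x) = - quat_coord a x.
Proof. by rewrite -scaleN1r quat_coordZ mulN1r. Qed.

Lemma lr4N (q e : H) : lr4 (- q) e = - lr4 q e.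
Proof. by apply/matrixP => a b; rewrite !mxE !mulNr quat_coordN. Qed.

Lemma lrmxNr n (K : 'M[H]_n) (e : H) : lrmx K (- e) = - lrmx K e.
Proof. by apply/matrixP => a b; rewrite !mxE mulrN quat_coordN. Qed.

Lemma lrmxN n (K : 'M[H]_n) (e : H) : lrmx (- K) e = - lrmx K e.
Proof. by apply/matrixP => a b; rewrite !mxE !mulNr quat_coordN. Qed.

Lemma conjs_quat_imag r : conjs (quat_imag r) = - quat_imag r.
Proof.
apply: quat_eqP => a; rewrite quat_coordN.
by move: r a => [[|[|[|//]]] ?] [[|[|[|[|//]]]] ?]; rewrite /quat_coord /= ?oppr0.
Qed.

Lemma quat_imag_sqr r : quat_imag r * quat_imag r = -1.
Proof.
apply: quat_eqP => a.
move: r a => [[|[|[|//]]] ?] [[|[|[|[|//]]]] ?]; rewrite /quat_coord /=; ring.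
Qed.

Lemma quat_imagC r s : r != s -> quat_imag r * quat_imag s = - (quat_imag s * quat_imag r).
Proof.
move=> rs; apply: quat_eqP => a; rewrite quat_coordN.
move: r s a rs => [[|[|[|//]]] ?] [[|[|[|//]]] ?] [[|[|[|[|//]]]] ?] // _;
rewrite /quat_coord /=; ring.
Qed.

Lemma quat_pencil_skew n (K : 'I_3 -> mxalg H n) : (forall r, star (K r) = K r) ->
  (quat_pencil K)^T = - quat_pencil K.
Proof.
move=> saK; rewrite /quat_pencil linear_sum -sumrN; apply: eq_bigr => r _ /=.
by rewrite lrmx_tr conjs_quat_imag lrmxNr; congr (- lrmx _ _); exact: saK.
Qed.

Lemma left_i_skew n : (left_i n)^T = - left_i n.
Proof.
rewrite /left_i lrmx_tr conjs1 qmx_adj trmx1 -lrmxN; congr (lrmx _ _).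
apply/matrixP => i j; rewrite !mxE; case: eqP => _; apply: quat_eqP => a;
by move: a => [[|[|[|[|//]]]] ?]; rewrite /quat_coord /=; ring.
Qed.

Lemma left_i_sqr n : left_i n *m left_i n = - 1%:M.
Proof.
rewrite /left_i lrmxM qmxM mulmx1 mulr1 -lrmx1 -lrmxN; congr (lrmx _ _).
apply/matrixP => i j; rewrite !mxE; case: eqP => _; apply: quat_eqP => a;
by move: a => [[|[|[|[|//]]]] ?]; rewrite /quat_coord /=; ring.
Qed.

Lemma modulus_quat_imag r : modulus (quat_imag r) = 1.
Proof.
rewrite /= -[RHS]sqrtr1; congr Num.sqrt.
by move: r => [[|[|[|//]]] ?] /=; ring.
Qed.

End Quat3.

Section Quat3b.
Variable R : realType.
Notation H := (quat R).
Let qI : H := Quat 0 1 0 0.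
Section Sphere.
Variables (N : nat) (V : fock R 2).
Notation n := (fdim V N.+2).
Notation X r := (gop V N.+1 (sphere2_mx R r)).

Definition sphere2_op (r : 'I_3) : mxalg H n := qmx (sphere2_unit R r) (X r).

(** Once [sphere2_block] is inserted, the quadratic part is the one of [raise_cogram]. With
    [raise_gram], the eigenvalues are N+2 on the range of the isometry and -(N+4) on its
    complement. *)
Lemma sphere2_pencil :
  - (left_i R n *m quat_pencil sphere2_op) =
  2%:R *: (raise_mx V (block2 R) N.+1 *m (raise_mx V (block2 R) N.+1)^T) - (N.+4%:R)%:M.
Proof.
rewrite raise_cogram block2_cogram tens_scalar mulr1 scalerDr -addrA.
transitivity (\sum_r (X r) *t lr4 (- qI * sphere2_unit R r) (quat_imag R r)).
  rewrite /quat_pencil mulmx_sumr -sumrN; apply: eq_bigr => r _.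
  rewrite /left_i lrmxM qmxM mul1mx mulr1 lrmx_tens mulNr lr4N.
  by rewrite -[in RHS]scaleN1r tensmxZr scaleN1r.
under eq_bigr do rewrite /gop tensmx_suml.
rewrite exchange_big /=.
transitivity (\sum_p gl V N.+1 p.1 p.2 *t
    (2 *: (block2 R p.2 *m (block2 R p.1)^T) - (p.1 == p.2)%:R%:M)).
  apply: eq_bigr => p _; rewrite -sphere2_block tensmx_sumr.
  by apply: eq_bigr => r _; rewrite tensmxZl tensmxZr.
transitivity (\sum_p (2%:R *: (gl V N.+1 p.1 p.2 *t (block2 R p.2 *m (block2 R p.1)^T)) -
    ((p.1 == p.2)%:R *: gl V N.+1 p.1 p.2) *t 1%:M)).
  apply: eq_bigr => p _; rewrite -tensmxZr; exact: tensmxB_scalar.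
rewrite sumrB -scaler_sumr; congr (_ + _).
rewrite -tensmx_suml (_ : \sum_p _ = gop V N.+1 1%:M); last first.
  by apply: eq_bigr => p _; rewrite mxE.
rewrite gop_scalar tens_scalar scale_scalar_mx -raddfB -raddfN; congr (_%:M).
by rewrite -[N.+4]addn2 natrD; ring.
Qed.
End Sphere.
End Quat3b.

Lemma char_poly_gram_sqrt (F : fieldType) m p (U : 'M[F]_(m, p)) (g b a : F) m' p' :
  (p' <= m')%N -> m = (m' + m')%N -> p = (p' + p')%N -> U^T *m U = a%:M ->
  exists q : {poly F}, [/\ q \is monic,
    q ^+ 2 = char_poly (g *: (U *m U^T) - b%:M) &
    q.[0] = b ^+ (m' - p') * (b - g * a) ^+ p'].
Proof.
move=> pm em ep UU.
exists (('X + b%:P) ^+ (m' - p') * ('X - (g * a - b)%:P) ^+ p'); split.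
- rewrite monicMl monic_exp ?monicXsubC //.
  by rewrite -[b]opprK polyCN monicXsubC.
- rewrite (char_poly_affine_gram _ _ _ UU); last lia.
  by rewrite em ep exprMn -!exprM; congr (_ ^+ _ * _ ^+ _); lia.
- by rewrite !hornerE /= ?add0r ?sub0r opprB.
Qed.

Section RealVnorm.
Variable R : realType.
Definition rnorm n (v : 'cV[R]_n) : R := @vnorm R R^o n v.

Lemma rnorm_ge0 n (v : 'cV[R]_n) : 0 <= rnorm v.
Proof. exact: vnorm_ge0. Qed.

Lemma rnorm_eq0 n (v : 'cV[R]_n) : rnorm v = 0 -> v = 0.
Proof. exact: vnorm_eq0. Qed.

Lemma rnormD n (u v : 'cV[R]_n) : rnorm (u + v) <= rnorm u + rnorm v.
Proof. exact: vnormD. Qed.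

Lemma rnorm_sqr n (v : 'cV[R]_n) : rnorm v ^+ 2 = (v^T *m v) 0 0.
Proof.
rewrite /rnorm vnorm_sqr mxE; apply: eq_bigr => i _.
by rewrite mxE /= real_normK ?num_real // expr2.
Qed.

Lemma rnormZ n (t : R) (v : 'cV[R]_n) : rnorm (t *: v) = `|t| * rnorm v.
Proof.
rewrite /rnorm -(@vnormZ R R^o); congr (@vnorm R R^o _ _).
by apply/colP => i; rewrite !mxE.
Qed.

Lemma rnormN n (v : 'cV[R]_n) : rnorm (- v) = rnorm v.
Proof. by rewrite -scaleN1r rnormZ normrN1 mul1r. Qed.

Lemma rnorm_isom m n (A : 'M[R]_(m, n)) (c : R) (v : 'cV[R]_n) : 0 <= c ->
  A^T *m A = (c ^+ 2)%:M -> rnorm (A *m v) = c * rnorm v.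
Proof.
move=> c0 AA; apply: (@pexpIrn _ 2) => //; rewrite ?nnegrE ?mulr_ge0 ?rnorm_ge0 //.
rewrite exprMn !rnorm_sqr trmx_mul -mulmxA (mulmxA A^T) AA.
by rewrite mul_scalar_mx -scalemxAr mxE.
Qed.

Lemma rnorm_sum n I (r : seq I) (P : pred I) (G : I -> 'cV[R]_n) :
  rnorm (\sum_(i <- r | P i) G i) <= \sum_(i <- r | P i) rnorm (G i).
Proof.
elim/big_rec2: _ => [|i y x _ le_xy]; first by rewrite /rnorm vnorm0.
by rewrite (le_trans (rnormD _ _)) // lerD2l.
Qed.
End RealVnorm.

Section Quat3c.
Variable R : realType.
Notation H := (quat R).
Let qI : H := Quat 0 1 0 0.

Lemma fdim2 (V : fock R 2) N : fdim V N = N.+1.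
Proof.
elim: N => [|N IH]; first exact: fdim0.
by apply/eqP; rewrite -(eqn_pmul2l (ltn0Sn N)) fdimS IH mulnC addn2.
Qed.

Section Sphere.
Variables (N : nat) (V : fock R 2).
Notation n := (fdim V N.+2).
Notation m := (n * 4)%N.

Lemma quat_pencilZ l (t : R) (K : 'I_3 -> mxalg H l) :
  quat_pencil (fun r => t *: K r) = t *: quat_pencil K.
Proof.
by rewrite /quat_pencil scaler_sumr; apply: eq_bigr => r _; rewrite lrmxZ.
Qed.

(** The eigenvalue c (N+2) has multiplicity 2 (N+4) and -c (N+4) has multiplicity 2 (N+2); the
    square root of the characteristic polynomial halves both. *)
Lemma sphere2_pencil_sqrt (c : R) : exists q : {poly R}, [/\ q \is monic,
  q ^+ 2 = char_poly (- (left_i R n *m quat_pencil (fun r => c *: sphere2_op N V r))) &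
  q.[0] = (c * N.+4%:R) ^+ N.+2 * (- (c * N.+2%:R)) ^+ N.+4].
Proof.
have gram := @raise_gram R 2 V 4 2 (block2 R) N.+1 1 (@block2_gram R).
have e4 : (n * 4 = (2 * n) + (2 * n))%N by lia.
have e2 : (fdim V N.+3 * 2 = fdim V N.+3 + fdim V N.+3)%N by lia.
have [|q [q1 q2 q3]] := char_poly_gram_sqrt (c * 2) (c * N.+4%:R) _ e4 e2 gram.
  rewrite !fdim2; lia.
exists q; split=> //.
  rewrite q2 quat_pencilZ -scalemxAr -scalerN sphere2_pencil scalerBr scalerA.
  by rewrite scale_scalar_mx.
rewrite q3 !fdim2; congr (_ ^+ _ * _ ^+ _); first lia.
by rewrite -[N.+4]addn2 -[N.+3]addn1 -[N.+2]addn2 !natrD; ring.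
Qed.

Definition north_pole l (r : 'I_3) : mxalg H l := if r == 0 :> nat then (1%:M : 'M[H]_l) else 0.

(** The eigenvalues are 1 and -1, each of multiplicity 2 l. *)
Lemma north_pole_sqrt l : exists q : {poly R}, [/\ q \is monic,
  q ^+ 2 = char_poly (- (left_i R l *m quat_pencil (north_pole l))) &
  q.[0] = (-1) ^+ l].
Proof.
pose U := (1%:M : 'M[R]_l) *t block2 R ord0.
have gram : U^T *m U = 1%:M.
  by rewrite /U trmx_tens tensmx_mul trmx1 mulmx1 block2_gram eqxx !mul1r tens_scalar mulr1.
have e4 : (l * 4 = (2 * l) + (2 * l))%N by lia.
have e2 : (l * 2 = l + l)%N by lia.
have [|q [q1 q2 q3]] := char_poly_gram_sqrt 2%:R 1 _ e4 e2 gram; first lia.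
exists q; split=> //.
  rewrite q2; congr char_poly.
  rewrite /quat_pencil !big_ord_recl big_ord0 /north_pole /=.
  have lrmx0 e : lrmx (0 : 'M[H]_l) e = 0.
    by apply/matrixP => i j; rewrite !mxE !mul0r quat_coord0.
  rewrite !lrmx0 !addr0.
  rewrite /U trmx_tens tensmx_mul trmx1 mulmx1.
  have -> : (1%:M : 'M[H]_l) = qmx 1 1%:M by rewrite qmx_scalar scale1r.
  rewrite /left_i lrmxM qmxM mul1mx !mulr1 lrmx_tens.
  transitivity ((1%:M : 'M[R]_l) *t (2%:R *: (block2 R ord0 *m (block2 R ord0)^T) - 1%:M)).
    by rewrite tensmxB_scalar scale1r tens_scalar mulr1 tensmxZr.
  have := @sphere2_block R ord0 ord0; rewrite eqxx.
  have -> : (true%:R : R) = 1 by [].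
  move=> <-; rewrite !big_ord_recl big_ord0.
  have -> : sphere2_mx R ord0 ord0 ord0 = 1 by rewrite mxE.
  have -> : sphere2_mx R (lift ord0 ord0) ord0 ord0 = 0 by rewrite mxE.
  have -> : sphere2_mx R (lift ord0 (lift ord0 ord0)) ord0 ord0 = 0 by rewrite mxE.
  rewrite !scale0r !addr0 scale1r.
  rewrite (_ : sphere2_unit R ord0 = 1) // mulr1 lr4N -scaleN1r tensmxZr scaleN1r.
  by congr (- (_ *t lr4 _ _)).
rewrite q3 expr1n mul1r mulr1; congr (_ ^+ _); ring.
Qed.

(** The two eigenvalues N+2 and -(N+4) are symmetric about -1, so adding 1 gives N+3 times an
    isometry; the triangle inequality loses one. The factor [left_i] is orthogonal. *)
Lemma sphere2_pencil_lower (c : R) (v : 'cV[R]_m) : 0 <= c ->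
  c * N.+2%:R * rnorm v <=
  rnorm (quat_pencil (fun r => c *: sphere2_op N V r) *m v).
Proof.
move=> c0; rewrite quat_pencilZ -scalemxAl rnormZ ger0_norm // -mulrA.
rewrite ler_wpM2l //.
have gram := @raise_gram R 2 V 4 2 (block2 R) N.+1 1 (@block2_gram R).
have Mdef := sphere2_pencil N V.
set U := raise_mx _ _ _ in gram Mdef; set A := quat_pencil _ in Mdef *.
set M := - _ in Mdef.
have -> : rnorm (A *m v) = rnorm (M *m v).
  rewrite /M mulNmx rnormN -mulmxA (rnorm_isom (A := left_i R n) (c := 1)) ?ler01 ?mul1r //.
  by rewrite left_i_skew mulNmx left_i_sqr opprK expr1n.
have M1 : rnorm ((M + 1%:M) *m v) = N.+3%:R * rnorm v.
  apply: rnorm_isom; first exact: ler0n.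
  have -> : M + 1%:M = 2%:R *: (U *m U^T) - N.+3%:R%:M.
    have -> : M = 2%:R *: (U *m U^T) - (N.+3%:R%:M + 1%:M).
      by rewrite Mdef -raddfD /= natr1.
    by rewrite opprD addrA subrK.
  have UUUU : (U *m U^T) *m (U *m U^T) = N.+3%:R *: (U *m U^T).
    by rewrite mulmxA -(mulmxA U U^T) gram mulr1 mul_mx_scalar -scalemxAl.
  have trU : (U *m U^T)^T = U *m U^T by rewrite trmx_mul trmxK.
  have -> : (2%:R *: (U *m U^T) - N.+3%:R%:M)^T = 2%:R *: (U *m U^T) - N.+3%:R%:M.
    by rewrite raddfB /= linearZ /= trU tr_scalar_mx.
  rewrite mulmxBl mulmxBr mul_scalar_mx mul_mx_scalar -scalemxAl -scalemxAr UUUU.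
  rewrite scalerBr !scalerA scale_scalar_mx -expr2 opprB addrA.
  rewrite addrAC [X in X + _](_ : _ = 0) ?add0r //.
  rewrite -scalerBl -scalerBl [X in X *: _](_ : _ = 0) ?scale0r //; ring.
have := rnormD (M *m v) v.
rewrite -[X in rnorm (_ + X)]mul1mx -mulmxDl M1.
have -> : (N.+3%:R : R) = N.+2%:R + 1 by rewrite -[N.+3]addn1 natrD.
by rewrite mulrDl mul1r lerD2r.
Qed.
End Sphere.
End Quat3c.

(** The determinant of A + s is a nonzero polynomial in s, and the numbers e / (k+1) are more
    numerous than its roots. *)
Lemma exists_shift_unitmx (R : realFieldType) n (A : 'M[R]_n) (e : R) : 0 < e ->
  exists2 s, 0 < s <= e & A + s%:M \in unitmx.
Proof.
move=> e0; pose p := char_poly (- A).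
have pE s : p.[s] = \det (A + s%:M).
  rewrite -[p.[s]]/(horner_eval s p) -det_map_mx; congr (\det _).
  by apply/matrixP => i j; rewrite !mxE /= /horner_eval polyCN opprK !hornerE hornerMn hornerX addrC.
have p0 : p != 0 by rewrite monic_neq0 // char_poly_monic.
pose s k : R := e / k.+1%:R.
have : ~~ all (root p) [seq s k | k <- iota 0 (size p)].
  apply/negP => rt; have := max_poly_roots p0 rt.
  rewrite size_map size_iota ltnn => /(_ _)/notF; apply.
  rewrite map_inj_uniq ?iota_uniq // => k l /(mulfI (lt0r_neq0 e0)) /invr_inj /eqP.
  by rewrite eqr_nat eqSS => /eqP.
move=> /allPn [_ /mapP [k _ ->]]; rewrite rootE pE -unitfE -unitmxE => u.
exists (s k) => //; rewrite divr_gt0 ?ltr0n //= ler_pdivrMr ?ltr0n //.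
by rewrite ler_peMr ?(ltW e0) // ler1n.
Qed.

Section Pencil.
Variables (R : realType) (n : nat).
Notation H := (quat R).
Notation m := (n * 4)%N.
Implicit Types K C : 'I_3 -> mxalg H n.

Lemma quat_pencilD K C : quat_pencil (fun r => K r + C r) = quat_pencil K + quat_pencil C.
Proof.
rewrite /quat_pencil -big_split; apply: eq_bigr => r _.
exact: lrmx_is_additive.
Qed.

Lemma rnorm_quat_pencil K (v : 'cV[R]_m) :
  rnorm (quat_pencil K *m v) <= (\sum_r `‖K r‖) * rnorm v.
Proof.
rewrite /quat_pencil mulmx_suml mulr_suml (le_trans (rnorm_sum _ _ _)) //.
apply: ler_sum => r _.
by have := vnorm_lrmx (K r) (quat_imag R r) v; rewrite modulus_quat_imag mulr1.
Qed.

(** A pencil bounded below by c stays injective under a perturbation of norm less than c. *)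
Lemma quat_pencil_near_unit K C (c : R) :
  (forall v, c * rnorm v <= rnorm (quat_pencil C *m v)) ->
  \sum_r `‖K r - C r‖ < c ->
  forall t, 0 <= t <= 1 -> quat_pencil C + t *: (quat_pencil K - quat_pencil C) \in unitmx.
Proof.
move=> lowC close t /andP[t0 t1]; apply: unitmx_of_ker => v.
rewrite mulmxDl => /eqP; rewrite addr_eq0 => /eqP Cv.
have := lowC v; rewrite Cv rnormN -scalemxAl.
have -> : quat_pencil K - quat_pencil C = quat_pencil (fun r => K r - C r).
  by apply/eqP; rewrite subr_eq -quat_pencilD; apply/eqP; congr quat_pencil;
    apply/funext => r; rewrite subrK.
rewrite rnormZ ger0_norm // => h.
have := rnorm_quat_pencil (fun r => K r - C r) v.
have := rnorm_ge0 v; have := rnorm_ge0 (quat_pencil (fun r => K r - C r) *m v).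
move: close h; set y := rnorm v; set x := rnorm (_ *m v); set z := \sum_r _.
move=> zc h x0 y0 xz; apply: rnorm_eq0; rewrite -/y; apply/eqP; rewrite eq_le y0 andbT leNgt.
apply/negP => yp; have zy : z * y < c * y by rewrite ltr_pM2r.
have tx : t * x <= x by rewrite ler_piMl.
by have := lt_le_trans zy (le_trans h (le_trans tx xz)); rewrite ltxx.
Qed.

(** The imaginary units anticommute and square to -1, so for commuting C_r the cross terms cancel in
    pairs. *)
Lemma quat_pencil_sqr C : (forall r s, acomm (C r) (C s) = 0) ->
  quat_pencil C *m quat_pencil C = - \sum_r lrmx (C r ⋆ C r) 1.
Proof.
move=> comC; rewrite /quat_pencil mulmx_suml.
pose E r s := lrmx (C r ⋆ C s) (quat_imag R s * quat_imag R r).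
have EE r : lrmx (C r) (quat_imag R r) *m (\sum_s lrmx (C s) (quat_imag R s)) =
    - lrmx (C r ⋆ C r) 1 + \sum_s (if s == r then 0 else E r s).
  rewrite mulmx_sumr (bigD1 r) //= [in RHS](bigD1 r) //= eqxx add0r.
  congr (_ + _); first by rewrite lrmxM quat_imag_sqr lrmxNr.
  by apply: eq_bigr => s /negbTE ->; rewrite lrmxM.
under eq_bigr do rewrite EE.
rewrite big_split /= sumrN -[RHS]addr0; congr (_ + _).
set S := LHS.
have SN : S = - S.
  rewrite {1}/S exchange_big /= -sumrN; apply: eq_bigr => r _.
  rewrite -sumrN; apply: eq_bigr => s _; rewrite eq_sym.
  case: (eqVneq s r) => sr; first by rewrite oppr0.
  have /eqP := comC s r; rewrite subr_eq0 => /eqP comsr.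
  by rewrite /E comsr quat_imagC ?lrmxNr // eq_sym.
have : 2%:R *: S = 0 by rewrite scaler_nat mulr2n {1}SN addNr.
by move/eqP; rewrite scaler_eq0 pnatr_eq0 /= => /eqP.
Qed.

(** Pairing the square of the pencil with v gives minus the sum of the squared norms of the C_r
    v. *)
Lemma quat_pencil_ker C (v : 'cV[R]_m) : (forall r, star (C r) = C r) ->
  (forall r s, acomm (C r) (C s) = 0) -> quat_pencil C *m v = 0 ->
  forall r, lrmx (C r) 1 *m v = 0.
Proof.
move=> saC comC Cv r.
have E s : ((v^T *m lrmx (C s ⋆ C s) 1 *m v) 0 0) = rnorm (lrmx (C s) 1 *m v) ^+ 2.
  rewrite rnorm_sqr trmx_mul lrmx_tr conjs1 (_ : adjmx (C s) = C s); last exact: saC.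
  have -> : lrmx (C s ⋆ C s) 1 = lrmx (C s) 1 *m lrmx (C s) 1 by rewrite lrmxM mulr1.
  by rewrite !mulmxA.
have : \sum_s rnorm (lrmx (C s) 1 *m v) ^+ 2 = 0.
  under eq_bigr do rewrite -E.
  rewrite -summxE -mulmx_suml -mulmx_sumr.
  have := quat_pencil_sqr comC => /(congr1 -%R); rewrite opprK => <-.
  by rewrite mulmxN mulNmx -!mulmxA Cv !mulmx0 oppr0 mxE.
move=> /psumr_eq0P/(_ r isT)/eqP; rewrite sqrf_eq0 => h.
by apply: rnorm_eq0; apply/eqP/h => s _; rewrite sqr_ge0.
Qed.

Lemma north_poleC r (A : mxalg H n) : north_pole R n r ⋆ A = A ⋆ north_pole R n r.
Proof.
rewrite /north_pole; case: ifP => _; first by rewrite [LHS]mul1mx [RHS]mulmx1.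
by rewrite [LHS]mul0mx [RHS]mulmx0.
Qed.

Lemma north_pole_star r : star (north_pole R n r) = north_pole R n r.
Proof.
rewrite /north_pole; case: ifP => _; apply/matrixP => i j; rewrite !mxE; last exact: conjs0.
by rewrite eq_sym; case: eqP => _; rewrite ?conjs1 // ?conjs0.
Qed.

(** The segment stays inside commuting self-adjoint families, so by [quat_pencil_ker] one injective
    component suffices: component 1, equal to (1 - t) K_1, for t < 1, and component 0, the identity,
    at t = 1. *)
Lemma quat_pencil_north_unit K : (forall r, star (K r) = K r) ->
  (forall r s, acomm (K r) (K s) = 0) -> lrmx (K (lift ord0 ord0)) 1 \in unitmx ->
  forall t, 0 <= t <= 1 ->
  quat_pencil K + t *: (quat_pencil (north_pole R n) - quat_pencil K) \in unitmx.
Proof.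
move=> saK comK uK t t01; apply: unitmx_of_ker => v.
pose C r := (1 - t) *: K r + t *: north_pole R n r.
have -> : quat_pencil K + t *: (quat_pencil (north_pole R n) - quat_pencil K) = quat_pencil C.
  rewrite quat_pencilD !quat_pencilZ scalerBl scale1r scalerBr addrA.
  by rewrite addrAC.
have saC r : star (C r) = C r by rewrite starD !starZ saK north_pole_star.
have comC r s : acomm (C r) (C s) = 0.
  have /eqP := comK r s; rewrite subr_eq0 => /eqP comrs.
  apply/eqP; rewrite subr_eq0; apply/eqP.
  rewrite /C !amulDl !amulDr !amulZl !amulZr comrs !(north_poleC r).
  rewrite -!(north_poleC s) !scalerA !(mulrC t) -!addrA; congr (_ + _).
  by rewrite addrCA.
move=> /(quat_pencil_ker saC comC) Cv.
have [t1|t1] := eqVneq t 1.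
  have := Cv ord0; rewrite /C /north_pole /= t1 subrr scale0r add0r scale1r lrmx1.
  by rewrite mul1mx.
have := Cv (lift ord0 ord0); rewrite /C /north_pole /= scaler0 addr0 lrmxZ -scalemxAl.
move/eqP; rewrite scaler_eq0 subr_eq0 eq_sym (negbTE t1) /= => /eqP Kv.
by rewrite -(mulKmx uK v) Kv mulmx0.
Qed.
End Pencil.

Section Quat3e.
Variable R : realType.
Notation H := (quat R).
Let qI : H := Quat 0 1 0 0.
Notation V := (fock_rep R 2).
Notation n N := (fdim V N.+2).

Lemma sphere2_op_star N r : star (sphere2_op N V r) = sphere2_op N V r.
Proof.
rewrite /sphere2_op [LHS]qmx_adj gop_tr.
suff -> : qmx (conjs (sphere2_unit R r)) (gop V N.+1 (sphere2_mx R r)^T) =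
   qmx (sphere2_unit R r) (gop V N.+1 (sphere2_mx R r)) by [].
have trE : (sphere2_mx R r)^T = sphere2_sign R r *: sphere2_mx R r.
  apply/matrixP => i j; rewrite !mxE /sphere2_sign.
  by move: r i j => [[|[|[|//]]] ?] [[|[|//]] ?] [[|[|//]] ?];
    rewrite /sphere2_coef /=; ring.
have conjE : conjs (sphere2_unit R r) = sphere2_sign R r *: sphere2_unit R r.
  rewrite /sphere2_unit /sphere2_sign; case: ifP => _; last by rewrite conjs1 scale1r.
  by apply: quat_eqP => -[[|[|[|[|//]]]] ?]; rewrite /quat_coord /=; ring.
have ss : sphere2_sign R r * sphere2_sign R r = 1.
  by rewrite /sphere2_sign; case: ifP => _; ring.
have -> : gop V N.+1 (sphere2_mx R r)^T = sphere2_sign R r *: gop V N.+1 (sphere2_mx R r).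
  rewrite trE /gop scaler_sumr; apply: eq_bigr => p _.
  by rewrite scalerA; congr (_ *: _); rewrite mxE.
rewrite conjE; apply/matrixP => i j; rewrite !mxE scalerA mulrAC ss mul1r.
by [].
Qed.

Lemma sphere2_unitC r s : sphere2_unit R r * sphere2_unit R s =
  sphere2_unit R s * sphere2_unit R r.
Proof. by rewrite /sphere2_unit; do 2 case: ifP => _; rewrite ?mul1r ?mulr1. Qed.

Lemma modulus_sphere2_unit r : modulus (sphere2_unit R r) = 1.
Proof.
rewrite /sphere2_unit; case: ifP => _; last exact: modulus1.
rewrite /= -[RHS]sqrtr1; congr Num.sqrt => /=; ring.
Qed.

Lemma sphere2_unit_sqr r : sphere2_unit R r * sphere2_unit R r = (sphere2_sign R r)%:A.
Proof.
rewrite /sphere2_unit /sphere2_sign; case: ifP => _; last by rewrite mulr1 scale1r.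
by apply: quat_eqP => -[[|[|[|[|//]]]] ?]; rewrite /quat_coord /=; ring.
Qed.

Lemma sphere2_op_sqr N : \sum_r sphere2_op N V r ⋆ sphere2_op N V r =
  ((N.+2%:R * N.+4%:R)%:A)%:M :> 'M[H]_(n N).
Proof.
transitivity (qmx 1 (\sum_r sphere2_sign R r *:
    (gop V N.+1 (sphere2_mx R r) *m gop V N.+1 (sphere2_mx R r))) : 'M[H]_(n N)).
  rewrite qmx_sum; apply: eq_bigr => r _; rewrite [LHS]qmxM sphere2_unit_sqr.
  by apply/matrixP => i j; rewrite !mxE scalerA mulrC.
rewrite (@casimir R 2 V N 3 (sphere2_mx R) (sphere2_sign R) 0 0); last first.
- by move=> p q; exact: sphere2_fierz.
- by rewrite mulmx0 raddf0 oppr0.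
- by rewrite trmx0 oppr0.
rewrite qmx_scalar; congr (_%:A%:M).
by rewrite -[N.+4]addn2 -[N.+2]addn1 !natrD; ring.
Qed.

Definition sphere2_bracket r s : 'M[R]_2 :=
  sphere2_mx R r *m sphere2_mx R s - sphere2_mx R s *m sphere2_mx R r.

Lemma sphere2_op_comm N r s :
  `‖acomm (sphere2_op N V r) (sphere2_op N V s)‖ <=
  (\sum_p `|sphere2_bracket r s p.1 p.2|) * N.+2%:R.
Proof.
have -> : acomm (sphere2_op N V r) (sphere2_op N V s) =
    qmx (sphere2_unit R r * sphere2_unit R s) (gop V N.+1 (sphere2_bracket r s)).
  rewrite /acomm /sphere2_bracket -gop_comm qmxD qmxN.
  by congr (_ - _); rewrite [LHS]qmxM // sphere2_unitC.
have := @opnorm_qmx_le R H (sphere2_unit R r * sphere2_unit R s) _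
  (gop V N.+1 (sphere2_bracket r s)).
move=> /(_ ((\sum_p `|sphere2_bracket r s p.1 p.2|) * N.+2%:R)).
rewrite modulusM !modulus_sphere2_unit !mul1r; apply=> [|v].
  by rewrite mulr_ge0 ?sumr_ge0.
exact: vnorm_gop_le.
Qed.

(** Closeness joins the sphere pencil to that of K, and commutation joins the latter to the north
    pole, both through invertible pencils, although the two ends have opposite Pfaffian signs. *)
Lemma commuting_far_from_sphere2 N (c : R) (K : 'I_3 -> mxalg H (n N)) :
  2^-1 <= c * N.+2%:R -> 0 < c ->
  (forall r, star (K r) = K r) -> (forall r s, acomm (K r) (K s) = 0) ->
  (forall r, `‖K r - c *: sphere2_op N V r‖ <= 10^-1) -> False.
Proof.
move=> cN c0 saK comK nearK.
(* K_1 is made invertible by a scalar shift of at most 1/10, which preserves commutation and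
   self-adjointness. *)
have [s /andP[s0 s1] us] :=
  exists_shift_unitmx (lrmx (K (lift ord0 ord0)) 1) (e := 10^-1) ltac:(lra).
pose one : mxalg H (n N) := (1%:M : 'M[H]_(n N)).
pose K' r : mxalg H (n N) := K r + (if r == 1 :> nat then s *: one else 0).
have oneC A : one ⋆ A = A ⋆ one by rewrite [LHS]mul1mx [RHS]mulmx1.
have star1 : star one = one.
  apply/matrixP => i j; rewrite !mxE eq_sym.
  by case: eqP => _; rewrite ?conjs1 // ?conjs0.
have norm1 : `‖one‖ <= 1.
  by apply: opnorm_le => // v; rewrite mul1mx mul1r.
have saK' r : star (K' r) = K' r.
  rewrite /K'; case: ifP => _; last by rewrite !addr0.
  by rewrite starD saK starZ star1.
have amul0 (A : mxalg H (n N)) : A ⋆ 0 = 0 by exact: mulmx0.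
have amul0l (A : mxalg H (n N)) : 0 ⋆ A = 0 by exact: mul0mx.
have comK' r q : acomm (K' r) (K' q) = 0.
  have /eqP := comK r q; rewrite subr_eq0 => /eqP comrq.
  apply/eqP; rewrite subr_eq0; apply/eqP.
  pose S (r : 'I_3) : mxalg H (n N) := if r == 1 :> nat then s *: one else 0.
  have SC l A : S l ⋆ A = A ⋆ S l.
    by rewrite /S; case: ifP => _; rewrite ?amul0 ?amul0l // amulZl amulZr oneC.
  rewrite /K' -/(S r) -/(S q) !amulDl !amulDr comrq.
  by rewrite (SC r (K q)) (SC r (S q)) (SC q (K r)) addrACA.
have uK' : lrmx (K' (lift ord0 ord0)) 1 \in unitmx.
  rewrite /K' /= lrmx_is_additive lrmxZ lrmx1 scale_scalar_mx mulr1.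
  exact: us.
pose C r : mxalg H (n N) := c *: sphere2_op N V r.
have saC r : star (C r) = C r by rewrite starZ sphere2_op_star.
have lowC v : 2^-1 * rnorm v <= rnorm (quat_pencil C *m v).
  have h := @sphere2_pencil_lower R N V c v (ltW c0).
  apply: (le_trans _ h).
  by rewrite ler_wpM2r ?rnorm_ge0.
(* Three distances of 1/10 and the shift total 4/10, below the lower bound 1/2 of the sphere
   pencil. *)
have close : \sum_r `‖K' r - C r‖ < 2^-1.
  have h r : `‖K' r - C r‖ <= 10^-1 + (if r == 1 :> nat then 10^-1 else 0).
    have -> : K' r - C r = (K r - C r) + (if r == 1 :> nat then s *: one else 0).
      exact: addrAC.
    apply: le_trans (anormD _ _) _; apply: lerD; first exact: nearK.
    case: ifP => _; last by rewrite anorm0.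
    rewrite anormZ gtr0_norm // (le_trans _ s1) // -[leRHS]mulr1.
    by rewrite ler_wpM2l // ltW.
  apply: le_lt_trans (ler_sum _ (fun r _ => h r)) _.
  by rewrite !big_ord_recl big_ord0 /=; lra.
have two0 : (2%:R : R) != 0 by rewrite pnatr_eq0.
have [qK [mK EK]] : exists q : {poly R}, q \is monic /\
    q ^+ 2 = char_poly (- (left_i R (n N) *m quat_pencil K')).
  have [q q1 q2] := char_poly_skew_square two0 (left_i_skew R (n N))
    (quat_pencil_skew saK') (left_i_sqr R (n N)).
  by exists q.
have [qC [mC EC C0]] := sphere2_pencil_sqrt N V c.
have [qN [mN EN N0]] := north_pole_sqrt R (n N).
have p1 := pfaffian_sign_path (left_i_skew R (n N)) (quat_pencil_skew saC)
  (quat_pencil_skew saK') (left_i_sqr R (n N)) (quat_pencil_near_unit lowC close)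
  mC mK EC EK.
have p2 := pfaffian_sign_path (left_i_skew R (n N)) (quat_pencil_skew saK')
  (quat_pencil_skew (@north_pole_star R (n N))) (left_i_sqr R (n N))
  (quat_pencil_north_unit saK' comK' uK') mK mN EK EN.
(* The two paths force equal signs for the sphere and the north pole, but the explicit values have
   signs (-1)^(N+4) and (-1)^(N+3). *)
have : 0 < (qC.[0] * qN.[0]) * (qK.[0] ^+ 2).
  by have := mulr_gt0 p1 p2; congr (0 < _); ring.
have qK0 : 0 < qK.[0] ^+ 2.
  rewrite lt0r sqr_ge0 sqrf_eq0 andbT; apply/eqP => q0.
  by move: p1; rewrite q0 mulr0 ltxx.
rewrite pmulr_lgt0 // C0 N0 fdim2 [(- (c * _)) ^+ _]exprNn -mulrA.
rewrite pmulr_rgt0; last by rewrite exprn_gt0 // mulr_gt0 // ltr0n.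
have -> : (-1) ^+ N.+4 * (c * N.+2%:R) ^+ N.+4 * (-1) ^+ N.+3 =
    - ((c * N.+2%:R) ^+ N.+4) :> R.
  have xx : (-1) ^+ N.+3 * (-1) ^+ N.+3 = 1 :> R by rewrite -expr2 sqrr_sign.
  move: xx; rewrite (exprS _ N.+3); move: ((-1) ^+ N.+3) ((c * N.+2%:R) ^+ N.+4) => x y xx.
  by rewrite mulN1r !mulNr mulrAC xx mul1r.
by rewrite oppr_gt0 ltNge exprn_ge0 // mulr_ge0 // ltW.
Qed.

Theorem obstructed_quat3 : obstructed 3 (quat R).
Proof.
exists 10^-1 => [|delta d0]; first lra.
pose B := \sum_r \sum_s \sum_p `|sphere2_bracket r s p.1 p.2|.
have B0 : 0 <= B by do 3 (apply: sumr_ge0 => ? _).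
(* With c^2 (N+2)(N+4) = 1 the scaled commutators are at most B / (N+4). *)
pose N := Num.bound (B / delta).
have NB : B / delta < N%:R.
  by rewrite archi_boundP // divr_ge0 // ltW.
pose D : R := N.+2%:R * N.+4%:R.
have D0 : 0 < D by rewrite mulr_gt0 ?ltr0n.
pose c := (Num.sqrt D)^-1.
have c0 : 0 < c by rewrite invr_gt0 sqrtr_gt0.
have cc : c * c * D = 1.
  by rewrite -expr2 exprVn sqr_sqrtr ?ltW // mulVf // gt_eqF.
exists (n N); split; first by rewrite fdim2.
exists (fun r => c *: sphere2_op N V r); split.
- by move=> r; rewrite starZ sphere2_op_star.
- transitivity ((c * c) *: (\sum_r sphere2_op N V r ⋆ sphere2_op N V r)).
    by rewrite scaler_sumr; apply: eq_bigr => r _; rewrite amulZl amulZr scalerA.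
  rewrite sphere2_op_sqr; apply/matrixP => i j; rewrite !mxE.
  by case: eqP => _; rewrite ?scaler0 // scalerA cc scale1r.
- move=> r s; have -> : acomm (c *: sphere2_op N V r) (c *: sphere2_op N V s) =
      (c * c) *: acomm (sphere2_op N V r) (sphere2_op N V s).
    by rewrite /acomm !amulZl !amulZr !scalerA scalerBr.
  have cc0 : 0 <= c * c by rewrite mulr_ge0 ?(ltW c0).
  rewrite anormZ ger0_norm //.
  apply: (le_trans (ler_wpM2l cc0 (sphere2_op_comm N r s))).
  have le_B : \sum_p `|sphere2_bracket r s p.1 p.2| <= B.
    rewrite /B (bigD1 r) //= (bigD1 s) //= -addrA lerDl addr_ge0 //.
      by do 2 (apply: sumr_ge0 => ? _).
    by do 3 (apply: sumr_ge0 => ? _).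
  apply: le_trans (_ : c * c * (B * N.+2%:R) <= _).
    by rewrite ler_wpM2l // ler_wpM2r ?ler0n.
  rewrite -(ler_pM2r D0) mulrAC cc mul1r.
  rewrite /D mulrCA [leLHS]mulrC ler_pM2l ?ltr0n //.
  move: NB; rewrite ltr_pdivrMr // => /ltW/le_trans; apply.
  by rewrite mulrC ler_pM2l // ler_nat; lia.
- move=> K saK comK nearK.
  apply: (@commuting_far_from_sphere2 N c K) => //.
  (* After squaring, the bound 1/2 <= c (N+2) becomes N+4 <= 4 (N+2). *)
  have h2 : 0 <= 2^-1 :> R by rewrite invr_ge0 ler0n.
  have h3 : 0 <= c * N.+2%:R by rewrite mulr_ge0 ?(ltW c0) ?ler0n.
  rewrite -ler_sqr ?nnegrE //.
  rewrite -(ler_pM2r D0) exprMn.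
  have -> : c ^+ 2 * N.+2%:R ^+ 2 * D = N.+2%:R ^+ 2 * (c * c * D) by ring.
  rewrite cc mulr1 /D.
  have : 0 <= (N%:R : R) by exact: ler0n.
  by rewrite -[N.+4]addn4 -[N.+2]addn2 !natrD; nra.
Qed.
End Quat3e.

(** * Commuting symmetric families: the pencil is nonpositive on half of the space *)

Section NonpositiveVectors.
Local Open Scope sesquilinear_scope.

Lemma wide_ker (F : fieldType) m p (A : 'M[F]_(m, p)) : (m < p)%N ->
  exists2 z : 'cV_p, z != 0 & A *m z = 0.
Proof.
move=> mp; have : kermx A^T != 0.
  rewrite -mxrank_eq0 mxrank_ker mxrank_tr.
  by have := rank_leq_row A; lia.
move=> /rowV0Pn [v /sub_kermxP vA v0]; exists v^T.
  by apply: contraNneq v0 => /(congr1 trmx); rewrite trmxK trmx0 => ->.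
by apply: trmx_inj; rewrite trmx_mul trmxK vA trmx0.
Qed.

Section Nonpositive.
Variables (C : numClosedFieldType) (n s h m : nat).
Variables (K : 'I_m.+1 -> 'M[C]_n) (G : 'I_m.+1 -> 'M[C]_s) (g : 'I_s -> bool)
  (beta : bool -> 'I_h -> 'I_s).
Hypothesis K0herm : K ord0 \is hermsymmx.
Hypothesis KC : forall r, K ord0 *m K r = K r *m K ord0.
Hypothesis G0 : forall a b, G ord0 a b = (if g b then 1 else -1) *+ (a == b).
Hypothesis G_off : forall r a b, r != ord0 -> g a = g b -> G r a b = 0.
Hypothesis beta_surj : forall b, exists a, beta (g b) a = b.

(* Diagonalize [K ord0]; the vectors whose coordinates along eigenvectors of    *)
(* positive (nonpositive) eigenvalue lie in the [-1]- ([+1]-) part of [G ord0]  *)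
(* form a space of half dimension on which the cross terms vanish.              *)
Lemma nonpositive_vector p (V : 'M[C]_(n * s, p)) : (n * h < p)%N ->
  exists2 z : 'cV_p, z != 0 &
    (((V *m z) ^t* *m (\sum_r K r *t G r) *m (V *m z)) 0 0) <= 0.
Proof.
move=> hp; pose P := spectralmx (K ord0); pose d := spectral_diag (K ord0).
have K0E := orthomx_spectralP (hermitian_normalmx K0herm).
rewrite -/P -/d in K0E.
have dreal i : d 0 i \is Num.real.
  by have /mxOverP := hermitian_spectral_diag_real K0herm; apply.
have Pu : P \in unitmx by exact: spectral_unit.
have PV : invmx P = P ^t* by rewrite invmx_unitary ?spectral_unitarymx.
pose L r := P *m K r *m invmx P.
have L0 : L ord0 = diag_mx d.
  by rewrite /L {1}K0E !mulmxA mulmxV // mul1mx mulmxK.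
have Loff r i j : d 0 i != d 0 j -> L r i j = 0.
  move=> dij; have : diag_mx d *m L r = L r *m diag_mx d.
    rewrite -L0 /L !mulmxA !(mulmxKV Pu) -!mulmxA; congr (_ *m _).
    by rewrite !mulmxA KC.
  move/matrixP/(_ i j); rewrite mul_diag_mx mul_mx_diag !mxE mulrC.
  move/eqP; rewrite -subr_eq0 -mulrBr mulf_eq0 subr_eq0 (negbTE dij) orbF.
  by move/eqP.
pose P1 := P *t (1%:M : 'M[C]_s).
pose sg i := (0 < d 0 i).
(* The n h coordinates to be killed: those in the half of [G ord0] whose sign agrees with the
   eigenvalue, nonpositive eigenvalues counting as negative. *)
pose Nc : 'M[C]_(n * h, n * s) := \matrix_(x, y)
  P1 (mxtens_index ((mxtens_unindex x).1, beta (sg (mxtens_unindex x).1) (mxtens_unindex x).2)) y.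
have [z z0 Nz] := wide_ker (Nc *m V) hp.
exists z => //; set v := V *m z.
pose w := P1 *m v.
have w0 i b : g b = sg i -> w (mxtens_index (i, b)) 0 = 0.
  move=> gb; have [a ab] := beta_surj b.
  have /matrixP/(_ (mxtens_index (i, a)) 0) := Nz.
  rewrite -mulmxA -/v [in X in X -> _]mxE [X in _ = X -> _]mxE => <-.
  rewrite mxE; apply: eq_bigr => y _; congr (_ * _).
  by rewrite [RHS]mxE mxtens_indexK /= -gb ab.
have P11 : (invmx P *t (1%:M : 'M[C]_s)) *m P1 = 1%:M.
  by rewrite /P1 tensmx_mul mulVmx // mulmx1 tensmx11.
have vE : v = (invmx P *t 1%:M) *m w by rewrite /w mulmxA P11 mul1mx.
clearbody w.
have Pi_adj : (invmx P *t (1%:M : 'M[C]_s)) ^t* = P1.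
  by rewrite PV trmx_tens trmx1 map_mxT map_mx1 trmxCK.
have formE : v ^t* *m (\sum_r K r *t G r) *m v =
    w ^t* *m (\sum_r L r *t G r) *m w.
  rewrite [in LHS]vE trmx_mul map_mxM Pi_adj -!mulmxA; congr (_ *m _).
  rewrite !mulmxA; congr (_ *m _).
  rewrite mulmx_sumr mulmx_suml; apply: eq_bigr => r _.
  by rewrite /P1 !tensmx_mul mul1mx mulmx1.
rewrite formE; clear formE P11 vE Nz; clearbody L.
have wE x : (w ^t*) 0 x = (w x 0)^* by rewrite !mxE.
rewrite mulmx_sumr mulmx_suml summxE; apply: sumr_le0 => r _.
rewrite mxE sum_mxtens; apply: sumr_le0 => j _; apply: sumr_le0 => b _.
rewrite mxE sum_mxtens mulr_suml; apply: sumr_le0 => i _.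
rewrite mulr_suml; apply: sumr_le0 => a _.
rewrite tensmxE wE.
have [gb|gb] := eqVneq (g b) (sg j); first by rewrite (w0 j b) // mulr0.
have [ga|ga] := eqVneq (g a) (sg i).
  by rewrite (w0 i a) // conjC0 !mul0r.
(* Off r = 0, [L r] links only equal eigenvalues; the surviving coordinates then lie in the same
   half, where [G r] vanishes. *)
have [r0|r0] := eqVneq r ord0; last first.
  have [dij|dij] := eqVneq (d 0 i) (d 0 j); last by rewrite Loff // mul0r mulr0 mul0r.
  rewrite G_off ?mulr0 ?mul0r //.
  by move: ga gb; rewrite /sg dij; case: (g a); case: (g b); case: (0 < d 0 j).
rewrite r0 L0 G0 !mxE.
have [ij|] := eqVneq i j; last by rewrite mulr0n mul0r mulr0 mul0r.
have [ab|] := eqVneq a b; last by rewrite mulr0n !mulr0 mul0r.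
rewrite ij ab !mulr1n; set u := w _ 0; set e : C := if _ then _ else _.
rewrite [X in X <= 0](_ : _ = (d 0 j * e) * (u * u^*)); last by ring.
rewrite mulr_le0_ge0 ?mul_conjC_ge0 // /e.
move: gb; rewrite /sg; have [dj|dj] := boolP (0 < d 0 j); case: (g b) => // _.
  by rewrite mulrN1 oppr_le0 ltW.
by rewrite mulr1 -real_leNgt ?real0 // in dj *.
Qed.
End Nonpositive.

(** The mixed terms cancel because T is symmetric. *)
Lemma complex_form_real (R : rcfType) n (T : 'M[R]_n) (X Y : 'cV[R]_n) :
  T^T = T ->
  let f : {rmorphism R -> R[i]} := real_complex R in
  let v := map_mx f X + 'i%C *: map_mx f Y in
  (v ^t* *m map_mx f T *m v) 0 0 = f ((X^T *m T *m X) 0 0 + (Y^T *m T *m Y) 0 0).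
Proof.
move=> Tsym f v.
have YX : (Y^T *m T *m X) 0 0 = (X^T *m T *m Y) 0 0.
  have : (Y^T *m T *m X)^T = X^T *m T *m Y by rewrite !trmx_mul trmxK Tsym mulmxA.
  by move/matrixP/(_ 0 0); rewrite mxE.
have -> : v ^t* = map_mx f X^T - 'i%C *: map_mx f Y^T.
  apply/matrixP => i j; rewrite !mxE rmorphD rmorphM -mulNr.
  by congr (_ + _ * _); [exact: conjc_real|exact: conjCi|exact: conjc_real].
have ii : ('i%C : R[i]) * 'i%C = -1 by rewrite -expr2 sqr_i.
rewrite /v !mulmxBl mulmxDr mulmxDr -!scalemxAl -!scalemxAr -!map_mxM.
rewrite scalerA ii scaleN1r.
move: YX; move: (X^T *m T *m X) (X^T *m T *m Y) (Y^T *m T *m X) (Y^T *m T *m Y).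
move=> A B C D CB; rewrite !mxE CB rmorphD /=; ring.
Qed.

Section RealNonpositive.
Variables (R : rcfType) (n s h m : nat).
Variables (K : 'I_m.+1 -> 'M[R]_n) (G : 'I_m.+1 -> 'M[R]_s) (g : 'I_s -> bool)
  (beta : bool -> 'I_h -> 'I_s).
Hypothesis Ksym : forall r, (K r)^T = K r.
Hypothesis Gsym : forall r, (G r)^T = G r.
Hypothesis KC : forall r, K ord0 *m K r = K r *m K ord0.
Hypothesis G0 : forall a b, G ord0 a b = (if g b then 1 else -1) *+ (a == b).
Hypothesis G_off : forall r a b, r != ord0 -> g a = g b -> G r a b = 0.
Hypothesis beta_surj : forall b, exists a, beta (g b) a = b.

Let T := \sum_r K r *t G r.
Let qf (x : 'cV[R]_(n * s)) := (x^T *m T *m x) 0 0.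

(** The spectral theorem is used over R[i], so the vector found is complex. Its real and imaginary
    parts give two real vectors, of which only the sum of the form values is controlled. *)
Lemma real_nonpositive_vectors p (V : 'M[R]_(n * s, p)) : (n * h < p)%N ->
  exists x y : 'cV_p, (x != 0) || (y != 0) /\ qf (V *m x) + qf (V *m y) <= 0.
Proof.
move=> hp; pose f : {rmorphism R -> R[i]} := real_complex R.
pose Kc r := map_mx f (K r); pose Gc r := map_mx f (G r).
have conjf (x : R) : (f x)^* = f x by exact: conjc_real.
have fconj a b (M : 'M[R]_(a, b)) : map_mx Num.conj (map_mx f M) = map_mx f M.
  by apply/matrixP => i j; rewrite !mxE conjf.
have K0h : Kc ord0 \is hermsymmx.
  have KcT : (Kc ord0)^T = Kc ord0 by rewrite /Kc map_trmx Ksym.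
  apply: realsym_hermsym.
    by apply/is_hermitianmxP; rewrite expr0 scale1r KcT map_mx_id.
  by apply/mxOverP => i j; rewrite mxE realE -(rmorph0 f) !lecR -realE num_real.
have KCc r : Kc ord0 *m Kc r = Kc r *m Kc ord0 by rewrite -!map_mxM KC.
have G0c a b : Gc ord0 a b = (if g b then 1 else -1) *+ (a == b).
  by rewrite mxE G0 rmorphMn /=; case: (g b); rewrite ?rmorph1 ?rmorphN1.
have Goffc r a b : r != ord0 -> g a = g b -> Gc r a b = 0.
  by move=> r0 gab; rewrite mxE G_off // rmorph0.
have [z z0 zle] := nonpositive_vector K0h KCc G0c Goffc beta_surj (map_mx f V) hp.
pose x := map_mx (@complex.Re R) z; pose y := map_mx (@complex.Im R) z.
have zE : z = map_mx f x + 'i%C *: map_mx f y.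
  by apply/colP => i; rewrite !mxE [LHS]complexE.
exists x, y; split.
  rewrite -negb_and; apply: contra z0 => /andP[/eqP x0 /eqP y0].
  by rewrite zE x0 y0 !map_mx0 scaler0 addr0.
have TE : \sum_r Kc r *t Gc r = map_mx f T.
  by rewrite /T raddf_sum; apply: eq_bigr => r _; rewrite /= map_mxT.
have Tsym : T^T = T.
  by rewrite /T raddf_sum; apply: eq_bigr => r _; rewrite /= trmx_tens Ksym Gsym.
pose X := V *m x; pose Y := V *m y.
have VzE : map_mx f V *m z = map_mx f X + 'i%C *: map_mx f Y.
  by rewrite zE mulmxDr -scalemxAr -!map_mxM.
by move: zle; rewrite TE VzE complex_form_real // -(rmorph0 f) lecR.
Qed.
End RealNonpositive.
End NonpositiveVectors.

(** * Integer tables for the five gamma matrices, with identities decided by computation *)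

Section IntTables.
Definition ztable (t : seq (seq int)) (i j : nat) : int := nth 0 (nth [::] t i) j.

(** A sum that evaluates, so that the table identities reduce to [vm_compute]. *)
Definition zsum n (F : nat -> int) : int := foldr (fun k s => F k + s) 0 (iota 0 n).

Arguments zsum : simpl never.

Lemma zsumE (R : pzRingType) n (F : nat -> int) :
  (zsum n F)%:~R = \sum_(i < n) (F i)%:~R :> R.
Proof.
rewrite -(big_mkord xpredT (fun i => (F i)%:~R : R)) /zsum /index_iota subn0.
elim: (iota 0 n) => [|k s IH]; first by rewrite big_nil.
by rewrite big_cons /= rmorphD /= IH.
Qed.

Definition forall_lt n (P : pred nat) := all P (iota 0 n).

Lemma forall_ltP n (P : pred nat) : forall_lt n P -> forall i : 'I_n, P i.
Proof. by move=> /allP h i; apply: h; rewrite mem_iota ltn_ord. Qed.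

(** Five anticommuting 4x4 Hermitian matrices; the last two tables are skew and are to be multiplied
    by the imaginary unit that [unit_coef] supplies as a 2x2 rotation. *)
Definition sphere4_coef (r : nat) : nat -> nat -> int := ztable (nth [::] [::
  [:: [:: 1; 0; 0; 0]; [:: 0; 1; 0; 0]; [:: 0; 0; -1; 0]; [:: 0; 0; 0; -1]];
  [:: [:: 0; 0; 1; 0]; [:: 0; 0; 0; 1]; [:: 1; 0; 0; 0]; [:: 0; 1; 0; 0]];
  [:: [:: 0; 0; 0; 1]; [:: 0; 0; -1; 0]; [:: 0; -1; 0; 0]; [:: 1; 0; 0; 0]];
  [:: [:: 0; 0; 0; 1]; [:: 0; 0; 1; 0]; [:: 0; -1; 0; 0]; [:: -1; 0; 0; 0]];
  [:: [:: 0; 0; 1; 0]; [:: 0; 0; 0; -1]; [:: -1; 0; 0; 0]; [:: 0; 1; 0; 0]]] r).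

Definition unit_coef (r : nat) : nat -> nat -> int :=
  ztable (if (r < 3)%N then [:: [:: 1; 0]; [:: 0; 1]] else [:: [:: 0; -1]; [:: 1; 0]]).

Definition sign_coef (r : nat) : int := if (r < 3)%N then 1 else -1.

Definition sympl_coef : nat -> nat -> int := ztable
  [:: [:: 0; 1; 0; 0]; [:: -1; 0; 0; 0]; [:: 0; 0; 0; 1]; [:: 0; 0; -1; 0]].

Definition gamma_coef r a b :=
  unit_coef r (a %/ 4) (b %/ 4) * sphere4_coef r (a %% 4) (b %% 4).

Definition gamma2_coef r a b :=
  unit_coef r (a %/ 8) (b %/ 8) * gamma_coef r (a %% 8) (b %% 8).

(* [R^2 (x) R^2] is the sum of two complex lines, spanned over the reals by    *)
(* the columns of these tables.                                                *)
Definition line_coef (e : bool) : nat -> nat -> int := ztable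
  (if e then [:: [:: 1; 0]; [:: 0; 1]; [:: 0; 1]; [:: -1; 0]]
   else [:: [:: 1; 0]; [:: 0; 1]; [:: 0; -1]; [:: 1; 0]]).

(** Columns 0 and 1 are the complex line e tensored with the basis vector e_i; columns 2 and 3 are
    the other line tensored with column i of the symplectic form. *)
Definition vect_coef (e : bool) (i a c : nat) : int :=
  if (c < 2)%N then line_coef e (a %/ 4) c * (a %% 4 == i)%N%:R
  else line_coef (~~ e) (a %/ 4) (c - 2)%N * sympl_coef (a %% 4) i.

(** The counterpart of the swap identity for Pauli matrices. The transposed roles of i and j in the
    two products make one a raising and the other a lowering term of the pencil. *)
Lemma gamma2_decomp_check :
  forall_lt 4 (fun i => forall_lt 4 (fun j => forall_lt 16 (fun a => forall_lt 16 (fun b =>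
    zsum 5 (fun r => sphere4_coef r i j * gamma2_coef r a b) ==
    zsum 4 (fun c => vect_coef true j a c * vect_coef true i b c)
    + zsum 4 (fun c => vect_coef false i a c * vect_coef false j b c)
    - (i == j)%:R * (a == b)%:R)))).
Proof. by vm_compute. Qed.

Lemma vect_gram_check (e : bool) :
  forall_lt 4 (fun i => forall_lt 4 (fun j => forall_lt 4 (fun a => forall_lt 4 (fun b =>
    zsum 16 (fun c => vect_coef e i c a * vect_coef e j c b) ==
    2 * ((i == j)%:R * (a == b)%:R))))).
Proof. by case: e; vm_compute. Qed.

(** This antisymmetry is what makes the ranges of the raising and lowering maps orthogonal. *)
Lemma vect_cross_check :
  forall_lt 4 (fun i => forall_lt 4 (fun j => forall_lt 4 (fun a => forall_lt 4 (fun b =>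
    zsum 16 (fun c => vect_coef true i c a * vect_coef false j c b) ==
    - zsum 16 (fun c => vect_coef true j c a * vect_coef false i c b))))).
Proof. by vm_compute. Qed.

Lemma vect_cogram_check :
  forall_lt 16 (fun a => forall_lt 16 (fun b =>
    zsum 4 (fun i => zsum 4 (fun c => vect_coef true i a c * vect_coef true i b c)) ==
    2 * (a == b)%:R)).
Proof. by vm_compute. Qed.

Lemma sphere4_fierz_check :
  forall_lt 4 (fun i => forall_lt 4 (fun j => forall_lt 4 (fun k => forall_lt 4 (fun l =>
    zsum 5 (fun r => sign_coef r * (sphere4_coef r i j * sphere4_coef r k l)) ==
    2 * ((i == l)%:R * (j == k)%:R) - (i == j)%:R * (k == l)%:R
    + 2 * (sympl_coef i k * sympl_coef j l))))).
Proof. by vm_compute. Qed.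

End IntTables.

(** * The fuzzy 4-sphere and the spectrum of its pencil *)

Section Sphere4.
Variable R : rcfType.

Definition zmx m n (F : nat -> nat -> int) : 'M[R]_(m, n) := \matrix_(i, j) (F i j)%:~R.

Definition sphere4_mx (r : 'I_5) : 'M[R]_4 := zmx 4 4 (sphere4_coef r).
Definition sphere4_unit (r : 'I_5) : 'M[R]_2 := zmx 2 2 (unit_coef r).
Definition sphere4_sign (r : 'I_5) : R := (sign_coef r)%:~R.
Definition sympl_mx : 'M[R]_4 := zmx 4 4 sympl_coef.
Definition gamma_mx (r : 'I_5) : 'M[R]_(2 * 4) := sphere4_unit r *t sphere4_mx r.
Definition vect (e : bool) (i : 'I_4) : 'M[R]_(2 * (2 * 4), 4) := zmx _ _ (vect_coef e i).

Lemma sphere4_fierz (p q : 'I_4 * 'I_4) :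
  \sum_r sphere4_sign r * (sphere4_mx r p.1 p.2 * sphere4_mx r q.1 q.2) =
    2 * ((p.1 == q.2)%:R * (p.2 == q.1)%:R) - (p.1 == p.2)%:R * (q.1 == q.2)%:R
    + 2 * (sympl_mx p.1 q.1 * sympl_mx p.2 q.2).
Proof.
have := sphere4_fierz_check.
move=> /forall_ltP /(_ p.1) /forall_ltP /(_ p.2) /forall_ltP /(_ q.1).
move=> /forall_ltP /(_ q.2) /eqP /(congr1 (fun z : int => z%:~R : R)).
rewrite zsumE; under eq_bigr do rewrite !rmorphM; move=> h.
under eq_bigr do rewrite !mxE; rewrite h !mxE.
by rewrite !(rmorphD, rmorphB, rmorphM, rmorph_nat, rmorphN) /=.
Qed.

Lemma sympl_skew : sympl_mx^T = - sympl_mx.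
Proof.
by apply/matrixP => -[[|[|[|[|//]]]] ?] [[|[|[|[|//]]]] ?]; rewrite !mxE /sympl_coef /=
  ?oppr0 -?rmorphN ?opprK.
Qed.

Lemma sympl_sqr : sympl_mx *m sympl_mx = - 1%:M.
Proof.
apply/matrixP => i j; rewrite !mxE !big_ord_recl big_ord0 !mxE.
move: i j => [[|[|[|[|//]]]] ?] [[|[|[|[|//]]]] ?]; rewrite /sympl_coef /ztable /=;
rewrite ?rmorphN /=; ring.
Qed.

Lemma gamma2E r (a b : 'I_(2 * (2 * 4))) :
  (sphere4_unit r *t gamma_mx r) a b = (gamma2_coef r a b)%:~R.
Proof. by rewrite !mxE /= -!rmorphM. Qed.

Lemma gamma2_decomp (i j : 'I_4) :
  \sum_r sphere4_mx r i j *: (sphere4_unit r *t gamma_mx r) =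
  vect true j *m (vect true i)^T + vect false i *m (vect false j)^T - (i == j)%:R%:M.
Proof.
apply/matrixP => a b; rewrite summxE.
under eq_bigr do rewrite mxE gamma2E mxE -rmorphM.
have := gamma2_decomp_check.
move=> /forall_ltP /(_ i) /forall_ltP /(_ j) /forall_ltP /(_ a).
move=> /forall_ltP /(_ b) /eqP /(congr1 (fun z : int => z%:~R : R)).
rewrite zsumE => ->.
rewrite intrB intrD !zsumE intrM !mulrz_nat !mxE.
rewrite mulr_natr; congr (_ + _ - _).
- by apply: eq_bigr => c _; rewrite !mxE rmorphM.
- by apply: eq_bigr => c _; rewrite !mxE rmorphM.
Qed.

Lemma vect_gram e i j : (vect e i)^T *m vect e j = ((i == j)%:R * 2)%:M.
Proof.
apply/matrixP => a b; rewrite !mxE.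
have := vect_gram_check e.
move=> /forall_ltP /(_ i) /forall_ltP /(_ j) /forall_ltP /(_ a).
move=> /forall_ltP /(_ b) /eqP /(congr1 (fun z : int => z%:~R : R)).
have -> : (2 * ((i == j :> nat)%:R * (a == b :> nat)%:R) : int)%:~R =
    ((i == j)%:R * 2) *+ (a == b) :> R.
  by rewrite -!val_eqE /=; do 2 case: eqP => _; rewrite ?(mulr0, mul0r, mulr1, mul1r).
rewrite zsumE => <-.
by apply: eq_bigr => c _; rewrite !mxE rmorphM.
Qed.

Lemma vect_cross i j : (vect true i)^T *m vect false j = - ((vect true j)^T *m vect false i).
Proof.
apply/matrixP => a b; rewrite !mxE.
have := vect_cross_check.
move=> /forall_ltP /(_ i) /forall_ltP /(_ j) /forall_ltP /(_ a).
move=> /forall_ltP /(_ b) /eqP /(congr1 (fun z : int => z%:~R : R)).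
rewrite rmorphN !zsumE /= => h.
transitivity (\sum_(c < 16) (vect_coef true i c a * vect_coef false j c b)%:~R : R).
  by apply: eq_bigr => c _; rewrite !mxE rmorphM.
by rewrite h; congr (- _); rewrite zsumE; apply: eq_bigr => c _; rewrite !mxE rmorphM.
Qed.

Lemma vect_cogram : \sum_i vect true i *m (vect true i)^T = 2%:M.
Proof.
apply/matrixP => a b; rewrite !mxE summxE.
have := vect_cogram_check.
move=> /forall_ltP /(_ a) /forall_ltP /(_ b) /eqP /(congr1 (fun z : int => z%:~R : R)).
have -> : (2 * (a == b :> nat)%:R : int)%:~R = 2 *+ (a == b) :> R.
  by rewrite -!val_eqE /=; case: eqP => _; rewrite ?(mulr0, mulr1).
rewrite zsumE => <-.
apply: eq_bigr => i _; rewrite zsumE mxE; apply: eq_bigr => c _.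
by rewrite !mxE rmorphM.
Qed.
End Sphere4.

(** The cast reconciles the two bracketings of the dimension: operators act on D (x) 2 and are
    paired with 8x8 matrices, whereas the tables treat the last sixteen dimensions together. *)
Lemma tensmxA (R : comNzRingType) m n p q s t (A : 'M[R]_(m, n)) (B : 'M[R]_(p, q)) (C : 'M[R]_(s, t)) :
  (A *t B) *t C = castmx (mulnA m p s, mulnA n q t) (A *t (B *t C)).
Proof.
apply/matrixP => i j; rewrite castmxE.
case: (mxtens_indexP i) => i1 i3; case: (mxtens_indexP i1) => {i1} i1 i2.
case: (mxtens_indexP j) => j1 j3; case: (mxtens_indexP j1) => {j1} j1 j2.
have castE a b c (x1 : 'I_a) (x2 : 'I_b) (x3 : 'I_c) :
    cast_ord (esym (mulnA a b c)) (mxtens_index (mxtens_index (x1, x2), x3)) =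
    mxtens_index (x1, mxtens_index (x2, x3)).
  by apply/val_inj => /=; rewrite mulnDl -addnA -mulnA.
by rewrite !castE !tensmxE mulrA.
Qed.

Section Sphere4Tables.
Variable R : rcfType.
Notation gamma := (@gamma_mx R).

Lemma gamma_check : forall_lt 5 (fun r => forall_lt 8 (fun a => forall_lt 8 (fun b =>
  [&& gamma_coef r a b == gamma_coef r b a,
      zsum 8 (fun c => gamma_coef r a c * gamma_coef r c b) == (a == b)%:R,
      (r != 0)%N ==> ((a %% 4 < 2) == (b %% 4 < 2))%N ==> (gamma_coef r a b == 0)
    & (gamma_coef 0 a b == (if (b %% 4 < 2)%N then 1 else -1) *+ (a == b))]))).
Proof. by vm_compute. Qed.

Lemma gammaE r (a b : 'I_(2 * 4)) : gamma r a b = (gamma_coef r a b)%:~R.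
Proof. by rewrite !mxE /= -rmorphM. Qed.

Lemma gamma_sym r : (gamma r)^T = gamma r.
Proof.
apply/matrixP => a b; rewrite mxE !gammaE; congr (_%:~R).
have := gamma_check.
by move=> /forall_ltP /(_ r) /forall_ltP /(_ a) /forall_ltP /(_ b) /and4P[/eqP ->].
Qed.

Lemma gamma_sqr r : gamma r *m gamma r = 1%:M.
Proof.
apply/matrixP => a b; rewrite !mxE.
have := gamma_check.
move=> /forall_ltP /(_ r) /forall_ltP /(_ a) /forall_ltP /(_ b) /and4P[_ /eqP h _ _].
move: h => /(congr1 (fun z : int => z%:~R : R)); rewrite zsumE mulrz_nat => <-.
by apply: eq_bigr => c _; rewrite !gammaE intrM.
Qed.

(** The index set of the eigenvalue 1 of the diagonal matrix [gamma ord0]. *)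
Definition gamma_half (b : 'I_(2 * 4)) : bool := (b %% 4 < 2)%N.

Lemma gamma_off r a b : r != ord0 -> gamma_half a = gamma_half b -> gamma r a b = 0.
Proof.
move=> r0 ab; rewrite gammaE.
have := gamma_check.
move=> /forall_ltP /(_ r) /forall_ltP /(_ a) /forall_ltP /(_ b) /and4P[_ _ h _].
move: h; rewrite -val_eqE /= in r0 *; rewrite r0 /= -/(gamma_half a) -/(gamma_half b).
by rewrite ab eqxx => /eqP ->.
Qed.

Lemma gamma_diag a b : gamma ord0 a b = (if gamma_half b then 1 else -1) *+ (a == b).
Proof.
rewrite gammaE.
have := gamma_check.
move=> /forall_ltP /(_ ord0) /forall_ltP /(_ a) /forall_ltP /(_ b) /and4P[_ _ _ /eqP ->].
by rewrite rmorphMn /= -/(gamma_half b); case: (gamma_half b); rewrite ?rmorphN1.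
Qed.

Definition gamma_index (e : bool) (a : 'I_4) : 'I_(2 * 4) :=
  inord (4 * (a %/ 2) + a %% 2 + (if e then 0 else 2)).

Lemma gamma_index_surj b : exists a, gamma_index (gamma_half b) a = b.
Proof.
have b8 := ltn_ord b.
exists (inord (2 * (b %/ 4) + b %% 2)); apply/val_inj.
rewrite /gamma_index /gamma_half /=.
by move: b b8 => [[|[|[|[|[|[|[|[|//]]]]]]]] ?] _; rewrite /= !inordK.
Qed.

Lemma sphere4_mx_tr r : (sphere4_mx R r)^T = sphere4_sign R r *: sphere4_mx R r.
Proof.
apply/matrixP => i j; rewrite !mxE -rmorphM; congr (_%:~R).
by move: r i j => [[|[|[|[|[|//]]]]] ?] [[|[|[|[|//]]]] ?] [[|[|[|[|//]]]] ?].
Qed.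

Lemma sphere4_unit_tr r : (sphere4_unit R r)^T = sphere4_sign R r *: sphere4_unit R r.
Proof.
apply/matrixP => i j; rewrite !mxE -rmorphM; congr (_%:~R).
by move: r i j => [[|[|[|[|[|//]]]]] ?] [[|[|//]] ?] [[|[|//]] ?].
Qed.

Lemma sphere4_sign_sqr r : sphere4_sign R r * sphere4_sign R r = 1.
Proof. by rewrite /sphere4_sign /sign_coef; case: ifP => _; rewrite ?mulr1 // rmorphN1 mulrNN mulr1. Qed.

Lemma sphere4_unit_case r : sphere4_unit R r = 1%:M /\ sphere4_sign R r = 1 \/
  sphere4_unit R r = sphere4_unit R ord_max /\ sphere4_sign R r = -1.
Proof.
rewrite /sphere4_unit /sphere4_sign /unit_coef /sign_coef /=; case: ifP => _.
  by left; split=> //; apply/matrixP => -[[|[|//]] ?] [[|[|//]] ?]; rewrite !mxE.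
by right; rewrite rmorphN1.
Qed.

Lemma sphere4_unit_max_sqr : sphere4_unit R ord_max *m sphere4_unit R ord_max = - 1%:M.
Proof.
apply/matrixP => -[[|[|//]] ?] [[|[|//]] ?]; rewrite !mxE !big_ord_recl big_ord0 !mxE
  /unit_coef /ztable /= ?rmorphN /=; ring.
Qed.

Lemma sphere4_unit_sqr r :
  sphere4_unit R r *m sphere4_unit R r = (sphere4_sign R r)%:M.
Proof.
have [[-> ->]|[-> ->]] := sphere4_unit_case r; first by rewrite mul1mx.
by rewrite sphere4_unit_max_sqr raddfN.
Qed.

Lemma sphere4_unitC r s :
  sphere4_unit R r *m sphere4_unit R s = sphere4_unit R s *m sphere4_unit R r.
Proof.
have [[-> _]|[-> _]] := sphere4_unit_case r; have [[-> _]|[-> _]] := sphere4_unit_case s;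
by rewrite ?mul1mx ?mulmx1.
Qed.

Lemma sphere4_unit_orth r : (sphere4_unit R r)^T *m sphere4_unit R r = 1%:M.
Proof.
rewrite sphere4_unit_tr -scalemxAl sphere4_unit_sqr scale_scalar_mx.
by rewrite sphere4_sign_sqr.
Qed.

Section Op.
Variables (N : nat) (V : fock R 4).
Notation D := (fdim V N.+2).

Definition sphere4_op r : 'M[R]_(D * 2) := gop V N.+1 (sphere4_mx R r) *t sphere4_unit R r.

Lemma gopZ t x : gop V N.+1 (t *: x) = t *: gop V N.+1 x.
Proof. by rewrite /gop scaler_sumr; apply: eq_bigr => p _; rewrite mxE scalerA. Qed.

Lemma sphere4_op_sym r : (sphere4_op r)^T = sphere4_op r.
Proof.
rewrite /sphere4_op trmx_tens gop_tr sphere4_mx_tr gopZ sphere4_unit_tr.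
by rewrite tensmxZl tensmxZr scalerA sphere4_sign_sqr scale1r.
Qed.

Lemma sphere4_op_sqr : \sum_r sphere4_op r *m sphere4_op r =
  (N.+2%:R * N.+2.+4%:R)%:M.
Proof.
transitivity ((\sum_r sphere4_sign R r *: (gop V N.+1 (sphere4_mx R r) *m
    gop V N.+1 (sphere4_mx R r))) *t (1%:M : 'M[R]_2)).
  rewrite tensmx_suml; apply: eq_bigr => r _.
  rewrite /sphere4_op tensmx_mul sphere4_unit_sqr -[sphere4_sign R r]mulr1.
  by rewrite -scale_scalar_mx tensmxZr mulr1 tensmxZl.
rewrite (@casimir R 4 V N 5 (sphere4_mx R) (sphere4_sign R) (sympl_mx R) 1); last first.
- by move=> p q; exact: sphere4_fierz.
- exact: sympl_sqr.
- exact: sympl_skew.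
rewrite tens_scalar mulr1; congr (_%:M); rewrite natrD.
by rewrite -[N.+2.+4]addn4 natrD -[N.+2]addn1 natrD; ring.
Qed.

Definition sphere4_bracket r s : 'M[R]_4 :=
  sphere4_mx R r *m sphere4_mx R s - sphere4_mx R s *m sphere4_mx R r.

Lemma sphere4_op_comm r s :
  sphere4_op r *m sphere4_op s - sphere4_op s *m sphere4_op r =
  gop V N.+1 (sphere4_bracket r s) *t (sphere4_unit R r *m sphere4_unit R s).
Proof.
rewrite /sphere4_op /sphere4_bracket -gop_comm !tensmx_mul (sphere4_unitC s r).
by rewrite -scaleN1r -tensmxZl scaleN1r -tensmxDl.
Qed.

Notation U := (raise_mx V (vect R true) N.+1).
Notation W := (lower_mx V (vect R false) N.+1).

(** By [gamma2_decomp] and the cogram formulas. With the Gram matrices below, U carries the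
    eigenvalue 2 (N+3) - (N+4) = N+2 and W the eigenvalue 2 (N+5) - (N+4) = N+6. *)
Lemma sphere4_pencil :
  \sum_r gop V N.+1 (sphere4_mx R r) *t (sphere4_unit R r *t gamma r) =
  U *m U^T + W *m W^T - N.+4%:R%:M.
Proof.
rewrite raise_cogram lower_cogram vect_cogram tens_scalar.
under eq_bigr do rewrite /gop tensmx_suml.
rewrite exchange_big /=.
transitivity (\sum_p gl V N.+1 p.1 p.2 *t (vect R true p.2 *m (vect R true p.1)^T +
    vect R false p.1 *m (vect R false p.2)^T - (p.1 == p.2)%:R%:M)).
  apply: eq_bigr => p _; rewrite -gamma2_decomp tensmx_sumr.
  by apply: eq_bigr => r _; rewrite tensmxZl tensmxZr.
transitivity (\sum_p ((gl V N.+1 p.1 p.2 *t (vect R true p.2 *m (vect R true p.1)^T) +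
    gl V N.+1 p.1 p.2 *t (vect R false p.1 *m (vect R false p.2)^T)) -
    ((p.1 == p.2)%:R *: gl V N.+1 p.1 p.2) *t 1%:M)).
  by apply: eq_bigr => p _; rewrite -tensmxDr; exact: tensmxB_scalar.
rewrite sumrB big_split /= -!addrA; congr (_ + _).
rewrite -tensmx_suml (_ : \sum_p _ *: _ = gop V N.+1 1%:M); last first.
  by apply: eq_bigr => p _; rewrite mxE.
rewrite gop_scalar tens_scalar [RHS]addrCA; congr (_ + _).
rewrite -raddfB -raddfN; congr (_%:M).
by rewrite -[N.+4]addn2 natrD; ring.
Qed.

Lemma sphere4_gramU : U^T *m U = (2 * N.+3%:R)%:M.
Proof.
by rewrite (@raise_gram R 4 V _ _ (vect R true) N.+1 2 (@vect_gram R true)) mulrC.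
Qed.

Lemma sphere4_gramW : W^T *m W = (2 * N.+1.+4%:R)%:M.
Proof.
by rewrite (@lower_gram R 4 V _ _ (vect R false) N 2 (@vect_gram R false)) mulrC addnC.
Qed.

Lemma sphere4_gramUW : U^T *m W = 0.
Proof. exact: (raise_lower0 V N (@vect_cross R)). Qed.
End Op.
End Sphere4Tables.

Lemma castmx_form (R : comNzRingType) m m' p (e : m = m') (T : 'M[R]_m) (V : 'M[R]_(m, p))
    (z : 'cV_p) :
  ((castmx (e, erefl p) V *m z)^T *m castmx (e, e) T *m (castmx (e, erefl p) V *m z)) =
  (V *m z)^T *m T *m (V *m z).
Proof. by case: _ / e; rewrite !castmx_id. Qed.

Lemma castmx_dot (R : comNzRingType) m m' p (e : m = m') (V : 'M[R]_(m, p)) (z : 'cV_p) :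
  (castmx (e, erefl p) V *m z)^T *m (castmx (e, erefl p) V *m z) =
  (V *m z)^T *m (V *m z).
Proof. by case: _ / e; rewrite castmx_id. Qed.

Section RnormTens.
Variable R : realType.

Lemma rnorm_dot n (u v : 'cV[R]_n) : (u^T *m v) 0 0 <= rnorm u * rnorm v.
Proof.
apply: le_trans (ler_norm _) _.
have := @adjmx_dot_le R R^o n u v; rewrite /= /rnorm.
have -> : adjmx (u : 'cV[R^o]_n) = u^T by apply/matrixP => i j; rewrite !mxE.
by [].
Qed.

Lemma rnorm_tens_sqr n s (v : 'cV[R]_(n * s)) :
  rnorm v ^+ 2 = \sum_(b < s) rnorm (\col_i v (mxtens_index (i, b)) 0) ^+ 2.
Proof.
rewrite rnorm_sqr mxE sum_mxtens exchange_big /=; apply: eq_bigr => b _.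
by rewrite rnorm_sqr mxE; apply: eq_bigr => i _; rewrite !mxE.
Qed.

Lemma rnorm_tens_le n s (A : 'M[R]_n) (B : 'M[R]_s) (c : R) (v : 'cV[R]_(n * s)) :
  0 <= c -> (forall w : 'cV_n, rnorm (A *m w) <= c * rnorm w) ->
  B^T *m B = 1%:M -> rnorm ((A *t B) *m v) <= c * rnorm v.
Proof.
move=> c0 Ac BB.
have -> : A *t B = (A *t 1%:M) *m (1%:M *t B) by rewrite tensmx_mul mulmx1 mul1mx.
rewrite -mulmxA; set w := _ *m v.
have -> : rnorm v = rnorm w.
  rewrite /w (rnorm_isom (c := 1)) ?ler01 ?mul1r //.
  by rewrite trmx_tens trmx1 tensmx_mul BB mul1mx tensmx11 expr1n.
rewrite -ler_sqr ?nnegrE ?mulr_ge0 ?rnorm_ge0 // exprMn !rnorm_tens_sqr mulr_sumr.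
apply: ler_sum => b _; rewrite -exprMn ler_sqr ?nnegrE ?mulr_ge0 ?rnorm_ge0 //.
have -> : \col_i ((A *t 1%:M) *m w) (mxtens_index (i, b)) 0 =
    A *m \col_i w (mxtens_index (i, b)) 0.
  apply/colP => i; rewrite !mxE sum_mxtens; apply: eq_bigr => j _.
  rewrite (bigD1 b) //= tensmxE [1%:M _ _]mxE eqxx mulr1 big1 ?addr0 ?mxE // => a ab.
  by rewrite tensmxE [1%:M _ _]mxE eq_sym (negbTE ab) mulr0 mul0r.
exact: Ac.
Qed.
End RnormTens.

Lemma sum_nonpos_eq0 (R : realFieldType) (f1 f2 r1 r2 : R) :
  4^-1 * r1 <= f1 -> 4^-1 * r2 <= f2 -> 0 <= r1 -> 0 <= r2 -> f1 + f2 <= 0 ->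
  r1 = 0 /\ r2 = 0.
Proof. by move=> *; split; lra. Qed.

(** * Five real matrices: signature against commutation *)

Section Sphere4c.
Variable R : realType.
Notation V := (fock_rep R 4).
Notation D N := (fdim V N.+2).
Notation gamma := (@gamma_mx R).

Definition spin_pencil n (K : 'I_5 -> 'M[R]_n) := \sum_r K r *t gamma r.

Definition spin_form n (K : 'I_5 -> 'M[R]_n) (x : 'cV[R]_(n * (2 * 4))) : R :=
  (x^T *m spin_pencil K *m x) 0 0.

Section Op.
Variable N : nat.
Notation U := (raise_mx V (vect R true) N.+1).
Notation W := (lower_mx V (vect R false) N.+1).

(** Its range is spanned by the eigenvectors of eigenvalues N+2 and N+6. *)
Definition positive_mx : 'M[R]_(D N * 2 * (2 * 4), fdim V N.+3 * 4 + fdim V N.+1 * 4) :=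
  castmx (mulnA (D N) 2 (2 * 4), erefl) (row_mx U W).

Lemma positive_mx_form z : N.+2%:R * rnorm (positive_mx *m z) ^+ 2 <=
  spin_form (sphere4_op N V) (positive_mx *m z).
Proof.
have TE : spin_pencil (sphere4_op N V) = castmx (mulnA (D N) 2 (2 * 4), mulnA (D N) 2 (2 * 4))
    (U *m U^T + W *m W^T - N.+4%:R%:M).
  rewrite -sphere4_pencil /spin_pencil.
  transitivity (\sum_r castmx (mulnA (D N) 2 (2 * 4), mulnA (D N) 2 (2 * 4))
     (gop V N.+1 (sphere4_mx R r) *t (sphere4_unit R r *t gamma r))).
    by apply: eq_bigr => r _; exact: tensmxA.
  by move: (mulnA (D N) 2 (2 * 4)) => e; case: _ / e; rewrite castmx_id;
     apply: eq_bigr => r _; rewrite castmx_id.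
rewrite /spin_form TE rnorm_sqr /positive_mx castmx_form castmx_dot.
rewrite -[z]vsubmxK; move: (usubmx z) (dsubmx z) => z1 z2.
rewrite mul_row_col.
set T := _ - _.
have WU : W^T *m U = 0.
  by apply: trmx_inj; rewrite trmx_mul trmxK sphere4_gramUW trmx0.
have TU : T *m U = N.+2%:R *: U.
  rewrite mulmxBl mulmxDl -!mulmxA sphere4_gramU WU mulmx0 addr0 mul_mx_scalar.
  rewrite mul_scalar_mx -scalerBl; congr (_ *: _).
  by rewrite -[N.+4]addn1 -[N.+3]addn1 !natrD; ring.
have TW : T *m W = N.+2.+4%:R *: W.
  rewrite mulmxBl mulmxDl -!mulmxA sphere4_gramW sphere4_gramUW mulmx0 add0r mul_mx_scalar.
  rewrite mul_scalar_mx -scalerBl; congr (_ *: _).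
  by rewrite -[N.+2.+4]addn4 -[N.+1.+4]addn4 -[N.+4]addn3 -[N.+2]addn1 !natrD; ring.
set u := U *m z1; set w := W *m z2.
have uw : u^T *m w = 0.
  by rewrite /u /w trmx_mul -mulmxA (mulmxA U^T) sphere4_gramUW mul0mx mulmx0.
have wu : w^T *m u = 0 by apply: trmx_inj; rewrite trmx_mul trmxK uw trmx0.
have Tx : T *m (u + w) = N.+2%:R *: u + N.+2.+4%:R *: w.
  by rewrite mulmxDr /u /w !mulmxA TU TW -!scalemxAl.
have TD : (u + w)^T = u^T + w^T by rewrite raddfD.
rewrite -mulmxA Tx TD !mulmxDl !mulmxDr -!scalemxAr uw wu !scaler0 !addr0 !add0r.
rewrite mxE [X in _ <= X]mxE [X in _ <= X + _]mxE [X in _ <= _ + X]mxE.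
rewrite mulrDr lerD2l ler_wpM2r //; last by rewrite ler_nat; lia.
by rewrite -rnorm_sqr sqr_ge0.
Qed.

Lemma positive_mx_inj (z : 'cV_(fdim V N.+3 * 4 + fdim V N.+1 * 4)) : positive_mx *m z = 0 -> z = 0.
Proof.
move=> Pz; have : (positive_mx *m z)^T *m (positive_mx *m z) = 0 by rewrite Pz mulmx0.
rewrite /positive_mx castmx_dot => h.
have {h} : row_mx U W *m z = 0.
  by apply: rnorm_eq0; apply/eqP; rewrite -sqrf_eq0 rnorm_sqr h mxE.
rewrite -[z]vsubmxK; move: (usubmx z) (dsubmx z) => z1 z2; rewrite mul_row_col => h.
have WU : W^T *m U = 0.
  by apply: trmx_inj; rewrite trmx_mul trmxK sphere4_gramUW trmx0.
have : U^T *m (U *m z1 + W *m z2) = 0 by rewrite h mulmx0.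
rewrite mulmxDr !mulmxA sphere4_gramU sphere4_gramUW mul0mx addr0 mul_scalar_mx.
move/eqP; rewrite scaler_eq0 mulf_eq0 !pnatr_eq0 /= => /eqP ->.
have : W^T *m (U *m z1 + W *m z2) = 0 by rewrite h mulmx0.
rewrite mulmxDr !mulmxA sphere4_gramW WU mul0mx add0r mul_scalar_mx.
move/eqP; rewrite scaler_eq0 mulf_eq0 !pnatr_eq0 /= => /eqP ->.
by rewrite col_mx0.
Qed.

(** The dimensions are strictly convex in the degree. After multiplication by (N+3)(N+5) and use of
    the recurrence, this reads (N+5)(N+6) + (N+2)(N+3) > 2 (N+3)(N+5). *)
Lemma positive_mx_wide : (D N * 2 * 4 < fdim V N.+3 * 4 + fdim V N.+1 * 4)%N.
Proof.
have := fdimS V N.+2; have := fdimS V N.+1; have := fdim_gt0 V N.+2 (isT : (0 < 4)%N).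
move: (fdim V N.+1) (fdim V N.+2) (fdim V N.+3) => d1 d2 d3 d20 e1 e3.
have e3' : (N.+3 * N.+1.+4 * d3 = N.+1.+4 * (N.+2 + 4) * d2)%N.
  by rewrite mulnAC e3 mulnC mulnA.
have e1' : (N.+3 * N.+1.+4 * d1 = N.+3 * N.+2 * d2)%N.
  by rewrite -!mulnA; congr (_ * _)%N; rewrite e1 addn4.
suff : (N.+3 * N.+1.+4 * (2 * d2) < N.+3 * N.+1.+4 * (d3 + d1))%N.
  by rewrite ltn_pmul2l //; lia.
by rewrite mulnDr e3' e1' !mulnA -mulnDl ltn_pmul2r //; lia.
Qed.
End Op.

Lemma commuting_far_from_sphere4 N (c : R) (K : 'I_5 -> mxalg R^o (D N * 2)) :
  2^-1 <= c * N.+2%:R -> 0 < c ->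
  (forall r, star (K r) = K r) -> (forall r s, acomm (K r) (K s) = 0) ->
  (forall r, `‖K r - c *: (sphere4_op N V r : mxalg R^o (D N * 2))‖ <= 20^-1) -> False.
Proof.
move=> cN c0 saK comK nearK.
pose K0 (r : 'I_5) : 'M[R]_(D N * 2) := K r.
have K0sym r : (K0 r)^T = K0 r.
  by rewrite -[RHS](saK r); apply/matrixP => i j; rewrite !mxE.
have K0C r : K0 ord0 *m K0 r = K0 r *m K0 ord0.
  by have /eqP := comK ord0 r; rewrite subr_eq0 => /eqP.
have [z1 [z2 [z12 neg]]] := real_nonpositive_vectors K0sym (@gamma_sym R) K0C
  (@gamma_diag R) (@gamma_off R) (@gamma_index_surj) (@positive_mx N) (@positive_mx_wide N).
(* The sphere contributes at least 1/2 of the squared norm and the five errors at most 1/20 each,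
   which leaves 1/4. *)
have pos z : 4^-1 * rnorm (positive_mx N *m z) ^+ 2 <= spin_form K0 (positive_mx N *m z).
  set x := _ *m z.
  pose E r := K0 r - c *: sphere4_op N V r.
  have opE r (w : 'cV[R]_(D N * 2)) : rnorm (E r *m w) <= 20^-1 * rnorm w.
    have h : opnorm (K r - c *: (sphere4_op N V r : mxalg R^o (D N * 2))) <= 20^-1 := nearK r.
    have -> : E r = K r - c *: (sphere4_op N V r : mxalg R^o (D N * 2)).
      by apply/matrixP => i j; rewrite !mxE.
    apply: le_trans (@opnormP R R^o _ _ w) _.
    by rewrite ler_wpM2r ?vnorm_ge0.
  have EE : spin_form K0 x = c * spin_form (sphere4_op N V) x
      + \sum_r (x^T *m ((E r *t gamma r) *m x)) 0 0.
    have PE : spin_pencil K0 = c *: spin_pencil (sphere4_op N V) + \sum_r E r *t gamma r.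
      rewrite /spin_pencil scaler_sumr -big_split; apply: eq_bigr => r _.
      by rewrite /= -tensmxZl -tensmxDl /E addrC subrK.
    rewrite /spin_form -summxE -mulmx_sumr -mulmx_suml mulmxA PE.
    by rewrite mulmxDr mulmxDl -scalemxAr -scalemxAl [LHS]mxE [X in X + _ = _]mxE.
  have lowE r : - (20^-1 * rnorm x ^+ 2) <= (x^T *m ((E r *t gamma r) *m x)) 0 0.
    rewrite lerNl.
    have := rnorm_dot x (- ((E r *t gamma r) *m x)).
    rewrite mulmxN [X in X <= _]mxE rnormN => /le_trans; apply.
    rewrite expr2 mulrCA ler_wpM2l ?rnorm_ge0 //.
    apply: rnorm_tens_le; [by rewrite invr_ge0 ler0n|exact: opE|].
    by rewrite gamma_sym gamma_sqr.
  rewrite EE.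
  have : \sum_(r < 5) - (20^-1 * rnorm x ^+ 2) <= \sum_r (x^T *m ((E r *t gamma r) *m x)) 0 0.
    by apply: ler_sum => r _; exact: lowE.
  rewrite sumr_const card_ord.
  have := ler_wpM2l (ltW c0) (positive_mx_form z); rewrite -/x mulrA.
  have := ler_wpM2r (sqr_ge0 (rnorm x)) cN.
  lra.
have {}neg : spin_form K0 (positive_mx N *m z1) + spin_form K0 (positive_mx N *m z2) <= 0 := neg.
have [s1 s2] := sum_nonpos_eq0 (pos z1) (pos z2) (sqr_ge0 _) (sqr_ge0 _) neg.
have inj z : rnorm (positive_mx N *m z) ^+ 2 = 0 -> z = 0.
  move=> /eqP; rewrite sqrf_eq0 => /eqP /rnorm_eq0; exact: positive_mx_inj.
by case/orP: z12 => /eqP; apply; exact: inj.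
Qed.
End Sphere4c.

Section Sphere4d.
Variable R : realType.
Notation V := (fock_rep R 4).
Notation D N := (fdim V N.+2).
Notation opa N r := (sphere4_op N V r : mxalg R^o (D N * 2)).

Lemma sphere4_op_star N r : star (opa N r) = opa N r.
Proof.
rewrite -[RHS](sphere4_op_sym N V r); apply/matrixP => i j.
by rewrite !mxE.
Qed.

Lemma sphere4_op_comm_le N r s : `‖acomm (opa N r) (opa N s)‖ <=
  (\sum_p `|sphere4_bracket R r s p.1 p.2|) * N.+2%:R.
Proof.
set C := _ * _.
have C0 : 0 <= C by rewrite mulr_ge0 ?sumr_ge0.
apply: opnorm_le => // v.
have -> : acomm (opa N r) (opa N s) =
   gop V N.+1 (sphere4_bracket R r s) *t (sphere4_unit R r *m sphere4_unit R s).
  exact: sphere4_op_comm.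
apply: (@rnorm_tens_le R) => // [w|].
  have := @vnorm_gop_le R R^o 4 V N.+1 (sphere4_bracket R r s) w.
  have -> : qmx (1 : R^o) (gop V N.+1 (sphere4_bracket R r s)) =
      gop V N.+1 (sphere4_bracket R r s) :> 'M[R]_(D N).
    by apply/matrixP => i j; rewrite mxE; exact: mulr1.
  exact.
rewrite trmx_mul -mulmxA (mulmxA (sphere4_unit R r)^T) sphere4_unit_orth mul1mx.
exact: sphere4_unit_orth.
Qed.

Theorem obstructed_real5 : obstructed 5 R^o.
Proof.
exists 20^-1 => [|delta d0]; first lra.
pose B := \sum_r \sum_s \sum_p `|sphere4_bracket R r s p.1 p.2|.
have B0 : 0 <= B by do 3 (apply: sumr_ge0 => ? _).
pose N := (Num.bound (B / delta)).+1.
have NB : B / delta < N%:R.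
  apply: lt_le_trans (_ : (Num.bound (B / delta))%:R <= _); last by rewrite ler_nat.
  by rewrite archi_boundP // divr_ge0 // ltW.
pose E : R := N.+2%:R * N.+2.+4%:R.
have E0 : 0 < E by rewrite mulr_gt0 ?ltr0n.
pose c := (Num.sqrt E)^-1.
have c0 : 0 < c by rewrite invr_gt0 sqrtr_gt0.
have cc : c * c * E = 1.
  by rewrite -expr2 exprVn sqr_sqrtr ?ltW // mulVf // gt_eqF.
exists (D N * 2)%N; split; first by rewrite muln_gt0 fdim_gt0.
exists (fun r => c *: opa N r); split.
- by move=> r; rewrite starZ sphere4_op_star.
- transitivity ((c * c) *: (\sum_r opa N r ⋆ opa N r)).
    by rewrite scaler_sumr; apply: eq_bigr => r _; rewrite amulZl amulZr scalerA.
  have -> : \sum_r opa N r ⋆ opa N r = (E%:M : 'M[R]_(D N * 2)) :> mxalg R^o (D N * 2).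
    exact: sphere4_op_sqr.
  apply/matrixP => i j; rewrite !mxE.
  by case: eqP => _; rewrite ?scaler0 //; exact: cc.
- move=> r s; have -> : acomm (c *: opa N r) (c *: opa N s) =
      (c * c) *: acomm (opa N r) (opa N s).
    by rewrite /acomm !amulZl !amulZr !scalerA scalerBr.
  have cc0 : 0 <= c * c by rewrite mulr_ge0 ?(ltW c0).
  rewrite anormZ ger0_norm //.
  apply: (le_trans (ler_wpM2l cc0 (sphere4_op_comm_le N r s))).
  have le_B : \sum_p `|sphere4_bracket R r s p.1 p.2| <= B.
    rewrite /B (bigD1 r) //= (bigD1 s) //= -addrA lerDl addr_ge0 //.
      by do 2 (apply: sumr_ge0 => ? _).
    by do 3 (apply: sumr_ge0 => ? _).
  apply: le_trans (_ : c * c * (B * N.+2%:R) <= _).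
    by rewrite ler_wpM2l // ler_wpM2r ?ler0n.
  rewrite -(ler_pM2r E0) mulrAC cc mul1r.
  rewrite /E mulrCA [leLHS]mulrC ler_pM2l ?ltr0n //.
  move: NB; rewrite ltr_pdivrMr // => /ltW/le_trans; apply.
  by rewrite mulrC ler_pM2l // ler_nat; lia.
- move=> K saK comK nearK.
  apply: (@commuting_far_from_sphere4 _ N c K) => //.
  have h2 : 0 <= 2^-1 :> R by rewrite invr_ge0 ler0n.
  have h3 : 0 <= c * N.+2%:R by rewrite mulr_ge0 ?(ltW c0) ?ler0n.
  rewrite -ler_sqr ?nnegrE //.
  rewrite -(ler_pM2r E0) exprMn.
  have -> : c ^+ 2 * N.+2%:R ^+ 2 * E = N.+2%:R ^+ 2 * (c * c * E) by ring.
  rewrite cc mulr1 /E.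
  have : 0 <= (N%:R : R) by exact: ler0n.
  by rewrite -[N.+2.+4]addn4 -[N.+2]addn2 !natrD; nra.
Qed.
End Sphere4d.

(** * Words of letters as an operator-valued multinomial law *)

Fixpoint words (J : finType) m : seq (seq J) :=
  if m is m'.+1 then [seq j :: w | j <- enum J, w <- words J m'] else [:: [::]].

Lemma size_words (J : finType) m w : w \in words J m -> size w = m.
Proof.
elim: m w => [|m IH] w /=; first by rewrite inE => /eqP ->.
by case/allpairsP => -[j v] [_ /IH <- ->].
Qed.

Lemma big_wordsS (J : finType) (V : nmodType) m (G : seq J -> V) :
  \sum_(w <- words J m.+1) G w = \sum_j \sum_(w <- words J m) G (j :: w).
Proof. by rewrite /= big_allpairs_dep big_enum. Qed.

Section StarAlgebraSums.
Variables (R : realType) (A : starAlgType R).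
Implicit Types a b : A.

Lemma amul0l a : 0 ⋆ a = 0.
Proof. by rewrite -[X in X ⋆ _](scale0r 0) amulZl scale0r. Qed.

Lemma amul0r a : a ⋆ 0 = 0.
Proof. by rewrite -[X in _ ⋆ X](scale0r 0) amulZr scale0r. Qed.

Lemma amul_suml I (r : seq I) (P : pred I) (G : I -> A) b :
  (\sum_(i <- r | P i) G i) ⋆ b = \sum_(i <- r | P i) G i ⋆ b.
Proof. exact: (big_morph (fun a => a ⋆ b) (fun x y => amulDl x y b) (amul0l b)). Qed.

Lemma amul_sumr I (r : seq I) (P : pred I) (G : I -> A) a :
  a ⋆ (\sum_(i <- r | P i) G i) = \sum_(i <- r | P i) a ⋆ G i.
Proof. exact: (big_morph (amul a) (amulDr a) (amul0r a)). Qed.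
End StarAlgebraSums.

Section Words.
Variables (R : realType) (A : starAlgType R) (one : A).
Hypothesis one_l : forall a, one ⋆ a = a.
Hypothesis one_r : forall a, a ⋆ one = a.
Variables (J : finType) (s : J -> A).
Hypothesis s_star : forall j, star (s j) = s j.
Hypothesis s_sum : \sum_j s j ⋆ s j = one.
Notation words := (words J).

Definition wordprod (w : seq J) : A := foldr (fun j x => s j ⋆ x) one w.
(** Of the form X X^T, hence positive even when the letters do not commute; for commuting letters it
    is the product of the squares of the letters. *)
Definition wordsq w : A := wordprod w ⋆ star (wordprod w).
Notation E := wordsq.

Lemma star_one : star one = one.
Proof. by rewrite -[LHS]one_r -[X in _ ⋆ X]starK -starM one_r starK. Qed.

Lemma wordsq_nil : E [::] = one.
Proof. by rewrite /wordsq /= star_one one_l. Qed.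

Lemma wordsq_cons j w : E (j :: w) = s j ⋆ E w ⋆ s j.
Proof. by rewrite /wordsq /= starM s_star !amulA. Qed.

(** Consistency of marginals. It holds without commutation, because the sum acts on the innermost
    letters. *)
Lemma sum_wordsq_cat w l : \sum_(v <- words l) E (w ++ v) = E w.
Proof.
elim: w => [|j w IH]; last first.
  under eq_bigr do rewrite cat_cons wordsq_cons.
  by rewrite -amul_suml -amul_sumr IH wordsq_cons.
rewrite wordsq_nil; elim: l => [|l IH]; first by rewrite big_seq1 wordsq_nil.
rewrite big_wordsS -[RHS]s_sum; apply: eq_bigr => j _.
under eq_bigr do rewrite /= wordsq_cons.
by rewrite -amul_suml -amul_sumr IH one_r.
Qed.

Section Commuting.
Hypothesis sC : forall i j, s i ⋆ s j = s j ⋆ s i.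
Let p j := s j ⋆ s j.

Lemma wordsqC j w : s j ⋆ E w = E w ⋆ s j.
Proof.
elim: w => [|i w IH]; first by rewrite wordsq_nil one_l one_r.
rewrite wordsq_cons; move: (E w) IH => e IH.
rewrite !amulA (sC j i) -(amulA (s i) (s j)) IH amulA.
by rewrite -[LHS]amulA -[RHS]amulA (sC j i).
Qed.

Lemma wordsq_consC j w : E (j :: w) = p j ⋆ E w.
Proof. by rewrite wordsq_cons -amulA -wordsqC amulA. Qed.

Lemma wordsq_cat w v : E (w ++ v) = E w ⋆ E v.
Proof.
elim: w => [|j w IH]; first by rewrite wordsq_nil one_l.
by rewrite cat_cons !wordsq_consC IH amulA.
Qed.

(** The expectation of f under the law E, a Bernstein operator; [letter_mean] is the expectation
    over one letter. *)
Definition word_mean m (f : seq J -> R) : A := \sum_(w <- words m) f w *: E w.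
Notation Exp := word_mean.
Definition letter_mean (c : J -> R) : A := \sum_j c j *: p j.
Notation a := letter_mean.
Definition wordsum (c : J -> R) (w : seq J) : R := \sum_(j <- w) c j.
Notation S := wordsum.

Lemma word_meanS m f : Exp m.+1 f = \sum_j p j ⋆ Exp m (fun w => f (j :: w)).
Proof.
rewrite /word_mean big_wordsS; apply: eq_bigr => j _; rewrite amul_sumr.
by apply: eq_bigr => w _; rewrite wordsq_consC amulZr.
Qed.

Lemma word_meanD m f g : Exp m (fun w => f w + g w) = Exp m f + Exp m g.
Proof. by rewrite -big_split; apply: eq_bigr => w _; rewrite scalerDl. Qed.

Lemma word_meanZ m t f : Exp m (fun w => t * f w) = t *: Exp m f.
Proof. by rewrite scaler_sumr; apply: eq_bigr => w _; rewrite scalerA. Qed.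

Lemma eq_word_mean m f g : f =1 g -> Exp m f = Exp m g.
Proof. by move=> fg; apply: eq_bigr => w _; rewrite fg. Qed.

Lemma word_mean1 m : Exp m (fun=> 1) = one.
Proof.
rewrite -wordsq_nil -(sum_wordsq_cat [::] m).
by apply: eq_bigr => w _; rewrite scale1r.
Qed.

Lemma word_mean_sum m c : Exp m (S c) = m%:R *: a c.
Proof.
elim: m => [|m IH].
  by rewrite /word_mean big_seq1 /wordsum big_nil !scale0r.
rewrite word_meanS.
under eq_bigr do under eq_word_mean do rewrite /wordsum big_cons -[c _]mulr1.
under eq_bigr do rewrite word_meanD word_meanZ word_mean1 IH amulDr amulZr one_r.
by rewrite big_split /= -amul_suml s_sum one_l -natr1 scalerDl scale1r addrC.
Qed.

Lemma letter_meanC c d : a c ⋆ a d = a d ⋆ a c.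
Proof.
have pC i j : p i ⋆ p j = p j ⋆ p i.
  have sp : s i ⋆ p j = p j ⋆ s i by rewrite /p amulA (sC i) -amulA (sC i) amulA.
  by rewrite /p -/(p j) -amulA sp amulA sp amulA.
rewrite amul_suml; under eq_bigr do rewrite amul_sumr.
rewrite exchange_big amul_suml; apply: eq_bigr => j _.
rewrite amul_sumr; apply: eq_bigr => i _ /=.
by rewrite !amulZl !amulZr pC scalerA mulrC -scalerA.
Qed.

(** The second moment of a sum of m independent letters: m diagonal terms and m (m - 1) products of
    means. *)
Lemma word_mean_sum2 m c d : Exp m (fun w => S c w * S d w) =
  m%:R *: a (fun j => c j * d j) + (m%:R * (m%:R - 1)) *: (a c ⋆ a d).
Proof.
elim: m => [|m IH].
  by rewrite /word_mean big_seq1 /wordsum !big_nil !mul0r !scale0r addr0.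
rewrite word_meanS.
have step j : Exp m (fun w => S c (j :: w) * S d (j :: w)) =
    (c j * d j) *: one + (m%:R * c j) *: a d + (m%:R * d j) *: a c
    + Exp m (fun w => S c w * S d w).
  transitivity (Exp m (fun w => c j * d j * 1 + c j * S d w + d j * S c w + S c w * S d w)).
    by apply: eq_word_mean => w; rewrite /wordsum !big_cons; ring.
  by rewrite !word_meanD !word_meanZ word_mean1 !word_mean_sum !scalerA !(mulrC _ m%:R).
under eq_bigr do rewrite step !amulDr !amulZr one_r.
rewrite !big_split /= -amul_suml s_sum one_l IH.
have pull e b : \sum_j (m%:R * e j) *: (p j ⋆ b) = m%:R *: (a e ⋆ b).
  rewrite amul_suml scaler_sumr; apply: eq_bigr => j _.
  by rewrite amulZl scalerA.
rewrite !pull -/(a (fun j => c j * d j)) (letter_meanC d c).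
move: (a (fun j => c j * d j)) (a c ⋆ a d) => X Y; rewrite -natr1.
have -> : (m%:R + 1) * (m%:R + 1 - 1) = m%:R + (m%:R + m%:R * (m%:R - 1)) :> R by ring.
rewrite !scalerDl scale1r [_ *: X + X]addrC -!addrA; congr (_ + _).
by rewrite (addrCA (_ *: Y) (_ *: X) _) (addrCA (_ *: Y) (_ *: X)).
Qed.

Variables (d : nat) (c : 'I_d -> J -> R).
Let h r := a (c r).
Hypothesis h_sqr : \sum_r h r ⋆ h r = one.

Definition wordpoint m (w : seq J) r : R := m%:R^-1 * S (c r) w.

Lemma word_mean_point m r : (0 < m)%N -> Exp m (fun w => wordpoint m w r) = h r.
Proof.
move=> m0; rewrite word_meanZ word_mean_sum scalerA mulVf ?scale1r //.
by rewrite pnatr_eq0 -lt0n.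
Qed.

End Commuting.
End Words.

(** It vanishes exactly when x = y is a unit vector, and being polynomial it has a computable
    mean. *)
Definition sphere_defect (R : pzRingType) d (x y : 'I_d -> R) : R :=
  \sum_r (x r - y r) ^+ 2 + (1 - \sum_r x r * y r) ^+ 2.

Section Defect.
Variables (R : realType) (A : starAlgType R) (one : A).
Hypothesis one_l : forall a, one ⋆ a = a.
Hypothesis one_r : forall a, a ⋆ one = a.
Variables (J : finType) (s : J -> A).
Hypothesis s_star : forall j, star (s j) = s j.
Hypothesis s_sum : \sum_j s j ⋆ s j = one.
Hypothesis sC : forall i j, s i ⋆ s j = s j ⋆ s i.
Variables (d : nat) (c : 'I_d -> J -> R).
Notation E := (wordsq one s).
Notation Exp := (word_mean one s).
Notation a := (letter_mean s).
Let h r := a (c r).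
Hypothesis h_sqr : \sum_r h r ⋆ h r = one.

(** Two independent words have the same mean point h, of square 1, and their coordinates have
    covariance D / m. The terms of order 0 cancel as 1 - 2 + 1. *)
Lemma mean_defect : exists z1 z2 : A, forall m, (0 < m)%N ->
  \sum_(w <- words J m) \sum_(v <- words J m)
    sphere_defect (wordpoint c m w) (wordpoint c m v) *: E (w ++ v) =
  m%:R^-1 *: z1 + m%:R^-1 ^+ 2 *: z2.
Proof.
(* The covariance of the coordinates r and t of a single letter. *)
pose D r t := a (fun j => c r j * c t j) - h r ⋆ h t.
exists (2 *: \sum_r D r r + \sum_r \sum_t ((h r ⋆ h t) ⋆ D r t + D r t ⋆ (h r ⋆ h t))).
exists (\sum_r \sum_t D r t ⋆ D r t) => m m0.
have m0' : (m%:R : R) != 0 by rewrite pnatr_eq0 -lt0n.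
pose Exp2 (G : seq J -> seq J -> R) : A :=
  \sum_(w <- words J m) \sum_(v <- words J m) G w v *: E (w ++ v).
rewrite -[LHS]/(Exp2 (fun w v => sphere_defect (wordpoint c m w) (wordpoint c m v))).
have Exp2D G1 G2 : Exp2 (fun w v => G1 w v + G2 w v) = Exp2 G1 + Exp2 G2.
  rewrite /Exp2 -big_split; apply: eq_bigr => w _; rewrite -big_split.
  by apply: eq_bigr => v _; rewrite scalerDl.
have Exp20 : Exp2 (fun _ _ => 0) = 0.
  by rewrite /Exp2 big1 // => w _; rewrite big1 // => v _; rewrite scale0r.
have Exp2_sum (I : finType) (G : I -> seq J -> seq J -> R) :
    Exp2 (fun w v => \sum_i G i w v) = \sum_i Exp2 (G i).
  rewrite /Exp2 exchange_big /=.
  under [RHS]eq_bigr do rewrite exchange_big.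
  rewrite [RHS]exchange_big; apply: eq_bigr => w _ /=.
  rewrite [RHS]exchange_big; apply: eq_bigr => v _ /=.
  by rewrite scaler_suml.
have Exp2M f g : Exp2 (fun w v => f w * g v) = Exp m f ⋆ Exp m g.
  rewrite /Exp2 amul_suml; apply: eq_bigr => w _.
  rewrite amul_sumr; apply: eq_bigr => v _.
  by rewrite amulZl amulZr scalerA wordsq_cat.
have eqExp2 G1 G2 : (forall w v, G1 w v = G2 w v) -> Exp2 G1 = Exp2 G2.
  by move=> G12; apply: eq_bigr => w _; apply: eq_bigr => v _; rewrite G12.
pose x r w := wordpoint c m w r.
have x1 r : Exp m (x r) = h r by exact: word_mean_point.
have x2 r t : Exp m (fun w => x r w * x t w) = h r ⋆ h t + m%:R^-1 *: D r t.
  transitivity (m%:R^-1 ^+ 2 *: Exp m (fun w => wordsum (c r) w * wordsum (c t) w)).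
    by rewrite -word_meanZ; apply: eq_word_mean => w; rewrite /x /wordpoint; ring.
  rewrite word_mean_sum2 // /D -/(h r) -/(h t); move: (a _) (h r ⋆ h t) => X Y.
  rewrite scalerDr scalerBr !scalerA.
  have -> : m%:R^-1 ^+ 2 * m%:R = m%:R^-1 :> R by field.
  have -> : m%:R^-1 ^+ 2 * (m%:R * (m%:R - 1)) = 1 - m%:R^-1 :> R by field.
  by rewrite scalerBl scale1r addrCA.
have -> : Exp2 (fun w v => sphere_defect (wordpoint c m w) (wordpoint c m v)) =
   Exp2 (fun w v => 1 * 1 + (\sum_r (x r w * x r w * 1 + 1 * (x r v * x r v)
       + (-4 * x r w) * x r v))
     + \sum_r \sum_t (x r w * x t w) * (x r v * x t v)).
  apply: eqExp2 => w v; rewrite /sphere_defect sqrrB expr1n mul1r.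
  have -> : (\sum_r wordpoint c m w r * wordpoint c m v r) ^+ 2 =
      \sum_r \sum_t x r w * x t w * (x r v * x t v).
    rewrite expr2 mulr_suml; apply: eq_bigr => r _; rewrite mulr_sumr.
    by apply: eq_bigr => t _; rewrite /x; ring.
  rewrite !addrA; congr (_ + _); rewrite addrAC [LHS]addrC; congr (_ + _).
  rewrite mul1r -sumrMnl -sumrN -big_split /=; apply: eq_bigr => r _; rewrite /x; ring.
rewrite !Exp2D !Exp2_sum.
have diag r : Exp2 (fun w v => x r w * x r w * 1 + 1 * (x r v * x r v) + -4 * x r w * x r v) =
    m%:R^-1 *: (2 *: D r r) - 2 *: (h r ⋆ h r).
  rewrite 2!Exp2D (Exp2M (fun w => x r w * x r w) (fun=> 1)).
  rewrite (Exp2M (fun=> 1) (fun w => x r w * x r w)) (Exp2M (fun w => -4 * x r w) (x r)).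
  rewrite word_mean1 // one_l one_r word_meanZ x1 x2 amulZl.
  move: (h r ⋆ h r) (D r r) => Y X.
  have -> : -4 *: Y = - (Y + Y) - 2 *: Y.
    by rewrite scaleNr !scaler_nat -opprD -[Y + Y]mulr2n -mulrnDr.
  have -> : 2 *: X = X + X by rewrite scaler_nat mulr2n.
  rewrite scalerDr (addrACA Y); move: (_ + _) (Y + Y) => M Z.
  by rewrite [Z + M]addrC -addrA addNKr.
have cross r t : Exp2 (fun w v => x r w * x t w * (x r v * x t v)) =
    (h r ⋆ h r) ⋆ (h t ⋆ h t) + m%:R^-1 *: ((h r ⋆ h t) ⋆ D r t + D r t ⋆ (h r ⋆ h t))
    + m%:R^-1 ^+ 2 *: (D r t ⋆ D r t).
  rewrite (Exp2M (fun w => x r w * x t w) (fun w => x r w * x t w)) x2.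
  have -> : (h r ⋆ h r) ⋆ (h t ⋆ h t) = (h r ⋆ h t) ⋆ (h r ⋆ h t).
    have C : h r ⋆ h t = h t ⋆ h r by exact: letter_meanC.
    by move: (h r) (h t) C => u v C; rewrite !amulA -(amulA u v u) -C amulA.
  move: (D r t) => X; move: (h r ⋆ h t) => Y.
  by rewrite amulDl !amulDr !amulZl !amulZr scalerA -expr2 scalerDr !addrA.
clearbody D.
rewrite (Exp2M (fun=> 1) (fun=> 1)) word_mean1 // one_l.
rewrite (eq_bigr _ (fun r _ => diag r)) sumrB -!scaler_sumr h_sqr.
under [X in _ + X = _]eq_bigr do rewrite Exp2_sum (eq_bigr _ (fun t _ => cross _ t)) !big_split /=
  -amul_sumr h_sqr one_r -!scaler_sumr.
rewrite !big_split /= h_sqr -!scaler_sumr.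
rewrite scalerDr -!addrA addrCA; congr (_ + _).
have -> : 2 *: one = one + one by rewrite scaler_nat mulr2n.
by rewrite opprD -(addrA (- one)) addKr addNKr.
Qed.
End Defect.

Lemma sum_cauchy_schwarz (R : realType) (I : Type) (r : seq I) (p a b : I -> R) :
  (forall i, 0 <= p i) ->
  (\sum_(i <- r) p i * (a i * b i)) ^+ 2 <=
  (\sum_(i <- r) p i * a i ^+ 2) * (\sum_(i <- r) p i * b i ^+ 2).
Proof.
move=> p0; elim: r => [|i r IH]; first by rewrite !big_nil expr0n mulr0.
rewrite !big_cons.
have A0 : 0 <= \sum_(i <- r) p i * a i ^+ 2.
  by apply: sumr_ge0 => j _; rewrite mulr_ge0 ?sqr_ge0.
have B0 : 0 <= \sum_(i <- r) p i * b i ^+ 2.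
  by apply: sumr_ge0 => j _; rewrite mulr_ge0 ?sqr_ge0.
move: IH A0 B0; move: (\sum_(i <- r) _) (\sum_(i <- r) _) (\sum_(i <- r) _) => Z Y X.
move=> XYZ Y0 Z0.
have cross : 2 * (a i * b i * X) <= a i ^+ 2 * Z + b i ^+ 2 * Y.
  apply: le_trans (ler_norm _) _.
  have S0 : 0 <= a i ^+ 2 * Z + b i ^+ 2 * Y by rewrite addr_ge0 // mulr_ge0 // sqr_ge0.
  rewrite -ler_sqr ?nnegrE // real_normK ?num_real //.
  rewrite -subr_ge0.
  have -> : (a i ^+ 2 * Z + b i ^+ 2 * Y) ^+ 2 - (2 * (a i * b i * X)) ^+ 2 =
      (a i ^+ 2 * Z - b i ^+ 2 * Y) ^+ 2 + (2 * (a i * b i)) ^+ 2 * (Y * Z - X ^+ 2) by ring.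
  by rewrite addr_ge0 ?sqr_ge0 // mulr_ge0 ?sqr_ge0 // subr_ge0.
rewrite -subr_ge0.
have -> : (p i * a i ^+ 2 + Y) * (p i * b i ^+ 2 + Z) - (p i * (a i * b i) + X) ^+ 2 =
   (Y * Z - X ^+ 2) + p i * (a i ^+ 2 * Z + b i ^+ 2 * Y - 2 * (a i * b i * X)) by ring.
by rewrite addr_ge0 ?mulr_ge0 ?subr_ge0.
Qed.

(** * Domination of positive sums in norm *)

Section Dominance.
Variables (R : realType) (F : conjScalarType R) (n : nat).
Local Notation M := (mxalg F n).

Lemma mxalg_form_sum (I : Type) (r : seq I) (X : I -> M) (f : I -> R) (u v : 'cV[F]_n) :
  (adjmx u *m ((\sum_(i <- r) f i *: (X i ⋆ star (X i)) : 'M[F]_n) *m v)) 0 0 =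
  \sum_(i <- r) f i *: ((adjmx (adjmx (X i) *m u) *m (adjmx (X i) *m v)) 0 0).
Proof.
elim: r => [|i r IH]; first by rewrite !big_nil mul0mx mulmx0 mxE.
rewrite !big_cons mulmxDl mulmxDr mxE IH; congr (_ + _).
rewrite adjmxM adjmxK -!mulmxA (mulmxA (X i) (adjmx (X i)) v).
have -> : (f i *: (X i ⋆ star (X i)) : M) = map_mx ( *:%R (f i)) ((X i : 'M[F]_n) *m adjmx (X i)).
  by [].
move: (_ *m adjmx (X i)) => Y.
rewrite !mxE scaler_sumr; apply: eq_bigr => a _; rewrite scalerAr; congr (_ * _).
by rewrite !mxE scaler_sumr; apply: eq_bigr => b _; rewrite mxE scalerAl.
Qed.

(** Write P(v) for the form of the g-sum at v. By Cauchy-Schwarz the form of the f-sum at (u, v) is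
    at most the geometric mean of P(u) and P(v), each bounded by the norm of the g-sum; u is taken
    to be the image of v. *)
Lemma positive_sum_dominated (I : Type) (r : seq I) (X : I -> M) (f g : I -> R) :
  (forall i, `|f i| <= g i) ->
  `‖\sum_(i <- r) f i *: (X i ⋆ star (X i))‖ <= `‖\sum_(i <- r) g i *: (X i ⋆ star (X i))‖.
Proof.
move=> fg; have g0 i : 0 <= g i by apply: le_trans (fg i).
set Sf := \sum_(i <- r) f i *: _; set Sg := \sum_(i <- r) g i *: _.
pose P (v : 'cV[F]_n) := \sum_(i <- r) g i * vnorm (adjmx (X i) *m v) ^+ 2.
have Ple v : P v <= `‖Sg‖ * vnorm v ^+ 2.
  have P0 : 0 <= P v by apply: sumr_ge0 => i _; rewrite mulr_ge0 ?sqr_ge0.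
  have PE : (adjmx v *m (Sg *m v)) 0 0 = (P v)%:A.
    rewrite mxalg_form_sum scaler_suml; apply: eq_bigr => i _.
    by rewrite adjmx_dotE scalerA.
  rewrite -[P v]ger0_norm // -(modulusA F) -PE.
  apply: le_trans (adjmx_dot_le _ _) _.
  by rewrite expr2 mulrCA ler_wpM2l ?vnorm_ge0 // opnormP.
apply: opnorm_le => [|v]; first exact: anorm_ge0.
set u := _ *m v.
have [u0|u0] := eqVneq (vnorm u) 0; first by rewrite u0 mulr_ge0 ?vnorm_ge0 ?anorm_ge0.
have up : 0 < vnorm u by rewrite lt0r u0 vnorm_ge0.
have le1 : vnorm u ^+ 2 <= \sum_(i <- r) g i *
    (vnorm (adjmx (X i) *m u) * vnorm (adjmx (X i) *m v)).
  rewrite -adjmx_dot {2}/u mxalg_form_sum.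
  apply: le_trans (modulus_sum _ _ _) _; apply: ler_sum => i _.
  rewrite modulusZ ler_pM ?modulus_ge0 //; exact: adjmx_dot_le.
have le2 := sum_cauchy_schwarz r (fun i => vnorm (adjmx (X i) *m u))
  (fun i => vnorm (adjmx (X i) *m v)) g0.
have le3 : (vnorm u ^+ 2) ^+ 2 <= P u * P v.
  apply: le_trans le2; rewrite ler_sqr ?nnegrE ?sqr_ge0 //.
  by apply: le_trans le1; rewrite sqr_ge0.
have Pge0 w : 0 <= P w by apply: sumr_ge0 => i _; rewrite mulr_ge0 ?sqr_ge0.
have le4 := le_trans le3 (ler_pM (Pge0 u) (Pge0 v) (Ple u) (Ple v)).
rewrite -ler_sqr ?nnegrE ?mulr_ge0 ?vnorm_ge0 ?anorm_ge0 //.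
have u2 : 0 < vnorm u ^+ 2 by rewrite exprn_gt0.
rewrite -(ler_pM2l u2) -expr2; apply: le_trans le4 _.
by rewrite exprMn mulrACA mulrCA -expr2.
Qed.

Lemma positive_sum_dominated_in (I : eqType) (r : seq I) (X : I -> M) (f g : I -> R) :
  (forall i, i \in r -> `|f i| <= g i) ->
  `‖\sum_(i <- r) f i *: (X i ⋆ star (X i))‖ <= `‖\sum_(i <- r) g i *: (X i ⋆ star (X i))‖.
Proof.
move=> fg; pose on (h : I -> R) i := if i \in r then h i else 0.
have onE h : \sum_(i <- r) h i *: (X i ⋆ star (X i)) =
    \sum_(i <- r) on h i *: (X i ⋆ star (X i)).
  by rewrite big_seq [RHS]big_seq; apply: eq_bigr => i ri; rewrite /on ri.
rewrite (onE f) (onE g); apply: positive_sum_dominated => i.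
by rewrite /on; case: ifP => [/fg //|_]; rewrite normr0.
Qed.
End Dominance.

Import numFieldNormedType.Exports.
Local Open Scope classical_set_scope.
Local Open Scope ring_scope.

(** * Limits and a compactness estimate *)

Section Limits.
Variable R : realType.

Lemma cvg_sum_seq (T : Type) (F : set_system T) {FF : Filter F} (I : Type) (r : seq I)
    (f : I -> T -> R) (l : I -> R) :
  (forall i, f i x @[x --> F] --> l i) ->
  (\sum_(i <- r) f i x) @[x --> F] --> \sum_(i <- r) l i.
Proof.
move=> fl; elim: r => [|i r IH].
  by under eq_fun do rewrite big_nil; rewrite big_nil; exact: cvg_cst.
by under eq_fun do rewrite big_cons; rewrite big_cons; exact: cvgD.
Qed.

Lemma cvg_mx (T : Type) (F : set_system T) {FF : Filter F} m n (f : T -> 'M[R]_(m, n)) (l : 'M[R]_(m, n)) :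
  (forall i j, f x i j @[x --> F] --> l i j) -> f x @[x --> F] --> l.
Proof.
move=> fl A [P lP PA]; rewrite nbhs_filterE.
have h : \forall x \near F, forall i j, P i j (f x i j).
  by apply: filter_forall => i; apply: filter_forall => j; exact: fl.
by apply: filterS h => x Px; exact: PA.
Qed.

Lemma cvg_coord (T : Type) (F : set_system T) {FF : Filter F} d (f : T -> 'rV[R]_d) (l : 'rV[R]_d) i :
  f x @[x --> F] --> l -> f x 0 i @[x --> F] --> l 0 i.
Proof.
move=> fl; exact: (cvg_comp f (fun M : 'rV[R]_d => M 0 i) fl (@coord_continuous R 1 d 0 i l)).
Qed.

Lemma cvg_sqr (T : Type) (F : set_system T) {FF : Filter F} (f : T -> R) (l : R) :
  f x @[x --> F] --> l -> f x ^+ 2 @[x --> F] --> l ^+ 2.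
Proof. by move=> fl; rewrite expr2; under eq_fun do rewrite expr2; exact: cvgM. Qed.

Definition defect d (x y : 'rV[R]_d) : R := sphere_defect (fun r => x 0 r) (fun r => y 0 r).

Lemma defect_ge0 d (x y : 'rV[R]_d) : 0 <= defect x y.
Proof. by rewrite addr_ge0 ?sqr_ge0 // sumr_ge0 // => r _; rewrite sqr_ge0. Qed.

Lemma defect_eq0 d (x y : 'rV[R]_d) : defect x y = 0 -> y = x /\ \sum_r x 0 r ^+ 2 = 1.
Proof.
have S0 : 0 <= \sum_r (x 0 r - y 0 r) ^+ 2 by apply: sumr_ge0 => r _; rewrite sqr_ge0.
move=> /eqP; rewrite /defect /sphere_defect paddr_eq0 ?sqr_ge0 // sqrf_eq0 subr_eq0.
case/andP => /eqP S1 /eqP S2.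
have xy : y = x.
  apply/rowP => i; apply/eqP; rewrite eq_sym -subr_eq0 -sqrf_eq0; apply/eqP.
  by have/psumr_eq0P := S1; apply=> // r _; rewrite sqr_ge0.
split=> //; rewrite S2; apply: eq_bigr => r _; by rewrite xy expr2.
Qed.

Lemma defect_cvg (T : Type) (F : set_system T) {FF : Filter F} d (f g : T -> 'rV[R]_d) x y :
  f t @[t --> F] --> x -> g t @[t --> F] --> y -> defect (f t) (g t) @[t --> F] --> defect x y.
Proof.
move=> fx gy; apply: cvgD.
  by apply: cvg_sum_seq => r; apply: cvg_sqr; apply: cvgB; exact: cvg_coord.
apply: cvg_sqr; apply: cvgB; first exact: cvg_cst.
by apply: cvg_sum_seq => r; apply: cvgM; exact: cvg_coord.
Qed.

Definition cube d (B : R) : set 'rV[R]_d := [set x | forall r, `|x 0 r| <= B].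

Lemma cube_compact d B : compact (@cube d B).
Proof.
have := @rV_compact R d (fun=> [set` `[- B, B]]) (fun _ => @segment_compact _ _ _).
congr compact; apply/seteqP; split=> x /= xB r; have := xB r; rewrite /= in_itv /= ler_norml.
  by [].
by [].
Qed.

(** On the compact square of the cube, the defect is bounded below away from its zeros, so a large C
    absorbs the bound M there; its zeros are the pairs (x, x) on the unit sphere, near which P is at
    most e. *)
Lemma defect_dominates d (B M : R) (P : 'rV[R]_d -> 'rV[R]_d -> R) :
  (forall x y, cube B x -> cube B y -> `|P x y| <= M) ->
  (forall x : 'rV[R]_d, \sum_r x 0 r ^+ 2 = 1 -> forall e : R, 0 < e ->
    \forall z \near (x, x), `|P z.1 z.2| <= e) ->
  forall e : R, 0 < e -> exists2 C, 0 <= C &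
    forall x y, cube B x -> cube B y -> `|P x y| <= e + C * defect x y.
Proof.
move=> PM Pdiag e e0.
have ge0 : \forall C \near +oo, 0 <= C :> R by exact: nbhs_pinfty_ge.
have KC : compact (@cube d B `*` @cube d B) by apply: compact_setX; exact: cube_compact.
have : \forall C \near +oo, (@cube d B `*` @cube d B) `<=`
    (fun z => `|P z.1 z.2| <= e + C * defect z.1 z.2).
  move/compact_near_coveringP/near_covering_withinP : KC; apply => -[x y] _.
  have [xy0|xy0] := eqVneq (defect x y) 0.
    have [-> x1] := defect_eq0 xy0.
    have A := Pdiag _ x1 _ e0.
    near=> z C => _.
    apply: le_trans (_ : e <= _); first exact: (near A z).
    rewrite lerDl mulr_ge0 ?defect_ge0 //.
    exact: (near ge0 C).
  have q0 : 0 < defect x y by rewrite lt0r xy0 defect_ge0.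
  have A : \forall z \near (x, y), defect x y / 2 < defect z.1 z.2.
    have dc : defect z.1 z.2 @[z --> (x, y)] --> defect x y.
      by apply: defect_cvg; [exact: cvg_fst|exact: cvg_snd].
    by apply: (cvgr_gt _ dc); rewrite ltr_pdivrMr // ltr_pMr // ltr1n.
  have geM : \forall C \near +oo, M / (defect x y / 2) <= C.
    by apply: nbhs_pinfty_ge; exact: num_real.
  near=> z C => -[zx zy].
  apply: (le_trans (PM _ _ zx zy)).
  apply: le_trans (_ : C * (defect x y / 2) <= _).
    by rewrite -ler_pdivrMr ?divr_gt0 //; exact: (near geM C).
  apply: le_trans (_ : C * defect z.1 z.2 <= _); last by rewrite lerDr ltW.
  apply: ler_wpM2l; first exact: (near ge0 C).
  by apply: ltW; exact: (near A z).
move=> h; have /filter_ex[C [C0 CP]] : \forall C \near +oo, 0 <= C /\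
   (@cube d B `*` @cube d B) `<=` (fun z => `|P z.1 z.2| <= e + C * defect z.1 z.2).
  by apply: filterI => //; exact: nbhs_pinfty_ge.
by exists C => // x y xB yB; exact: (CP (x, y)).
Unshelve. all: by end_near. Qed.
End Limits.

(** * Functions on the sphere through stereographic projection *)

Section Stereographic.
Variables (R : realType) (k : nat).
Implicit Types (x y : 'rV[R]_k.+1) (v : 'rV[R]_k) (f : suspension R k).

Definition sqnorm d (x : 'rV[R]_d) : R := \sum_r x 0 r ^+ 2.
Definition radius x : R := Num.sqrt (sqnorm x).
Definition stereo x : 'rV[R]_k :=
  \row_j (x 0 (lift ord_max j) / (radius x - x 0 ord_max)).
(** f transported to the sphere punctured at its last pole, set to 0 at the pole and extended
    homogeneously of degree 0, because sample points lie only near the sphere. *)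
Definition sphere_ext (f : suspension R k) x : R :=
  if x 0 ord_max < radius x then f (stereo x) else 0.

Lemma sqnorm_ge0 d (x : 'rV[R]_d) : 0 <= sqnorm x.
Proof. by apply: sumr_ge0 => r _; rewrite sqr_ge0. Qed.

Lemma sqnorm_cvg (T : Type) (F : set_system T) {FF : Filter F} d (f : T -> 'rV[R]_d) (x : 'rV[R]_d) :
  f t @[t --> F] --> x -> sqnorm (f t) @[t --> F] --> sqnorm x.
Proof. by move=> fx; apply: cvg_sum_seq => r; apply: cvg_sqr; exact: cvg_coord. Qed.

Lemma sqnorm_continuous d : continuous (@sqnorm d).
Proof. move=> x; exact (@sqnorm_cvg _ (nbhs x) _ _ id x cvg_id). Qed.

Lemma sqnorm_split x : sqnorm x = x 0 ord_max ^+ 2 + \sum_j x 0 (lift ord_max j) ^+ 2.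
Proof. by rewrite /sqnorm (bigD1_ord ord_max). Qed.

Lemma radius_cvg x : radius y @[y --> x] --> radius x.
Proof.
exact: (cvg_comp _ _ (@sqnorm_continuous _ x) (@sqrt_continuous R (sqnorm x))).
Qed.

Lemma last_cvg x : (y : 'rV[R]_k.+1) 0 ord_max @[y --> x] --> x 0 ord_max.
Proof. exact: (@coord_continuous R 1 k.+1 0 ord_max x). Qed.

Lemma sqnorm_stereo x : x 0 ord_max < radius x ->
  sqnorm (stereo x) = (radius x + x 0 ord_max) / (radius x - x 0 ord_max).
Proof.
move=> lt; have d0 : radius x - x 0 ord_max != 0 by rewrite subr_eq0 gt_eqF.
have r2 : radius x ^+ 2 = x 0 ord_max ^+ 2 + \sum_j x 0 (lift ord_max j) ^+ 2.
  by rewrite sqr_sqrtr ?sqnorm_ge0 // sqnorm_split.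
have -> : sqnorm (stereo x) = (\sum_j x 0 (lift ord_max j) ^+ 2) / (radius x - x 0 ord_max) ^+ 2.
  by rewrite mulr_suml; apply: eq_bigr => j _; rewrite mxE exprMn exprVn.
have -> : \sum_j x 0 (lift ord_max j) ^+ 2 = radius x ^+ 2 - x 0 ord_max ^+ 2 by rewrite r2; ring.
by field.
Qed.

Lemma suspension_bounded f : exists2 M, 0 <= M & forall v, `|f v| <= M.
Proof.
case: f => f /=; rewrite inE => -[cf f0].
have [K cK Kf] := f0 1 ltr01.
have : compact (f @` K).
  by apply: continuous_compact => //; apply: continuous_subspaceT; exact: cf.
move=> /(@compact_bounded R R) [M [_ MK]].
exists (Num.max 1 (M + 1)) => [|v]; first by rewrite le_max ler01.
have [Kv|Kv] := pselect (K v); rewrite le_max; apply/orP.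
  by right; apply: (MK (M + 1)); [rewrite ltrDl|exists v].
by left; rewrite ltW // Kf.
Qed.

Lemma sphere_ext_bounded f : exists2 M, 0 <= M & forall x, `|sphere_ext f x| <= M.
Proof.
have [M M0 fM] := suspension_bounded f; exists M => // x.
by rewrite /sphere_ext; case: ifP => // _; rewrite normr0.
Qed.

Lemma suspension_decay f (e : R) : 0 < e ->
  exists2 M, 0 < M & forall v, M < sqnorm v -> `|f v| < e.
Proof.
case: f => f /=; rewrite inE => -[cf f0] e0.
have [K cK Kf] := f0 e e0.
have : compact (@sqnorm k @` K).
  apply: continuous_compact => //; apply: continuous_subspaceT => v.
  exact: sqnorm_continuous.
move=> /(@compact_bounded R R) [M [_ MK]].
exists (Num.max 1 (M + 1)) => [|v]; first by rewrite lt_max ltr01.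
rewrite gt_max => /andP[_ Mv]; apply: Kf => Kv.
have := MK (M + 1); rewrite ltrDl => /(_ ltr01) /(_ (sqnorm v)).
by move=> /(_ (ex_intro2 _ _ v Kv erefl)); rewrite /= ger0_norm ?sqnorm_ge0 // leNgt Mv.
Qed.

Lemma last_le_sqnorm x : sqnorm x = 1 -> x 0 ord_max <= 1.
Proof.
move=> x1; have : x 0 ord_max ^+ 2 <= 1.
  by rewrite -x1 sqnorm_split lerDl sumr_ge0 // => j _; rewrite sqr_ge0.
by move: (x 0 ord_max) => t; nra.
Qed.

Lemma sphere_ext_cvg f x : sqnorm x = 1 -> sphere_ext f y @[y --> x] --> sphere_ext f x.
Proof.
move=> x1; have rx : radius x = 1 by rewrite /radius x1 sqrtr1.
have le1 := last_le_sqnorm x1.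
have dc : (radius y - y 0 ord_max) @[y --> x] --> radius x - x 0 ord_max.
  by apply: (cvgB (FF := nbhs_filter x)); [exact: radius_cvg|exact: last_cvg].
have [lt1|ge1] := ltP (x 0 ord_max) 1.
  have d0 : 0 < radius x - x 0 ord_max by rewrite rx subr_gt0.
  have near_pos : \forall y \near x, 0 < radius y - y 0 ord_max by exact: (cvgr_gt _ dc).
  rewrite {2}/sphere_ext rx lt1.
  have sc : stereo y @[y --> x] --> stereo x.
    apply: (cvg_mx (FF := nbhs_filter x)) => i j; rewrite mxE; under eq_fun do rewrite mxE.
    apply: (cvgM (FF := nbhs_filter x)); first exact: (@coord_continuous R 1 k.+1 0 _ x).
    by apply: (cvgV (FF := nbhs_filter x)) => //; rewrite gt_eqF.
  have fc : f (stereo y) @[y --> x] --> f (stereo x).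
    have cf : continuous f by case: (f) => g /=; rewrite inE => -[].
    exact: (cvg_comp _ _ sc (cf _)).
  apply: cvg_trans fc; apply: (near_eq_cvg (FF := nbhs_filter x)).
  apply: (@filterS _ (nbhs x) (nbhs_filter x) _ _ _ near_pos) => y.
  by rewrite subr_gt0 /sphere_ext => ->.
(* At the pole the squared norm of the projection, (r + x) / (r - x), tends to infinity, and f
   decays there. *)
have xm : x 0 ord_max = 1 by apply/eqP; rewrite eq_le le1.
rewrite {2}/sphere_ext rx xm ltxx; apply/(@cvgr0Pnorm_lt R R _ _ (nbhs_filter x)) => e e0.
have [M M0 fM] := suspension_decay f e0.
have sc : (radius y + y 0 ord_max) @[y --> x] --> (2 : R).
  rewrite -[2]/(1 + 1) -{1}rx -{1}xm.
  by apply: (cvgD (FF := nbhs_filter x)); [exact: radius_cvg|exact: last_cvg].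
have n1 : \forall y \near x, 1 < radius y + y 0 ord_max.
  by apply: (cvgr_gt _ sc); rewrite ltr1n.
have n2 : \forall y \near x, radius y - y 0 ord_max < M^-1.
  by apply: (cvgr_lt _ dc); rewrite rx xm subrr invr_gt0.
near=> y; rewrite /sphere_ext; case: ifP => [lt|_]; last by rewrite normr0.
apply: fM; rewrite sqnorm_stereo //.
have d0 : 0 < radius y - y 0 ord_max by rewrite subr_gt0.
rewrite ltr_pdivlMr //; apply: lt_trans (_ : 1 < _); last exact: (near n1 y).
by rewrite -ltr_pdivlMl // mulr1; exact: (near n2 y).
Unshelve. all: by end_near. Qed.

Lemma sphere_ext_mul f g x : sphere_ext (f ⋆ g) x = sphere_ext f x * sphere_ext g x.
Proof. by rewrite /sphere_ext; case: ifP => _ //; rewrite mul0r. Qed.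

Lemma sphere_ext_lin (t : R) f g x :
  sphere_ext (t *: f + g) x = t * sphere_ext f x + sphere_ext g x.
Proof. by rewrite /sphere_ext; case: ifP => _ //; rewrite mulr0 addr0. Qed.

Lemma frac_sqnorm_pred (g : 'rV[R]_k -> R) : continuous g ->
  (forall v, g v ^+ 2 <= 4 * (1 + sqnorm v)) -> 
  (fun v => g v / (1 + sqnorm v) : R^o) \in @C0_pred R 'rV[R]_k.
Proof.
move=> cg g4; have n0 v : 0 < 1 + sqnorm v by rewrite ltr_wpDr ?sqnorm_ge0.
rewrite inE; split=> [v|e e0].
  apply: (cvgM (FF := nbhs_filter v)); first exact: cg.
  apply: (cvgV (FF := nbhs_filter v)); first by rewrite gt_eqF.
  by apply: (cvgD (FF := nbhs_filter v)); [exact: cvg_cst|exact: sqnorm_continuous].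
(* Outside the cube 1 + |v|^2 exceeds B, while the square of the function is at most 4 / (1 +
   |v|^2). *)
pose B := 4 / e ^+ 2.
have e2 : 0 < e ^+ 2 by rewrite exprn_gt0.
exists (cube (B + 1)); first exact: cube_compact.
move=> v /existsNP [r /negP]; rewrite -ltNge => Bv.
have B0 : 0 < B by rewrite divr_gt0.
have Bn : B < 1 + sqnorm v.
  have : (B + 1) ^+ 2 < v 0 r ^+ 2.
    by rewrite -[v 0 r ^+ 2]real_normK ?num_real // ltr_pXn2r ?nnegrE ?addr_ge0 // ltW.
  have : v 0 r ^+ 2 <= sqnorm v.
    by rewrite /sqnorm (bigD1 r) //= lerDl sumr_ge0 // => s _; rewrite sqr_ge0.
  nra.
rewrite -ltr_sqr ?nnegrE ?(ltW e0) // real_normK ?num_real // exprMn exprVn.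
rewrite ltr_pdivrMr ?exprn_gt0 //.
apply: le_lt_trans (g4 v) _; rewrite expr2 mulrA ltr_pM2r //.
by rewrite mulrC -ltr_pdivrMr.
Qed.

Lemma coord_fun_pred (j : 'I_k) :
  (fun v => 2 * v 0 j / (1 + sqnorm v) : R^o) \in @C0_pred R 'rV[R]_k.
Proof.
apply: frac_sqnorm_pred => v.
  apply: (cvgM (FF := nbhs_filter v)); first exact: cvg_cst.
  exact: (@coord_continuous R 1 k 0 j v).
have : v 0 j ^+ 2 <= sqnorm v.
  by rewrite /sqnorm (bigD1 j) //= lerDl sumr_ge0 // => s _; rewrite sqr_ge0.
by nra.
Qed.

Lemma last_fun_pred : (fun v => 2 / (1 + sqnorm v) : R^o) \in @C0_pred R 'rV[R]_k.
Proof.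
apply: (frac_sqnorm_pred (g := fun=> 2)) => v; first exact: cst_continuous.
by have := sqnorm_ge0 v; nra.
Qed.

(** On the sphere, [coord_fun j] is a coordinate and [last_fun] is 1 minus the last one, since the
    last coordinate itself does not vanish at the pole. *)
Definition coord_fun j : suspension R k := MkC0 (coord_fun_pred j).
Definition last_fun : suspension R k := MkC0 last_fun_pred.

Lemma sphere_ext_coord j x : sqnorm x = 1 ->
  sphere_ext (coord_fun j) x = x 0 (lift ord_max j).
Proof.
move=> x1; have rx : radius x = 1 by rewrite /radius x1 sqrtr1.
rewrite /sphere_ext rx; case: ifPn => lt.
  rewrite /= sqnorm_stereo ?rx // mxE rx.
  have d0 : 1 - x 0 ord_max != 0 by rewrite subr_eq0 gt_eqF.
  by field; rewrite d0 /=; have -> : 1 - x 0 ord_max + (1 + x 0 ord_max) = 2 by ring.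
have xm : x 0 ord_max = 1.
  by apply/eqP; rewrite eq_le last_le_sqnorm //= leNgt.
move: x1; rewrite sqnorm_split xm expr1n -[RHS]addr0 => /addrI/psumr_eq0P h.
apply/esym/eqP; rewrite -sqrf_eq0; apply/eqP/h => // i _; exact: sqr_ge0.
Qed.

Lemma sphere_ext_last x : sqnorm x = 1 -> sphere_ext last_fun x = 1 - x 0 ord_max.
Proof.
move=> x1; have rx : radius x = 1 by rewrite /radius x1 sqrtr1.
rewrite /sphere_ext rx; case: ifPn => lt.
  rewrite /= sqnorm_stereo ?rx //.
  have d0 : 1 - x 0 ord_max != 0 by rewrite subr_eq0 gt_eqF.
  by field; rewrite d0 /=; have -> : 1 - x 0 ord_max + (1 + x 0 ord_max) = 2 by ring.
have -> : x 0 ord_max = 1.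
  by apply/eqP; rewrite eq_le last_le_sqnorm //= leNgt.
by rewrite subrr.
Qed.
End Stereographic.

(** * The negative answer to the first question *)

Section Question1.
Variables (R : realType) (F : conjScalarType R).

(** The squared norms of the H_s v add up to that of v. *)
Lemma sum_sqr_contraction n d (H : 'I_d -> mxalg F n) r :
  (forall r, star (H r) = H r) -> \sum_r H r ⋆ H r = (1%:M : 'M[F]_n) -> `‖H r‖ <= 1.
Proof.
move=> saH sqH; apply: opnorm_le => // v; rewrite mul1r.
rewrite -ler_sqr ?nnegrE ?vnorm_ge0 //.
have <- : \sum_s vnorm ((H s : 'M[F]_n) *m v) ^+ 2 = vnorm v ^+ 2.
  apply: (@scalerA_inj R F); rewrite scaler_suml -adjmx_dotE -[X in adjmx v *m X]mul1mx -sqH.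
  rewrite mulmx_suml mulmx_sumr summxE; apply: eq_bigr => s _.
  have aH : adjmx (H s : 'M[F]_n) = H s := saH s.
  by rewrite -adjmx_dotE adjmxM aH -!mulmxA.
by rewrite (bigD1 r) //= lerDl sumr_ge0 // => s _; rewrite sqr_ge0.
Qed.

Lemma obstructed_question1 d : obstructed d F -> ~ question1 d F.
Proof.
move=> [eps e0 obs] q1; have [delta d0 lift] := q1 eps e0.
have [n [n0 [H [saH sqH comH far]]]] := obs delta d0.
have cH r : selfadjoint_contraction (H r) by split=> //; exact: sum_sqr_contraction.
have [K [cK nearK comK]] := lift n n0 H cH comH.
by apply: (far K) => // r; have [] := cK r.
Qed.
End Question1.

(** * Letters built from a family with sum of squares 1 *)

Section Letters.
Variables (R : realType) (A : starAlgType R) (one : A).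
Hypothesis one_l : forall a, one ⋆ a = a.
Hypothesis one_r : forall a, a ⋆ one = a.
Variables (d : nat) (H : 'I_d -> A).
Hypothesis H_star : forall r, star (H r) = H r.
Hypothesis H_sqr : \sum_r H r ⋆ H r = one.

Definition letter_sign (b : bool) : R := (-1) ^+ b.
(** The squares of 1 + H_r and 1 - H_r over all r add up to 2 d + 2, which fixes the factor. *)
Definition letter (j : bool * 'I_d) : A :=
  (Num.sqrt (d.+1 * 2)%:R)^-1 *: (one + letter_sign j.1 *: H j.2).
(** Scaled so that the mean coordinate of one letter is H_r: the difference of the squares of 1 +
    H_r and 1 - H_r is 4 H_r. *)
Definition letter_coord (r : 'I_d) (j : bool * 'I_d) : R :=
  letter_sign j.1 * (d.+1%:R / 2) *+ (j.2 == r).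

Lemma letter_star j : star (letter j) = letter j.
Proof. by rewrite /letter starZ starD starZ H_star star_one. Qed.

Lemma letter_sqr j : letter j ⋆ letter j =
  (d.+1 * 2)%:R^-1 *: (one + H j.2 ⋆ H j.2 + (2 * letter_sign j.1) *: H j.2).
Proof.
rewrite /letter amulZl amulZr scalerA -invfM -expr2 sqr_sqrtr ?ler0n //.
congr (_ *: _); rewrite amulDl !amulDr !amulZl !amulZr !one_l one_r scalerA.
have -> : letter_sign j.1 * letter_sign j.1 = 1 by rewrite /letter_sign -expr2 sqrr_sign.
move: (H j.2) (_ ⋆ _) (letter_sign _) => X Y t.
by rewrite scale1r mulrDl !mul1r scalerDl -addrA -[RHS]addrA; congr (_ + _);
  rewrite [RHS]addrC addrA.
Qed.

Lemma sum_letter (V : nmodType) (G : bool * 'I_d -> V) :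
  \sum_j G j = \sum_r (G (true, r) + G (false, r)).
Proof.
rewrite (eq_bigr (fun j => G (j.1, j.2))) => [|[]//].
rewrite -(pair_bigA _ (fun b r => G (b, r))) /= exchange_big /=.
by apply: eq_bigr => r _; rewrite big_bool.
Qed.

Lemma letter_sqr_sum : (0 < d)%N -> \sum_j letter j ⋆ letter j = one.
Proof.
move=> d0; rewrite sum_letter.
transitivity (\sum_r d.+1%:R^-1 *: (one + H r ⋆ H r)).
  apply: eq_bigr => r _; rewrite !letter_sqr /letter_sign /= expr0 expr1.
  rewrite -scalerDr addrACA -scalerDl mulrN1 mulr1 addNr scale0r addr0.
  move: (one + _) => Y; have -> : Y + Y = 2 *: Y by rewrite scaler_nat mulr2n.
  by rewrite scalerA natrM invfM -mulrA mulVf ?mulr1 // pnatr_eq0.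
rewrite -scaler_sumr big_split /= H_sqr sumr_const card_ord -mulrSr.
have -> : one *+ d.+1 = d.+1%:R *: one by rewrite scaler_nat.
by rewrite scalerA mulVf ?scale1r // pnatr_eq0.
Qed.

Lemma letter_mean_coord r : letter_mean letter (letter_coord r) = H r.
Proof.
rewrite /letter_mean sum_letter (bigD1 r) //= [X in _ + X]big1 ?addr0 => [|t tr]; last first.
  by rewrite /letter_coord /= (negbTE tr) !mulr0n !scale0r addr0.
rewrite /letter_coord /= eqxx !mulr1n !letter_sqr /letter_sign /= expr0 expr1.
rewrite mulN1r scaleNr mul1r mulr1 mulrN1 !scalerA addrC -scalerBr.
rewrite scaleNr opprD opprK addrACA subrr add0r -scalerDl !scalerA.
rewrite -[RHS]scale1r; congr (_ *: _); rewrite natrM.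
have d1 : d.+1%:R != 0 :> R by rewrite pnatr_eq0.
by field.
Qed.

Lemma letter_comm i j : (forall r t, H r ⋆ H t = H t ⋆ H r) ->
  letter i ⋆ letter j = letter j ⋆ letter i.
Proof.
move=> HC; rewrite /letter !amulZl !amulZr; congr (_ *: (_ *: _)).
rewrite !amulDl !amulDr !amulZl !amulZr !one_l !one_r HC !scalerA.
by rewrite addrACA [in RHS]mulrC.
Qed.

Lemma wordpoint_cube m w r : (0 < m)%N -> w \in words _ m ->
  `|wordpoint letter_coord m w r| <= d.+1%:R / 2.
Proof.
move=> m0 /size_words wm; rewrite /wordpoint normrM gtr0_norm ?invr_gt0 ?ltr0n //.
rewrite ler_pdivrMl ?ltr0n // -wm; elim: (w) => [|j v IH].
  by rewrite /wordsum big_nil normr0 mul0r.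
rewrite /wordsum big_cons (le_trans (ler_normD _ _)) // -[size _]add1n natrD mulrDl mul1r.
apply: lerD => //; rewrite /letter_coord; case: eqP => _; rewrite ?mulr0n ?normr0 ?divr_ge0 //.
by rewrite mulr1n normrM normr_sign mul1r ger0_norm // divr_ge0.
Qed.
End Letters.

(** * Homomorphisms and null sequences *)

Section StarHom.
Variables (R : realType) (A B : starAlgType R) (phi : A -> B).
Hypothesis phiP : is_star_hom phi.

Lemma star_homD a b : phi (a + b) = phi a + phi b.
Proof. by case: phiP => lin _ _; rewrite -[a]scale1r lin !scale1r. Qed.

Lemma star_hom0 : phi 0 = 0.
Proof. by apply: (addrI (phi 0)); rewrite -star_homD !addr0. Qed.

Lemma star_homZ t a : phi (t *: a) = t *: phi a.
Proof. by case: phiP => lin _ _; rewrite -[t *: a]addr0 lin star_hom0 addr0. Qed.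

Lemma star_homM a b : phi (a ⋆ b) = phi a ⋆ phi b.
Proof. by case: phiP. Qed.

Lemma star_hom_star a : phi (star a) = star (phi a).
Proof. by case: phiP. Qed.

Lemma star_hom_sum I (r : seq I) (P : pred I) (G : I -> A) :
  phi (\sum_(i <- r | P i) G i) = \sum_(i <- r | P i) phi (G i).
Proof. exact: (big_morph _ star_homD star_hom0). Qed.

Lemma star_hom_wordsq one (J : finType) (s : J -> A) w :
  phi (wordsq one s w) = wordsq (phi one) (phi \o s) w.
Proof.
rewrite /wordsq star_homM star_hom_star.
suff -> : phi (wordprod one s w) = wordprod (phi one) (phi \o s) w by [].
by elim: w => [//|j w IH] /=; rewrite star_homM IH.
Qed.
End StarHom.

Section SequenceAlgebraFacts.
Variables (R : realType) (B : nat -> normedStarAlgType R).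

Lemma prod_sumE I (r : seq I) (P : pred I) (G : I -> prod_alg B) i :
  (\sum_(j <- r | P j) G j) i = \sum_(j <- r | P j) G j i.
Proof. exact: (big_morph (fun s : prod_alg B => s i) (fun _ _ => erefl) erefl). Qed.

Lemma null_cvg (s : prod_alg B) : s \in @null_ideal R B -> `‖s i‖ @[i --> \oo] --> (0 : R).
Proof. by rewrite inE. Qed.

Lemma pi_eq_null (s u : prod_alg B) : corona_pi s = corona_pi u -> s - u \in @null_ideal R B.
Proof. by move/corona_piP. Qed.

(* A modulus of smallness that is only uniform up to every fixed error [e]. *)
Lemma null_ideal_le (s : prod_alg B) :
  (forall e : R, 0 < e -> exists C, forall i, `‖s i‖ <= e + C / i.+1%:R) -> s \in @null_ideal R B.
Proof.
move=> sC; rewrite inE /=; apply/(@cvgr0Pnorm_le R R) => e e0.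
have e2 : 0 < e / 2 by rewrite divr_gt0.
have [C Ce] := sC (e / 2) e2.
have Cc : (C / i.+1%:R) @[i --> \oo] --> (0 : R).
  by rewrite -[X in _ --> X](mulr0 C); exact: cvgMl_tmp (@cvg_harmonic R).
near=> i; rewrite ger0_norm ?anorm_ge0 //.
apply: le_trans (Ce i) _; rewrite [leRHS]splitr lerD2l ltW //.
by near: i; apply: (cvgr_lt _ Cc); rewrite divr_gt0.
Unshelve. all: by end_near. Qed.
End SequenceAlgebraFacts.

(** * Approximate identities for words in the algebra of bounded sequences *)

Section ApproximateRepresentation.
Variables (R : realType) (F : conjScalarType R) (k : nat) (n : nat -> nat).
Variable H : forall i, 'I_k.+1 -> mxalg F (n i).
Hypothesis H_star : forall i r, star (H i r) = H i r.
Hypothesis H_sqr : forall i, \sum_r H i r ⋆ H i r = (1%:M : 'M[F]_(n i)).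
Hypothesis H_comm : forall i r s, `‖acomm (H i r) (H i s)‖ <= i.+1%:R^-1.
Notation P := (prod_alg (mxalg_seq F n)).
Notation pi := (@corona_pi R (mxalg_seq F n)).
Notation J := (prod bool 'I_k.+1).
Notation words := (words J).

Lemma anorm_unit l : `‖((1%:M : 'M[F]_l) : mxalg F l)‖ <= 1.
Proof. by apply: opnorm_le => // v; rewrite mul1mx mul1r. Qed.

Lemma unit_bounded : exists C : R, forall i, `‖((1%:M : 'M[F]_(n i)) : mxalg_seq F n i)‖ <= C.
Proof. by exists 1 => i; exact: anorm_unit. Qed.
Definition unit_seq : P := MkProd unit_bounded.
Notation one := unit_seq.

Lemma gen_bounded r : exists C : R, forall i, `‖(H i r : mxalg_seq F n i)‖ <= C.
Proof. by exists 1 => i; apply: sum_sqr_contraction. Qed.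
Definition gen_seq r : P := MkProd (gen_bounded r).

Lemma unit_l (s : P) : one ⋆ s = s.
Proof. by apply: prod_algP => i; exact: mul1mx. Qed.
Lemma unit_r (s : P) : s ⋆ one = s.
Proof. by apply: prod_algP => i; exact: mulmx1. Qed.
Lemma gen_star r : star (gen_seq r) = gen_seq r.
Proof. by apply: prod_algP => i; exact: H_star. Qed.
Lemma gen_sqr : \sum_r gen_seq r ⋆ gen_seq r = one.
Proof. by apply: prod_algP => i; rewrite prod_sumE; exact: H_sqr. Qed.

Notation s := (letter one gen_seq).
Notation E := (wordsq one s).
Notation c := (letter_coord R).
Notation x := (wordpoint (@letter_coord R k.+1)).

Let pi_hom := @corona_pi_star_hom R (mxalg_seq F n).
Let pione_l y : pi one ⋆ y = y.
Proof. by have [u <-] := corona_pi_surj y; rewrite -(star_homM pi_hom) unit_l. Qed.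
Let pione_r y : y ⋆ pi one = y.
Proof. by have [u <-] := corona_pi_surj y; rewrite -(star_homM pi_hom) unit_r. Qed.
Let h r := pi (gen_seq r).
Let hstar r : star (h r) = h r.
Proof. by rewrite /h -(star_hom_star pi_hom) gen_star. Qed.
Let hsqr : \sum_r h r ⋆ h r = pi one.
Proof.
by rewrite -gen_sqr (star_hom_sum pi_hom); apply: eq_bigr => r _; rewrite (star_homM pi_hom).
Qed.
Let hcomm r t : h r ⋆ h t = h t ⋆ h r.
Proof.
rewrite /h -!(star_homM pi_hom); apply/corona_piP; apply: null_ideal_le => e e0.
exists 1 => i; rewrite mul1r; apply: le_trans (H_comm i r t) _.
by rewrite lerDr ltW.
Qed.
Let sigma := letter (pi one) h.
Let pi_letter j : pi (s j) = sigma j.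
Proof. by rewrite /letter !(star_homZ pi_hom, star_homD pi_hom). Qed.
Let pi_wordsq w : pi (E w) = wordsq (pi one) sigma w.
Proof.
rewrite (star_hom_wordsq pi_hom); congr (wordsq _ _ w).
by apply: funext => j; exact: pi_letter.
Qed.
Let sigma_star j : star (sigma j) = sigma j := letter_star pione_r hstar j.
Let sigma_sum : \sum_j sigma j ⋆ sigma j = pi one := letter_sqr_sum pione_l pione_r hsqr isT.
Let sigma_comm i j : sigma i ⋆ sigma j = sigma j ⋆ sigma i := letter_comm pione_l pione_r i j hcomm.

(** The images in the quotient commute, so the identities proved for commuting letters hold there
    and, in the sequence algebra, up to null sequences. The next two lemmas have the same source. *)
Lemma wordsq_cat_null w v : E w ⋆ E v - E (w ++ v) \in @null_ideal R (mxalg_seq F n).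
Proof.
by apply: pi_eq_null; rewrite (star_homM pi_hom) !pi_wordsq wordsq_cat.
Qed.

Lemma wordpoint_null m r : (0 < m)%N ->
  \sum_(w <- words m) x m w r *: E w - gen_seq r \in @null_ideal R (mxalg_seq F n).
Proof.
move=> m0; apply: pi_eq_null; rewrite (star_hom_sum pi_hom).
under eq_bigr do rewrite (star_homZ pi_hom) pi_wordsq.
rewrite -/(h r) -[RHS](letter_mean_coord pione_l pione_r h r).
exact: (word_mean_point pione_l pione_r sigma_star sigma_sum sigma_comm).
Qed.

Lemma defect_null : exists z1 z2 : P, forall m, (0 < m)%N ->
  \sum_(w <- words m) \sum_(v <- words m) sphere_defect (x m w) (x m v) *: E (w ++ v)
  - (m%:R^-1 *: z1 + m%:R^-1 ^+ 2 *: z2) \in @null_ideal R (mxalg_seq F n).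
Proof.
have hsum : \sum_r letter_mean sigma (letter_coord R r) ⋆ letter_mean sigma (letter_coord R r)
    = pi one.
  by rewrite -[RHS]hsqr; apply: eq_bigr => r _; rewrite (letter_mean_coord pione_l pione_r h r).
have [y1 [y2 y12]] := mean_defect pione_l pione_r sigma_star sigma_sum sigma_comm hsum.
have [z1 z1y] := corona_pi_surj y1; have [z2 z2y] := corona_pi_surj y2.
exists z1, z2 => m m0; apply: pi_eq_null.
rewrite (star_homD pi_hom) !(star_homZ pi_hom) z1y z2y -y12 // (star_hom_sum pi_hom).
apply: eq_bigr => w _; rewrite (star_hom_sum pi_hom); apply: eq_bigr => v _.
by rewrite (star_homZ pi_hom) pi_wordsq.
Qed.

(** For a fixed length m there are finitely many words, so finitely many null sequences are made
    small at one index. *)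
Lemma good_index (z1 z2 : P) m : (0 < m)%N ->
  (forall m, (0 < m)%N ->
    \sum_(w <- words m) \sum_(v <- words m) sphere_defect (x m w) (x m v) *: E (w ++ v)
    - (m%:R^-1 *: z1 + m%:R^-1 ^+ 2 *: z2) \in @null_ideal R (mxalg_seq F n)) ->
  exists i,
  [/\ \sum_(w <- words m) \sum_(v <- words m) `‖(E w ⋆ E v - E (w ++ v)) i‖ <= m%:R^-1,
      `‖(\sum_(w <- words m) \sum_(v <- words m) sphere_defect (x m w) (x m v) *: E (w ++ v)
        - (m%:R^-1 *: z1 + m%:R^-1 ^+ 2 *: z2)) i‖ <= m%:R^-1
    & forall r, `‖(\sum_(w <- words m) x m w r *: E w - gen_seq r) i‖ <= m%:R^-1].
Proof.
move=> m0 defect0.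
pose e1 i := \sum_(w <- words m) \sum_(v <- words m) `‖(E w ⋆ E v - E (w ++ v)) i‖.
pose e2 i := `‖(\sum_(w <- words m) \sum_(v <- words m) sphere_defect (x m w) (x m v) *: E (w ++ v)
        - (m%:R^-1 *: z1 + m%:R^-1 ^+ 2 *: z2)) i‖.
pose e3 r i := `‖(\sum_(w <- words m) x m w r *: E w - gen_seq r) i‖.
have c1 : e1 i @[i --> \oo] --> (0 : R).
  have -> : 0 = \sum_(w <- words m) \sum_(v <- words m) 0 :> R.
    by rewrite big1 // => w _; rewrite big1.
  apply: cvg_sum_seq => w; apply: cvg_sum_seq => v.
  by apply: null_cvg; exact: wordsq_cat_null.
have c2 : e2 i @[i --> \oo] --> (0 : R) by apply: null_cvg; exact: defect0.
have c3 r : e3 r i @[i --> \oo] --> (0 : R) by apply: null_cvg; exact: wordpoint_null.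
have mp : 0 < m%:R^-1 :> R by rewrite invr_gt0 ltr0n.
have n1 : \forall i \near \oo, e1 i < m%:R^-1 by apply: (cvgr_lt _ c1).
have n2 : \forall i \near \oo, e2 i < m%:R^-1 by apply: (cvgr_lt _ c2).
have n3 : \forall i \near \oo, forall r, e3 r i < m%:R^-1.
  by apply: filter_forall => r; apply: (cvgr_lt _ (c3 r)).
have [i [[i1 i2] i3]] := filter_ex (filterI (filterI n1 n2) n3).
by exists i; split; [exact: ltW i1|exact: ltW i2|move=> r; exact: ltW (i3 r)].
Qed.

Notation mean := (word_mean one s).
Notation defect_mean m :=
  (\sum_(w <- words m) \sum_(v <- words m) sphere_defect (x m w) (x m v) *: E (w ++ v)).

Lemma mean_pairs m (phi : seq J -> R) :
  mean m phi = \sum_(w <- words m) \sum_(v <- words m) phi w *: E (w ++ v).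
Proof.
apply: eq_bigr => w _; rewrite -scaler_sumr; congr (_ *: _); apply/esym.
exact: (sum_wordsq_cat unit_l unit_r (letter_star unit_r gen_star)
  (letter_sqr_sum unit_l unit_r gen_sqr isT)).
Qed.

(** Domination by e + C defect; since the E(w ++ v) sum to 1, the dominating operator is e plus C
    times the mean defect. *)
Lemma pair_mean_le i m (G : seq J -> seq J -> R) (e C : R) :
  0 <= e -> 0 <= C ->
  (forall w v, w \in words m -> v \in words m ->
    `|G w v| <= e + C * sphere_defect (x m w) (x m v)) ->
  `‖(\sum_(w <- words m) \sum_(v <- words m) G w v *: E (w ++ v)) i‖ <=
  e + C * `‖(defect_mean m) i‖.
Proof.
move=> e0 C0 GC.
pose X (p : seq J * seq J) : mxalg F (n i) := wordprod one s (p.1 ++ p.2) i.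
pose ps := [seq (w, v) | w <- words m, v <- words m].
have pairE (f : seq J -> seq J -> R) :
    (\sum_(w <- words m) \sum_(v <- words m) f w v *: E (w ++ v)) i =
    \sum_(p <- ps) f p.1 p.2 *: (X p ⋆ star (X p)) :> mxalg F (n i).
  rewrite big_allpairs_dep prod_sumE; apply: eq_bigr => w _.
  by rewrite prod_sumE.
have -> : e + C * `‖(defect_mean m) i‖ = e * 1 + C * `‖(defect_mean m) i‖ by rewrite mulr1.
apply: le_trans (_ : `‖(e *: one + C *: defect_mean m) i‖ <= _); last first.
  apply: le_trans (anormD _ _) _; apply: lerD.
    have := anormZ e (one i); rewrite ger0_norm // => ->.
    by rewrite ler_wpM2l // anorm_unit.
  by have := anormZ C ((defect_mean m) i); rewrite ger0_norm // => ->.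
have -> : e *: one + C *: defect_mean m = \sum_(w <- words m) \sum_(v <- words m)
    (e + C * sphere_defect (x m w) (x m v)) *: E (w ++ v).
  have -> : e *: one = mean m (fun=> e * 1).
    by rewrite word_meanZ word_mean1 //; [exact: unit_l|exact: unit_r|
      exact: (letter_star unit_r gen_star)|exact: (letter_sqr_sum unit_l unit_r gen_sqr isT)].
  rewrite mean_pairs scaler_sumr -big_split; apply: eq_bigr => w _ /=.
  rewrite scaler_sumr -big_split; apply: eq_bigr => v _ /=.
  by rewrite mulr1 scalerA -scalerDl.
rewrite !pairE; apply: positive_sum_dominated_in => p.
by case/allpairsP => -[w v] [wm vm ->]; exact: GC.
Qed.

(** The error splits into the failure of E(w) E(v) = E(w ++ v) and the change of psi from one sample
    point to the other, the latter bounded by the defect. *)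
Lemma mean_mul_le i m (phi psi : seq J -> R) (a b e C : R) :
  0 <= e -> 0 <= C -> 0 <= a -> 0 <= b ->
  (forall w, `|phi w| <= a) -> (forall w, `|psi w| <= b) ->
  (forall w v, w \in words m -> v \in words m ->
    `|phi w * psi v - phi w * psi w| <= e + C * sphere_defect (x m w) (x m v)) ->
  `‖(mean m phi ⋆ mean m psi - mean m (fun w => phi w * psi w)) i‖ <=
  a * b * (\sum_(w <- words m) \sum_(v <- words m) `‖(E w ⋆ E v - E (w ++ v)) i‖)
  + (e + C * `‖(defect_mean m) i‖).
Proof.
move=> e0 C0 a0 b0 pa pb pC.
have -> : mean m phi ⋆ mean m psi - mean m (fun w => phi w * psi w) =
    \sum_(w <- words m) \sum_(v <- words m) (phi w * psi v) *: (E w ⋆ E v - E (w ++ v))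
    + \sum_(w <- words m) \sum_(v <- words m) (phi w * psi v - phi w * psi w) *: E (w ++ v).
  rewrite (mean_pairs m (fun w => phi w * psi w)) {1}/word_mean amul_suml -sumrB -big_split; apply: eq_bigr => w _ /=.
  rewrite /word_mean amul_sumr  -sumrB -big_split /=; apply: eq_bigr => v _.
  by rewrite amulZl amulZr scalerA scalerBr scalerBl addrA subrK.
apply: le_trans (anormD _ _) _; apply: lerD; last exact: pair_mean_le.
rewrite prod_sumE mulr_sumr.
elim/big_ind2: _ => [|y1 t1 y2 t2 h1 h2|w _]; first by rewrite anorm0.
  by apply: le_trans (anormD _ _) _; exact: lerD.
rewrite prod_sumE mulr_sumr.
elim/big_ind2: _ => [|y1 t1 y2 t2 h1 h2|v _]; first by rewrite anorm0.
  by apply: le_trans (anormD _ _) _; exact: lerD.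
have := anormZ (phi w * psi v) ((E w ⋆ E v - E (w ++ v)) i) => ->.
by rewrite ler_wpM2r ?anorm_ge0 // normrM ler_pM.
Qed.

Lemma mean_coord_le i m r (phi : seq J -> R) (a b e C : R) :
  0 <= e -> 0 <= C ->
  (forall w v, w \in words m -> v \in words m ->
    `|phi w - (a + b * x m w r)| <= e + C * sphere_defect (x m w) (x m v)) ->
  `‖(mean m phi - (a *: one + b *: gen_seq r)) i‖ <=
  (e + C * `‖(defect_mean m) i‖) +
  `|b| * `‖(\sum_(w <- words m) x m w r *: E w - gen_seq r) i‖.
Proof.
move=> e0 C0 pC.
have -> : mean m phi - (a *: one + b *: gen_seq r) =
    mean m (fun w => phi w - (a + b * x m w r))
    + b *: (\sum_(w <- words m) x m w r *: E w - gen_seq r).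
  have mean1 : mean m (fun=> 1) = one.
    by rewrite word_mean1 //; [exact: unit_l|exact: unit_r|
      exact: (letter_star unit_r gen_star)|exact: (letter_sqr_sum unit_l unit_r gen_sqr isT)].
  have -> : mean m (fun w => phi w - (a + b * x m w r)) =
      mean m phi - a *: one - b *: mean m (fun w => x m w r).
    transitivity (mean m (fun w => phi w + (- a) * 1 + (- b) * x m w r)).
      by apply: eq_word_mean => w; ring.
    by rewrite !word_meanD !word_meanZ mean1 !scaleNr.
  by rewrite scalerBr addrA subrK opprD addrA.
apply: le_trans (anormD _ _) _; apply: lerD.
  by rewrite mean_pairs; apply: pair_mean_le.
by rewrite (anormZ b ((\sum_(w <- words m) x m w r *: E w - gen_seq r) i)).
Qed.
End ApproximateRepresentation.

Lemma suspensionC (R : realType) k (f g : suspension R k) : f ⋆ g = g ⋆ f.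
Proof. by apply/val_inj/funext => y; exact: mulrC. Qed.

Lemma star_mean (R : realType) (A : starAlgType R) (one : A) (J : finType) (s : J -> A) m phi :
  star (word_mean one s m phi) = word_mean one s m phi.
Proof.
have star0 : star (0 : A) = 0 by rewrite -(scale0r (0 : A)) starZ !scale0r.
rewrite /word_mean (big_morph _ (@starD R A) star0); apply: eq_bigr => w _.
by rewrite starZ /wordsq starM starK.
Qed.

(** * Continuous functions on the sphere, up to the defect *)

Section SphereEstimates.
Variables (R : realType) (k : nat).
Implicit Types (f g : suspension R k).

Let fst_near (x : 'rV[R]_k.+1) : z.1 @[z --> (x, x)] --> x.
Proof. exact: cvg_fst. Qed.
Let snd_near (x : 'rV[R]_k.+1) : z.2 @[z --> (x, x)] --> x.
Proof. exact: cvg_snd. Qed.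

Lemma sphere_ext_mul_defect f g (B e : R) : 0 < e -> exists2 C, 0 <= C &
  forall x y : 'rV[R]_k.+1, cube B x -> cube B y ->
  `|sphere_ext f x * sphere_ext g y - sphere_ext f x * sphere_ext g x| <= e + C * defect x y.
Proof.
move=> e0; have [M M0 fM] := sphere_ext_bounded f; have [N N0 gN] := sphere_ext_bounded g.
apply: (@defect_dominates R k.+1 B (M * N + M * N)
  (fun x y => sphere_ext f x * sphere_ext g y - sphere_ext f x * sphere_ext g x)) => //.
  move=> x y _ _; apply: le_trans (ler_normB _ _) _; rewrite !normrM.
  by apply: lerD; rewrite ler_pM.
move=> x x1 d d0.
have fx : sphere_ext f z.1 @[z --> (x, x)] --> sphere_ext f x.
  exact (cvg_comp _ _ (@fst_near x) (sphere_ext_cvg (f := f) x1)).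
have gx1 : sphere_ext g z.1 @[z --> (x, x)] --> sphere_ext g x.
  exact (cvg_comp _ _ (@fst_near x) (sphere_ext_cvg (f := g) x1)).
have gx2 : sphere_ext g z.2 @[z --> (x, x)] --> sphere_ext g x.
  exact (cvg_comp _ _ (@snd_near x) (sphere_ext_cvg (f := g) x1)).
have := cvgB (FF := nbhs_filter (x, x)) (cvgM (FF := nbhs_filter (x, x)) fx gx2)
  (cvgM (FF := nbhs_filter (x, x)) fx gx1).
by rewrite subrr => /(@cvgr0Pnorm_le R R _ _ (nbhs_filter (x, x))); apply.
Qed.

Lemma sphere_ext_affine_defect f (r : 'I_k.+1) (a b B e : R) : 0 < e ->
  (forall x : 'rV[R]_k.+1, sqnorm x = 1 -> sphere_ext f x = a + b * x 0 r) ->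
  exists2 C, 0 <= C & forall x y : 'rV[R]_k.+1, cube B x -> cube B y ->
  `|sphere_ext f x - (a + b * x 0 r)| <= e + C * defect x y.
Proof.
move=> e0 fE; have [M M0 fM] := sphere_ext_bounded f.
apply: (@defect_dominates R k.+1 B (M + (`|a| + `|b| * B))
  (fun x y => sphere_ext f x - (a + b * x 0 r))) => //.
  move=> x y xB _; apply: le_trans (ler_normB _ _) _; apply: lerD => //.
  apply: le_trans (ler_normD _ _) _; rewrite lerD2l normrM ler_wpM2l //; exact: xB.
move=> x x1 d d0.
have fx : sphere_ext f z.1 @[z --> (x, x)] --> sphere_ext f x.
  exact (cvg_comp _ _ (@fst_near x) (sphere_ext_cvg (f := f) x1)).
have rx : (z.1 : 'rV[R]_k.+1) 0 r @[z --> (x, x)] --> x 0 r.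
  exact (cvg_comp _ _ (@fst_near x) (@coord_continuous R 1 k.+1 0 r x)).
have := cvgB (FF := nbhs_filter (x, x)) fx (cvgD (FF := nbhs_filter (x, x))
  (cvg_cst a (FF := nbhs_filter (x, x)))
  (cvgM (FF := nbhs_filter (x, x)) (cvg_cst b (FF := nbhs_filter (x, x))) rx)).
by rewrite -fE // subrr => /(@cvgr0Pnorm_le R R _ _ (nbhs_filter (x, x))); apply.
Qed.
End SphereEstimates.

(** * The homomorphism into the quotient and the consequence of a lift *)

Section Representation.
Variables (R : realType) (F : conjScalarType R) (k : nat) (n kk : nat -> nat).
Variable H : forall i, 'I_k.+1 -> mxalg F (n i).
Hypothesis H_star : forall i r, star (H i r) = H i r.
Hypothesis H_sqr : forall i, \sum_r H i r ⋆ H i r = (1%:M : 'M[F]_(n i)).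
Notation P := (prod_alg (mxalg_seq F n)).
Notation J := (prod bool 'I_k.+1).
Notation words := (words J).
Notation gen := (gen_seq H_star H_sqr).
Notation one := (unit_seq F n).
Notation s := (letter one gen).
Notation E := (wordsq one s).
Notation mean := (word_mean one s).
Notation x := (wordpoint (@letter_coord R k.+1)).
Notation defect_mean m :=
  (\sum_(w <- words m) \sum_(v <- words m) sphere_defect (x m w) (x m v) *: E (w ++ v)).

Variable D : R.
Hypothesis D0 : 0 <= D.
Hypothesis cat_small : forall m, \sum_(w <- words m.+1) \sum_(v <- words m.+1)
  `‖(E w ⋆ E v - E (w ++ v)) (kk m)‖ <= m.+1%:R^-1.
Hypothesis defect_small : forall m, `‖(defect_mean m.+1) (kk m)‖ <= D / m.+1%:R.
Hypothesis gen_small : forall m r,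
  `‖(\sum_(w <- words m.+1) x m.+1 w r *: E w - gen r) (kk m)‖ <= m.+1%:R^-1.
Notation B' := (mxalg_seq F (n \o kk)).
Notation P' := (prod_alg B').

Definition point m (w : seq J) : 'rV[R]_k.+1 := \row_r x m w r.

Lemma point_cube m w : (0 < m)%N -> w \in words m -> cube (k.+2%:R / 2) (point m w).
Proof. by move=> m0 wm r; rewrite mxE; exact: wordpoint_cube. Qed.

Lemma defect_point m w v : defect (point m w) (point m v) = sphere_defect (x m w) (x m v).
Proof. by congr sphere_defect; apply/funext => r; rewrite mxE. Qed.

(** The Bernstein operator of f; at position m it is used with words of length m+1 and evaluated at
    the index [kk m]. *)
Definition fun_mean (f : suspension R k) m : P := mean m (fun w => sphere_ext f (point m w)).

Lemma fun_mean_bounded f : exists C : R, forall m, `‖(fun_mean f m.+1 (kk m) : B' m)‖ <= C.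
Proof.
have [M M0 fM] := sphere_ext_bounded f; exists M => m.
have h (w v : seq J) : w \in words m.+1 -> v \in words m.+1 ->
    `|sphere_ext f (point m.+1 w)| <= M + 0 * sphere_defect (x m.+1 w) (x m.+1 v).
  by move=> _ _; rewrite mul0r addr0.
have := @pair_mean_le R F k n H H_star H_sqr (kk m) m.+1 _ M 0 M0 (lexx 0) h.
by rewrite -mean_pairs mul0r addr0.
Qed.

Definition fun_seq f : P' := MkProd (fun_mean_bounded f).

Lemma gen'_bounded r : exists C : R, forall m, `‖(H (kk m) r : B' m)‖ <= C.
Proof.
exists 1 => m.
exact: (@sum_sqr_contraction R F _ _ (H (kk m)) r (H_star (kk m)) (H_sqr (kk m))).
Qed.
Definition gen' r : P' := MkProd (gen'_bounded r).

Lemma fun_seq_affine f r a b :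
  (forall y : 'rV[R]_k.+1, sqnorm y = 1 -> sphere_ext f y = a + b * y 0 r) ->
  fun_seq f - (a *: unit_seq F (n \o kk) + b *: gen' r) \in @null_ideal R B'.
Proof.
move=> fE; apply: null_ideal_le => e e0.
have [C C0 fC] := @sphere_ext_affine_defect R k f r a b (k.+2%:R / 2) e e0 fE.
exists (C * D + `|b|) => m.
apply: le_trans (_ : e + C * `‖(defect_mean m.+1) (kk m)‖ +
  `|b| * `‖(\sum_(w <- words m.+1) x m.+1 w r *: E w - gen r) (kk m)‖ <= _).
  apply: (@mean_coord_le R F k n H H_star H_sqr (kk m) m.+1 r
    (fun w => sphere_ext f (point m.+1 w)) a b e C (ltW e0) C0) => w v wm vm.
  rewrite -defect_point.
  have -> : x m.+1 w r = point m.+1 w 0 r by rewrite mxE.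
  by apply: fC; exact: point_cube.
rewrite -addrA lerD2l mulrDl; apply: lerD; last by rewrite ler_wpM2l.
by rewrite -mulrA ler_wpM2l.
Qed.

Definition rep f : corona B' := corona_pi (fun_seq f).

(** Linearity and compatibility with the involution hold term by term; multiplicativity holds only
    modulo null sequences, by [mean_mul_le]. *)
Lemma rep_star_hom : is_star_hom rep.
Proof.
have pi_hom := @corona_pi_star_hom R B'.
split=> [t f g|f g|f]; rewrite /rep.
- rewrite -(star_homZ pi_hom) -(star_homD pi_hom); congr corona_pi.
  apply: prod_algP => m; rewrite /= /fun_mean.
  have -> : mean m.+1 (fun w => sphere_ext (t *: f + g) (point m.+1 w)) =
      t *: fun_mean f m.+1 + fun_mean g m.+1.
    rewrite -word_meanZ -word_meanD; apply: eq_word_mean => w; exact: sphere_ext_lin.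
  by [].
- rewrite -(star_homM pi_hom); apply/esym/corona_piP; apply: null_ideal_le => e e0.
  have [C C0 fC] := @sphere_ext_mul_defect R k f g (k.+2%:R / 2) e e0.
  have [M M0 fM] := sphere_ext_bounded f; have [N N0 gN] := sphere_ext_bounded g.
  exists (M * N + C * D) => m.
  apply: le_trans (_ : M * N * (\sum_(w <- words m.+1) \sum_(v <- words m.+1)
    `‖(E w ⋆ E v - E (w ++ v)) (kk m)‖) + (e + C * `‖(defect_mean m.+1) (kk m)‖) <= _).
    have -> : (fun_seq f ⋆ fun_seq g - fun_seq (f ⋆ g)) m =
        (fun_mean f m.+1 ⋆ fun_mean g m.+1 -
         mean m.+1 (fun w => sphere_ext f (point m.+1 w) * sphere_ext g (point m.+1 w))) (kk m).
      have -> : mean m.+1 (fun w => sphere_ext f (point m.+1 w) * sphere_ext g (point m.+1 w)) =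
          fun_mean (f ⋆ g) m.+1.
        by apply: eq_word_mean => w; rewrite sphere_ext_mul.
      by [].
    apply: (@mean_mul_le R F k n H H_star H_sqr (kk m) m.+1
      (fun w => sphere_ext f (point m.+1 w)) (fun w => sphere_ext g (point m.+1 w))
      M N e C (ltW e0) C0 M0 N0) => // w v wm vm.
    by rewrite -defect_point; apply: fC; exact: point_cube.
  rewrite addrCA lerD2l mulrDl; apply: lerD; last by rewrite -mulrA ler_wpM2l.
  by rewrite ler_wpM2l // mulr_ge0.
- rewrite -(star_hom_star pi_hom); congr corona_pi; apply: prod_algP => m.
  have h : star (fun_mean f m.+1) = fun_mean f m.+1 by exact: star_mean.
  exact: (esym (congr1 (fun u : P => u (kk m)) h)).
Qed.

Lemma lift_commuting (psi : suspension R k -> P') : is_star_hom psi ->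
  rep = @corona_pi R B' \o psi ->
  exists K : 'I_k.+1 -> P',
  [/\ forall r, star (K r) = K r, forall r t, K r ⋆ K t = K t ⋆ K r
    & forall r, K r - gen' r \in @null_ideal R B'].
Proof.
move=> psi_hom repE; set u := unit_seq F (n \o kk).
have ul y : u ⋆ y = y by exact: unit_l.
have ur y : y ⋆ u = y by exact: unit_r.
have psi_star f : star (psi f) = psi f by rewrite -(star_hom_star psi_hom).
have psiC f g : psi f ⋆ psi g = psi g ⋆ psi f by rewrite -!(star_homM psi_hom) suspensionC.
have psi_near f : psi f - fun_seq f \in @null_ideal R B'.
  by apply: pi_eq_null; rewrite -/(rep f) repE.
(* K_r is the lift of the coordinate function, except for the last index, where it is 1 minus the
   lift of [last_fun]; t encodes the two cases. *)
pose t (r : 'I_k.+1) : R := if unlift ord_max r is Some _ then 0 else 1.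
pose g r : suspension R k := if unlift ord_max r is Some j then coord_fun R j else last_fun R k.
exists (fun r => t r *: u + (1 - 2 * t r) *: psi (g r)); split=> [r|r q|r].
- by rewrite starD !starZ psi_star (star_one ur).
- have := psiC (g r) (g q); move: (psi (g r)) (psi (g q)) => X Y XY.
  move: (t r) (t q) => a a'.
  rewrite !amulDl !amulDr !amulZl !amulZr !ul !ur XY !scalerA addrACA.
  by rewrite (mulrC a' a) (mulrC a' (1 - _)) (mulrC (1 - 2 * a') a) (mulrC (1 - 2 * a')).
- have gE (y : 'rV[R]_k.+1) : sqnorm y = 1 ->
      sphere_ext (g r) y = t r + (1 - 2 * t r) * y 0 r.
    move=> y1; rewrite /g /t; case: unliftP => [j ->|->].
      by rewrite sphere_ext_coord // add0r mulr0 subr0 mul1r.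
    by rewrite sphere_ext_last //; ring.
  have := rpredD (psi_near (g r)) (fun_seq_affine gE); rewrite -/u addrA subrK.
  rewrite /t; case: unlift => [j|].
    by rewrite mulr0 subr0 !scale0r !add0r !scale1r.
  have -> : 1 - 2 * 1 = -1 :> R by ring.
  by rewrite !scaleN1r !scale1r => h; rewrite addrAC -opprB rpredN.
Qed.
End Representation.

(** A lift gives, at every position, a commuting self-adjoint family whose distance to the
    obstructed family there tends to 0. *)
Theorem obstructed_question2 (R : realType) (F : conjScalarType R) k :
  obstructed k.+1 F -> ~ question2 k.+1 F.
Proof.
move=> [eps e0 obs] q2.
have obs' (i : nat) : exists p : {l & 'I_k.+1 -> mxalg F l},
    [/\ (0 < projT1 p)%N, forall r, star (projT2 p r) = projT2 p r,
        \sum_r projT2 p r ⋆ projT2 p r = (1%:M : 'M[F]_(projT1 p)),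
        forall r s, `‖acomm (projT2 p r) (projT2 p s)‖ <= i.+1%:R^-1
      & forall K : 'I_k.+1 -> mxalg F (projT1 p), (forall r, star (K r) = K r) ->
        (forall r s, acomm (K r) (K s) = 0) ->
        (forall r, `‖K r - projT2 p r‖ <= eps) -> False].
  have [|l [l0 [H [h1 h2 h3 h4]]]] := obs i.+1%:R^-1; first by rewrite invr_gt0.
  by exists (existT _ l H).
have [p pP] := choice obs'.
pose n i := projT1 (p i); pose H i : 'I_k.+1 -> mxalg F (n i) := projT2 (p i).
have H_star i r : star (H i r) = H i r by have [_ h _ _ _] := pP i; exact: h.
have H_sqr i : \sum_r H i r ⋆ H i r = (1%:M : 'M[F]_(n i)) by have [] := pP i.
have H_comm i r s : `‖acomm (H i r) (H i s)‖ <= i.+1%:R^-1.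
  by have [_ _ _ h _] := pP i; exact: h.
have [z1 [z2 defect0]] := @defect_null R F k n H H_star H_sqr H_comm.
(* Diagonal choice: position m uses words of length m+1 at an index where all their errors are at
   most 1 / (m+1). *)
have [kk kkP] := choice (fun m => @good_index R F k n H H_star H_sqr H_comm z1 z2 m.+1
  (ltn0Sn m) defect0).
have [C1 z1C] := prod_bounded z1; have [C2 z2C] := prod_bounded z2.
have C10 : 0 <= C1 by apply: le_trans (z1C 0%N); exact: anorm_ge0.
have C20 : 0 <= C2 by apply: le_trans (z2C 0%N); exact: anorm_ge0.
(* The error at the chosen index, then bounds for the terms of order 1/m and 1/m^2. *)
pose D := 1 + C1 + C2.
have D0 : 0 <= D by rewrite !addr_ge0.
have cat_small m := let: And3 h _ _ := kkP m in h.
have gen_small m := let: And3 _ _ h := kkP m in h.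
have defect_small m := let: And3 _ h _ := kkP m in h.
have defect_bound m : `‖(\sum_(w <- words (prod bool 'I_k.+1) m.+1)
    \sum_(v <- words (prod bool 'I_k.+1) m.+1)
    sphere_defect (wordpoint (@letter_coord R k.+1) m.+1 w)
      (wordpoint (@letter_coord R k.+1) m.+1 v) *:
    wordsq (unit_seq F n) (letter (unit_seq F n) (gen_seq H_star H_sqr)) (w ++ v)) (kk m)‖
    <= D / m.+1%:R.
  have := defect_small m; move: (\sum_(w <- _) _) => Z hZ.
  pose W := m.+1%:R^-1 *: z1 + m.+1%:R^-1 ^+ 2 *: z2.
  have ZE : Z (kk m) = (Z - W) (kk m) + W (kk m) by exact: (esym (subrK _ _)).
  rewrite ZE; apply: le_trans (anormD _ _) _.
  have mi : 0 <= m.+1%:R^-1 :> R by rewrite invr_ge0.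
  have WC : `‖W (kk m)‖ <= m.+1%:R^-1 * C1 + m.+1%:R^-1 * C2.
    apply: le_trans (anormD _ _) _; apply: lerD.
      have := anormZ m.+1%:R^-1 (z1 (kk m)); rewrite ger0_norm // => ->.
      by rewrite ler_wpM2l.
    have := anormZ (m.+1%:R^-1 ^+ 2) (z2 (kk m)); rewrite ger0_norm ?exprn_ge0 // => ->.
    rewrite ler_pM ?exprn_ge0 ?anorm_ge0 // expr2 -[leRHS]mulr1 ler_wpM2l //.
    by rewrite invf_le1 ?ler1n ?ltr0n.
  rewrite mulrC !mulrDr mulr1 -addrA; exact: lerD.
have n0 m : (0 < (n \o kk) m)%N by have [] := pP (kk m).
pose psi := @rep R F k n kk H H_star H_sqr.
have psi_hom : is_star_hom psi.
  exact: (rep_star_hom cat_small defect_bound).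
have [psi' psi'P psiE] := q2 (n \o kk) n0 psi psi_hom.
have [K [K_star K_comm K_near]] := @lift_commuting R F k n kk H H_star H_sqr D
  defect_bound gen_small psi' psi'P psiE.
have Knear : \forall m \near \oo, forall r, `‖(K r - gen' kk H_star H_sqr r) m‖ < eps.
  apply: filter_forall => r.
  by apply: (cvgr_lt _ (null_cvg (K_near r))).
have [m Km] := filter_ex Knear.
have [_ _ _ _ far] := pP (kk m).
apply: (far (fun r => K r m)) => [r|r t|r].
- exact: (congr1 (fun u : prod_alg (mxalg_seq F (n \o kk)) => u m) (K_star r)).
- have h := congr1 (fun u : prod_alg (mxalg_seq F (n \o kk)) => u m) (K_comm r t).
  apply/eqP; rewrite subr_eq0; apply/eqP; exact: h.
- exact: ltW (Km r).
Qed.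

Theorem corollary6p8 (R : realType) :
  (~ @question1 R 5 R^o /\ ~ @question2 R 5 R^o) /\
  (~ @question1 R 3 (quat R) /\ ~ @question2 R 3 (quat R)).
Proof.
have real5 := @obstructed_real5 R; have quat3 := @obstructed_quat3 R.
split; split; by [exact: obstructed_question1 | exact: obstructed_question2].
Qed.
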